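(* Let $D\subset\mathbb R^n$, $n\ge 2$, be a domain, let $p,q\ge 1$, and let $f:D\to\mathbb R^n$ be a mapping with finite length $(p,q)$-distortion. Then $$M_q(f(\Gamma))\le \int_D K_{I,q}(x,f)\,\rho^q(x)\,dm(x)$$ for every family of curves $\Gamma$ in $D$ and every $\rho\in\operatorname{adm}\Gamma$; and $$M_p(\Gamma)\le \int_{f(E)} K_{I,p}(y,f^{-1},E)\,\rho_*^p(y)\,dm(y)$$ for every measurable set $E\subset D$, every family $\Gamma$ of curves in $E$ and every $\rho_*\in\operatorname{adm} f(\Gamma)$, where $K_{I,p}(y,f^{-1},E):=\sum_{x\in E\cap f^{-1}(y)}K_{O,p}(x,f)$.
   Context: $m$ denotes Lebesgue measure on $\mathbb R^n$. All mappings $f:D\to\mathbb R^n$ are continuous and orientation preserving (the topological degree $\mu(y,f,G)>0$ for every domain $G$ with $\overline G\subset D$ and $y\in f(G)\setminus f(\partial G)$). A curve is a continuous map $\gamma:\Delta\to\mathbb R^n$, $\Delta\subset\mathbb R$ an interval; $f(\Gamma)=\{f\circ\gamma:\gamma\in\Gamma\}$. For a curve family $\Gamma$, a Borel $\rho:\mathbb R^n\to[0,\infty]$ is admissible, $\rho\in\operatorname{adm}\Gamma$, if $\int_\gamma\rho\,|dx|\ge1$ for every locally rectifiable $\gamma\in\Gamma$; the $p$-modulus is $M_p(\Gamma)=\inf_{\rho\in\operatorname{adm}\Gamma}\int_{\mathbb R^n}\rho^p\,dm$ ($=+\infty$ if $\operatorname{adm}\Gamma=\varnothing$). A property holds for $p$-a.e.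 curve of a family if the subfamily where it fails has $p$-modulus zero. $f$ has the $N$-property if $m(f(S))=0$ whenever $m(S)=0$, and the $N^{-1}$-property if $m(f^{-1}(S))=0$ whenever $m(S)=0$. For a locally rectifiable $\gamma:\Delta\to\mathbb R^n$, $l_\gamma:\Delta\to\Delta_\gamma$ is the (signed) length function normalized at some $t_0\in\Delta$ ($l_\gamma(t)=\pm$ length of $\gamma$ between $t_0$ and $t$). If $\tilde\gamma=f\circ\gamma$ is also locally rectifiable, $L_{\gamma,f}:\Delta_\gamma\to\Delta_{\tilde\gamma}$ is the unique nondecreasing function with $L_{\gamma,f}(l_\gamma(t))=l_{\tilde\gamma}(t)$ for all $t\in\Delta$. A curve $\gamma$ in $D$ is a lifting of $\tilde\gamma$ if $\tilde\gamma=f\circ\gamma$. $f$ has property $L^{(1)}_p$ if for $p$-a.e. curve $\gamma$ in $D$, $f\circ\gamma$ is locally rectifiable and $L_{\gamma,f}$ has the $N$-property (maps null sets to null sets); $f$ has property $L^{(2)}_q$ if for $q$-a.e. curve $\tilde\gamma$ in $f(D)$ every lifting $\gamma$ of $\tilde\gamma$ is locally rectifiable and $L_{\gamma,f}$ has the $N^{-1}$-property. $f$ has finite length $(p,q)$-distortion if $f$ is differentiable a.e. in $D$, has the $N$- and $N^{-1}$-properties, and has properties $L^{(1)}_p$ and $L^{(2)}_q$. At points of differentiability: $l(f'(x))=\min_{|h|=1}|f'(x)h|$, $\|f'(x)\|=\max_{|h|=1}|f'(x)h|$, $J(x,f)=\det f'(x)$. For $p,q\ge1$: $K_{I,q}(x,f)=|J(x,f)|/l(f'(x))^q$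 if $J(x,f)\ne0$, $=1$ if $f'(x)=0$, $=\infty$ otherwise; $K_{O,p}(x,f)=\|f'(x)\|^p/|J(x,f)|$ if $J(x,f)\ne0$, $=1$ if $f'(x)=0$, $=\infty$ otherwise. *)

(* Defs.v *)
From HB Require Import structures.
From mathcomp Require Import all_boot all_order all_algebra.
From mathcomp Require Import all_classical all_reals all_analysis.

Set Implicit Arguments.
Unset Strict Implicit.
Unset Printing Implicit Defensive.

Import Order.TTheory GRing.Theory Num.Theory.
Import numFieldNormedType.Exports.

Local Open Scope classical_set_scope.
Local Open Scope ring_scope.

Section Defs.
Variables (R : realType) (n : nat).
Local Notation V := 'rV[R]_n.

(** Euclidean norm on R^n (the library norm on 'rV is the sup-norm). *)
Definition enorm (v : V) : R := Num.sqrt (\sum_(i < n) v ord0 i ^+ 2).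

Definition box (a b : V) : set V :=
  [set x : V | forall i, a ord0 i <= x ord0 i <= b ord0 i].
Definition boxvol (a b : V) : R := \prod_(i < n) Num.max 0 (b ord0 i - a ord0 i).

Definition lebn (A : set V) : \bar R :=
  ereal_inf [set s | exists a b : nat -> V,
     A `<=` \bigcup_k box (a k) (b k) /\
     s = (\sum_(0 <= k <oo) (boxvol (a k) (b k))%:E)%E].

Definition leb_measurable (E : set V) : Prop :=
  forall T : set V, lebn T = (lebn (T `&` E) + lebn (T `\` E))%E.

Definition borel_set (A : set V) : Prop := <<s (@open V) >> A.
Definition borel_fun (rho : V -> \bar R) : Prop :=
  forall r : R, borel_set [set x | (r%:E < rho x)%E].

(** Lebesgue integral over R^n of a nonnegative (measurable) function,
    given by the layer-cake formula  int g dm = int_0^oo m({g > t}) dt. *)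
Definition intn (g : V -> \bar R) : \bar R :=
  (\int[lebesgue_measure]_(t in `]0%R, +oo[) lebn [set x | (t%:E < g x)%E])%E.

Definition intn_on (A : set V) (g : V -> \bar R) : \bar R :=
  intn (fun x => if `[< A x >] then g x else 0%E).

(** A curve: a continuous map gamma : Delta -> R^n, Delta a (nonempty) interval.
    We store the interval Delta and a map R -> R^n whose values off Delta are
    irrelevant. *)
Record curve := Curve { cdom : interval R ; cpath : R -> V }.

Definition is_curve (g : curve) : Prop :=
  [set` cdom g] !=set0 /\ {within [set` cdom g], continuous (cpath g)}.

Definition curve_in (A : set V) (g : curve) : Prop :=
  is_curve g /\ cpath g @` [set` cdom g] `<=` A.

Definition clength (g : curve) (a b : R) : \bar R :=
  ereal_sup [set s | exists (k : nat) (t : nat -> R),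
     t 0%N = a /\ t k = b /\ (forall i, (i < k)%N -> t i <= t i.+1) /\
     s = (\sum_(i < k) enorm (cpath g (t i.+1) - cpath g (t i)))%:E].

Definition loc_rectifiable (g : curve) : Prop :=
  forall a b, a \in cdom g -> b \in cdom g -> a <= b -> (clength g a b < +oo)%E.

Definition slength (g : curve) (t0 t : R) : R :=
  if t0 <= t then fine (clength g t0 t) else - fine (clength g t t0).

Definition arcparam (g : curve) (a b s : R) : V :=
  cpath g (get [set t | a <= t <= b /\ fine (clength g a t) = s]).

Definition line_int (rho : V -> \bar R) (g : curve) : \bar R :=
  ereal_sup [set s | exists a b, a \in cdom g /\ b \in cdom g /\ a <= b /\
     s = (\int[lebesgue_measure]_(u in `[0%R, fine (clength g a b)])
             rho (arcparam g a b u))%E].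

Definition admissible (Gam : set curve) (rho : V -> \bar R) : Prop :=
  borel_fun rho /\ (forall x, (0 <= rho x)%E) /\
  forall g, Gam g -> loc_rectifiable g -> (1 <= line_int rho g)%E.

Definition modulus (p : R) (Gam : set curve) : \bar R :=
  ereal_inf [set intn (fun x => rho x `^ p)%E | rho in admissible Gam].

Definition ae_curve (p : R) (A : set V) (P : curve -> Prop) : Prop :=
  modulus p [set g | curve_in A g /\ ~ P g] = 0%E.

End Defs.

Arguments curve R n : clear implicits.

Section Mapping.
Variables (R : realType) (n : nat).
Local Notation V := 'rV[R]_n.

Definition fcurve (f : V -> V) (g : curve R n) : curve R n :=
  Curve (cdom g) (f \o cpath g).
Definition fimage (f : V -> V) (Gam : set (curve R n)) : set (curve R n) :=
  fcurve f @` Gam.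

Definition null1 (S : set R) : Prop := (@lebesgue_measure R).-negligible S.

(** Delta_gamma = l_gamma(Delta), and L_{gamma,f} : Delta_gamma -> Delta_{f o gamma}
    with L(l_gamma(t)) = l_{f o gamma}(t). *)
Definition ldom (g : curve R n) (t0 : R) : set R := slength g t0 @` [set` cdom g].
Definition Lfun (f : V -> V) (g : curve R n) (t0 s : R) : R :=
  slength (fcurve f g) t0 (get [set t | t \in cdom g /\ slength g t0 t = s]).

Definition L1_prop (f : V -> V) (g : curve R n) : Prop :=
  loc_rectifiable g /\ loc_rectifiable (fcurve f g) /\
  forall t0, t0 \in cdom g ->
    forall S, S `<=` ldom g t0 -> null1 S -> null1 (Lfun f g t0 @` S).

Definition L2_prop (D : set V) (f : V -> V) (gt : curve R n) : Prop :=
  forall g : curve R n, curve_in D g ->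
    cdom g = cdom gt -> {in [set` cdom g], f \o cpath g =1 cpath gt} ->
    loc_rectifiable g /\ loc_rectifiable gt /\
    forall t0, t0 \in cdom g ->
      forall S, S `<=` ldom gt t0 -> null1 S ->
        null1 (ldom g t0 `&` Lfun f g t0 @^-1` S).

Definition jacmx (f : V -> V) (x : V) : 'M[R]_n :=
  \matrix_(i < n, j < n) ('d f x (delta_mx ord0 i)) ord0 j.
Definition jac (f : V -> V) (x : V) : R := \det (jacmx f x).
Definition lmin (f : V -> V) (x : V) : R :=
  inf [set enorm ('d f x h) | h in [set h : V | enorm h = 1]].
Definition opnorm (f : V -> V) (x : V) : R :=
  sup [set enorm ('d f x h) | h in [set h : V | enorm h = 1]].

(** K_{I,q}(x,f) and K_{O,p}(x,f); set to 0 at points of non-differentiability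
    (a null set, irrelevant for the statement). *)
Definition KI (q : R) (f : V -> V) (x : V) : \bar R :=
  if `[< differentiable f x >] then
    if jac f x != 0 then (`|jac f x| / lmin f x `^ q)%:E
    else if jacmx f x == 0 then 1%E else +oo%E
  else 0%E.
Definition KO (p : R) (f : V -> V) (x : V) : \bar R :=
  if `[< differentiable f x >] then
    if jac f x != 0 then (opnorm f x `^ p / `|jac f x|)%:E
    else if jacmx f x == 0 then 1%E else +oo%E
  else 0%E.

Definition KIinv (p : R) (f : V -> V) (E : set V) (y : V) : \bar R :=
  (\esum_(x in E `&` f @^-1` [set y]) KO p f x)%E.

Definition domain (A : set V) : Prop := open A /\ connected A /\ A !=set0.

Definition C1_on (U : set V) (g : V -> V) : Prop :=
  (forall x, U x -> differentiable g x) /\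
  forall i j, {in U, continuous (fun x => jacmx g x i j)}.

(** mu(y, f, G) > 0, with the Brouwer degree computed through any C^1
    approximation g of f on cl G (sup_{cl G}|g - f| < dist(y, f(bd G)))
    having y as a regular value: deg = sum_{x in G, g x = y} sign J(x,g). *)
Definition degree_pos (f : V -> V) (G : set V) (y : V) : Prop :=
  forall (g : V -> V) (U : set V) (eps : R),
    open U -> closure G `<=` U -> C1_on U g ->
    (forall x, closure G x -> `|g x - f x| <= eps) ->
    (forall z, (closure G `\` G) z -> eps < `|y - f z|) ->
    (forall x, closure G x -> g x = y -> jac g x != 0) ->
    forall s : seq V, uniq s -> (forall x, x \in s <-> (G x /\ g x = y)) ->
      0 < \sum_(x <- s) Num.sg (jac g x).

Definition orientation_preserving (D : set V) (f : V -> V) : Prop :=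
  forall G : set V, domain G -> compact (closure G) -> closure G `<=` D ->
    forall y, (f @` G) y -> ~ (f @` (closure G `\` G)) y -> degree_pos f G y.

Definition N_prop (D : set V) (f : V -> V) : Prop :=
  forall S, S `<=` D -> lebn S = 0%E -> lebn (f @` S) = 0%E.
Definition Ninv_prop (D : set V) (f : V -> V) : Prop :=
  forall S, lebn S = 0%E -> lebn (D `&` f @^-1` S) = 0%E.

Definition finite_length_distortion (p q : R) (D : set V) (f : V -> V) : Prop :=
  lebn [set x | D x /\ ~ differentiable f x] = 0%E /\
  N_prop D f /\ Ninv_prop D f /\
  ae_curve p D (L1_prop f) /\
  ae_curve q (f @` D) (L2_prop D f).

End Mapping.

(* Main.v *)
(** By Sard's theorem and the N- and N^-1-properties, [f] is differentiable with nonzero Jacobian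
    almost everywhere. For [tau > 1] the set of such points is covered by countably many compact
    sets on which [f] is affine up to the factor [tau]: it changes volumes like a constant
    Jacobian [1 / beta] and lengths by factors between [l] and [L], where [l] and [L] are close to
    the smallest and largest stretching of the derivative. Made disjoint, they give Borel pieces
    [B k] that exhaust the domain up to a null set [G].

    For the first inequality the test function for [f Gam] is
    [y |-> sup {rho x / l k : x in B k, f x = y}], for the second one the test function for [Gam]
    is [x |-> L k * rhos (f x)] on [E `&` B k]. By the L^(2)-, respectively L^(1)-property, for all
    curves outside an exceptional family the length function of the lifting, respectively of the
    image, is a change of parameter that ignores null sets, so that comparing line integrals
    piece by piece shows that the test function is admissible. On each piece the level sets of the
    test function are compared by volume with those of the right-hand side, which costs powers of
    [tau]; finally [tau] tends to 1.

    Since the integral is the layer-cake integral of an outer measure, subadditivity for suprema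
    and superadditivity over disjoint measurable sets are all that is needed. *)

Require Import Defs.
From HB Require Import structures.
From mathcomp Require Import all_boot all_order all_algebra fingroup perm.
From mathcomp Require Import all_classical all_reals all_analysis measurable_realfun.
From mathcomp Require Import ring lra.
Import Order.TTheory GRing.Theory Num.Theory.
Import numFieldNormedType.Exports.
Local Open Scope classical_set_scope.
Local Open Scope ring_scope.
Set Implicit Arguments.
Unset Strict Implicit.
Unset Printing Implicit Defensive.

(** * Lebesgue outer measure *)

Section Lebn.
Variables (R : realType) (n : nat).
Local Notation V := 'rV[R]_n.+1.
Local Notation lebn := (@lebn R n.+1).
Implicit Types (a b x y : V) (A B : set V).

(** A curve may spend positive length in the null set [G], where no piece controls it. The test
    function is therefore raised to +oo on [G], for the first inequality on a null hull of its
    image: a curve of positive length there has infinite line integral, and for the others the N- or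
    N^-1-property carries the null set of parameters across.

    A piece bounds chords only, while a curve may meet it in any measurable set of parameters.
    Length on such a set is controlled by viewing length as the least increment of a function
    dominating all chords: a competitor is built that grows by the chord bound on the set and by the
    full length across its gaps.

    The pieces are indexed by rational matrices approximating the inverse of the derivative.
    Followed by such a matrix, [f] is a small perturbation of the identity, so both volume bounds
    are Lipschitz estimates.

    The loss is tau^(p+2), or tau^(q+2): one factor per unit of the exponent from the stretching,
    one from the volumes, one from the Jacobian. *)

Lemma boxvol_ge0 a b : 0 <= boxvol a b.
Proof. by apply: prodr_ge0 => i _; rewrite le_max lexx. Qed.

Lemma boxvol_eq0 a b i : b ord0 i <= a ord0 i -> boxvol a b = 0.
Proof.
move=> h; rewrite /boxvol (bigD1 i)//= (_ : Num.max _ _ = 0) ?mul0r//.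
by apply/max_idPl; rewrite subr_le0.
Qed.

Lemma lebn_ge0 A : (0 <= lebn A)%E.
Proof.
apply: le_ereal_inf_tmp => _ [a [b [_ ->]]].
by apply: nneseries_ge0 => k _ _; rewrite lee_fin boxvol_ge0.
Qed.

Lemma le_lebn : {homo lebn : A B / A `<=` B >-> (A <= B)%E}.
Proof.
move=> A B AB; apply: ereal_inf_le_tmp => _ [a [b [Bab ->]]].
by exists a, b; split => //; exact: subset_trans Bab.
Qed.

Lemma lebn_cover A (a b : nat -> V) : A `<=` \bigcup_k box (a k) (b k) ->
  (lebn A <= \sum_(0 <= k <oo) (boxvol (a k) (b k))%:E)%E.
Proof. by move=> h; apply: ereal_inf_lbound; exists a, b. Qed.

(** Its corners are in the wrong order, so it is empty and of volume 0; it pads finite covers to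
    sequences. *)
Definition box0 : V * V := (const_mx 1, const_mx 0).

Lemma boxvol_box0 : boxvol box0.1 box0.2 = 0.
Proof. by rewrite (@boxvol_eq0 _ _ ord0)//= !mxE. Qed.

Lemma lebn_box a b : (lebn (box a b) <= (boxvol a b)%:E)%E.
Proof.
pose F k := if k is 0%N then (a, b) else box0.
apply: le_trans (@lebn_cover _ (fun k => (F k).1) (fun k => (F k).2) _) _.
  by move=> x hx; exists 0%N.
rewrite nneseries_recl//; last by move=> *; rewrite lee_fin boxvol_ge0.
rewrite eseries_cond/= eseries0 ?adde0// => -[|]//= k _ _.
by rewrite boxvol_box0.
Qed.

Lemma lebn0 : lebn set0 = 0%E.
Proof.
apply/eqP; rewrite eq_le lebn_ge0 andbT.
apply: le_trans (@lebn_cover _ (fun k => box0.1) (fun k => box0.2) _) _ => //.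
by rewrite eseries0// => k _ _; rewrite boxvol_box0.
Qed.

Lemma lebn_approx A (e : R) : 0 < e -> (lebn A < +oo)%E ->
  exists G : nat -> V * V, A `<=` \bigcup_k box (G k).1 (G k).2 /\
   (\sum_(0 <= k <oo) (boxvol (G k).1 (G k).2)%:E <= lebn A + e%:E)%E.
Proof.
move=> e0 Aoo.
have fA : lebn A \is a fin_num by rewrite ge0_fin_numE ?lebn_ge0.
have [_ [a [b [Aab ->]]] h] := lb_ereal_inf_adherent e0 fA.
by exists (fun k => (a k, b k)); split => //; exact: ltW.
Qed.

(** The k-th set is covered by boxes with excess e / 2^(k+1), and the double sequence of boxes is
    enumerated by a bijection between [nat] and [nat * nat]. The total volume is computed as a sum
    over pairs, where the order is immaterial. *)
Lemma lebn_sigma_subadditive : sigma_subadditive lebn.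
Proof.
move=> A; have [[i ioo]|] := pselect (exists i, lebn (A i) = +oo%E).
  rewrite (eseries_pinfty _ _ ioo) ?leey// => k _.
  by rewrite -ltNye (lt_le_trans _ (lebn_ge0 _)).
rewrite -forallNE => Aoo.
suff add2e (e : {posnum R}) :
    (lebn (\bigcup_n A n) <= \sum_(0 <= i <oo) lebn (A i) + e%:num%:E)%E.
  by apply/lee_addgt0Pr => _/posnumP[].
rewrite (le_trans _ (epsilon_trick _ _ _))//; last first.
  by move=> k; exact: lebn_ge0.
have /choice[G PG] : forall k, exists G : nat -> V * V,
    A k `<=` \bigcup_j box (G j).1 (G j).2 /\
   (\sum_(0 <= j <oo) (boxvol (G j).1 (G j).2)%:E
     <= lebn (A k) + (e%:num / (2 ^ k.+1)%:R)%:E)%E.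
  move=> k; apply: lebn_approx; first by [].
  by rewrite ltey; apply/eqP; exact: Aoo.
pose g : nat * nat -> \bar R :=
  fun ij => (boxvol (G ij.1 ij.2).1 (G ij.1 ij.2).2)%:E.
have g0 z : (0 <= g z)%E by rewrite lee_fin boxvol_ge0.
apply: (@le_trans _ _ (\esum_(i in setT) g i)%E).
  have /card_esym/ppcard_eqP[f] := card_nat2.
  have -> : (\esum_(i in setT) g i = \sum_(0 <= k <oo) g (f k))%E.
    rewrite -(esum_pred_image g f xpredT)//.
    rewrite [X in _ = esum X _](_ : _ = setT)//.
    by apply/seteqP; split => // ij _; exists (f^-1%FUN ij) => //; rewrite invK ?inE.
    by move=> i j _ _ /(congr1 f^-1%FUN); rewrite !funK ?inE.
  have H : \bigcup_k A k `<=` \bigcup_k box (G (f k).1 (f k).2).1 (G (f k).1 (f k).2).2.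
    move=> x [i _ /(PG i).1 [j _ xj]].
    by exists (f^-1%FUN (i, j)) => //=; rewrite invK ?inE.
  exact: lebn_cover H.
rewrite (_ : esum _ _ = \sum_(0 <= i <oo) \sum_(0 <= j <oo) g (i, j))%E; last first.
  pose J : nat -> set (nat * nat) := fun i => [set (i, j) | j in setT].
  rewrite (_ : setT = \bigcup_k J k); last first.
    by rewrite predeqE => -[a b]; split => // _; exists a => //; exists b.
  rewrite esum_bigcupT /=; last 2 first.
    - apply/trivIsetP => i j _ _ ij.
      rewrite predeqE => -[k m] /=; split => //= -[] [_] _ [<-{k} _].
      by move=> [m' _] [] /esym/eqP; rewrite (negbTE ij).
    - by move=> /= [k m].
  rewrite -(image_id [set: nat]) -fun_true esum_pred_image//; last first.
    by move=> k _; exact: esum_ge0.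
  apply: eq_eseriesr => /= j _.
  rewrite -(esum_pred_image g (pair j) predT)//=; last first.
    by move=> ? ? _ _; exact: (@can_inj _ _ _ snd).
  by congr esum; rewrite predeqE => -[a b]; split; move=> [i _ <-]; exists i.
apply: lee_nneseries => [k _ _|k _]; first exact: nneseries_ge0.
exact: (PG k).2.
Qed.

HB.instance Definition _ := isOuterMeasure.Build R V lebn lebn0 lebn_ge0
  le_lebn lebn_sigma_subadditive.

Definition lebn_outer : {outer_measure set V -> \bar R} := lebn.

Lemma leb_measurableE A : leb_measurable A <-> lebn.-caratheodory A.
Proof. by split => h X; rewrite {1}h setDE. Qed.

End Lebn.

Section RowNorm.
Variables (R : realType) (n : nat).
Implicit Type v : 'rV[R]_n.

Lemma rV_norm_le v (s : R) : 0 <= s -> (forall i, `|v ord0 i| <= s) -> `|v| <= s.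
Proof.
move=> s0 h; have -> : `|v| = mx_norm v by [].
rewrite mx_normrE; apply/bigmax_leP; split => //= -[i j] _ /=.
by rewrite (ord1 i).
Qed.

Lemma rV_norm_lt v (s : R) : 0 < s -> (forall i, `|v ord0 i| < s) -> `|v| < s.
Proof.
move=> s0 h; have -> : `|v| = mx_norm v by [].
rewrite mx_normrE; apply/bigmax_ltP; split => //= -[i j] _ /=.
by rewrite (ord1 i).
Qed.

Lemma coord_le_norm v i : `|v ord0 i| <= `|v|.
Proof.
have -> : `|v| = mx_norm v by [].
by rewrite mx_normrE; exact: (le_bigmax _ (fun ij => `|v ij.1 ij.2|) (ord0, i)).
Qed.

End RowNorm.

(** * Borel sets: Caratheodory measurability and hulls *)

Section Borel.
Variables (R : realType) (n : nat).
Local Notation V := 'rV[R]_n.+1.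
Local Notation lebn := (@lebn R n.+1).
Implicit Types (a b x y : V) (A B : set V).

Lemma minmax_split (u v c : R) :
  Num.max 0 (Num.min v c - u) + Num.max 0 (v - Num.max u c) <= Num.max 0 (v - u).
Proof.
case: (leP u c) => uc; case: (leP v c) => vc.
- rewrite [X in _ + X <= _]max_l ?subr_le0// addr0//.
- rewrite !max_r ?subr_ge0 ?(ltW vc)//; last by rewrite (le_trans uc) ?ltW.
  by rewrite addrC subrKA.
- rewrite !max_l ?subr_le0 ?addr0 ?(ltW (le_lt_trans vc uc))//.
- rewrite (max_l (_ : c - u <= 0)) ?add0r// subr_le0; exact: ltW.
Qed.

Let row_upd a i c : V := \row_j (if j == i then c else a ord0 j).

(** The hyperplane cuts each box of a cover into two boxes whose volumes add up to at most the old
    one. *)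
Lemma caratheodory_halfspace (i : 'I_n.+1) (c : R) :
  lebn.-caratheodory [set x : V | x ord0 i <= c].
Proof.
set H := [set _ | _]; apply: le_caratheodory_measurable.
suff h X : (lebn (X `&` H) + lebn (X `&` ~` H) <= lebn X)%E by exact: h.
have [Xoo|] := ltP (lebn X) +oo%E; last by rewrite leye_eq => /eqP ->; rewrite leey.
apply/lee_addgt0Pr => e e0; have [G [XG Ge]] := lebn_approx e0 Xoo.
apply: le_trans Ge.
pose G1 k := row_upd (G k).2 i (Num.min ((G k).2 ord0 i) c).
pose G2 k := row_upd (G k).1 i (Num.max ((G k).1 ord0 i) c).
have h1 : (lebn (X `&` H) <= \sum_(0 <= k <oo) (boxvol (G k).1 (G1 k))%:E)%E.
  apply: lebn_cover => x [/XG[k _ /= xk] Hx]; exists k => //= j.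
  have /andP[-> /= h] := xk j; rewrite mxE; case: eqP => // ->.
  by rewrite le_min Hx andbT; case/andP: (xk i).
have h2 : (lebn (X `&` ~` H) <= \sum_(0 <= k <oo) (boxvol (G2 k) (G k).2)%:E)%E.
  apply: lebn_cover => x [/XG[k _ /= xk] Hx]; exists k => //= j.
  have /andP[h -> /=] := xk j; rewrite mxE andbT; case: eqP => // ->.
  have /ltW cx : c < x ord0 i by rewrite ltNge; exact/negP.
  by rewrite ge_max cx andbT; case/andP: (xk i).
apply: le_trans (leeD h1 h2) _.
rewrite -nneseriesD; do ?by move=> *; rewrite lee_fin boxvol_ge0.
apply: lee_nneseries => [k _ _|k _]; first by rewrite adde_ge0// lee_fin boxvol_ge0.
rewrite -EFinD lee_fin.
(* All three boxes share the sides in the directions other than [i], so that the inequality reduces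
   to the one-dimensional [minmax_split]. *)
pose Pi := \prod_(j | j != i) Num.max 0 ((G k).2 ord0 j - (G k).1 ord0 j).
have bv (u v : V) : (forall j, j != i -> u ord0 j = (G k).1 ord0 j) ->
    (forall j, j != i -> v ord0 j = (G k).2 ord0 j) ->
    boxvol u v = Num.max 0 (v ord0 i - u ord0 i) * Pi.
  move=> uE vE; rewrite /boxvol (bigD1 i)//=; congr (_ * _).
  by apply: eq_bigr => j ji; rewrite uE ?vE.
rewrite (bv _ (G1 k))//; last by move=> j /negbTE ji; rewrite mxE ji.
rewrite (bv (G2 k))//; last by move=> j /negbTE ji; rewrite mxE ji.
rewrite (bv (G k).1 (G k).2)//.
rewrite -mulrDl ler_wpM2r//; first by apply: prodr_ge0 => *; rewrite le_max lexx.
rewrite !mxE eqxx; set u := (G k).1 _ _; set v := (G k).2 _ _.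
exact: minmax_split.
Qed.

Lemma caratheodory_bigcup_count (T : countType) (F : T -> set V) (P : set T) :
  (forall i, P i -> lebn.-caratheodory (F i)) ->
  lebn.-caratheodory (\bigcup_(i in P) F i).
Proof.
move=> mF.
pose F' k := if unpickle k is Some i then if `[< P i >] then F i else set0 else set0.
rewrite (_ : \bigcup_(i in P) F i = \bigcup_k F' k).
  apply: caratheodory_measurable_bigcup => k; rewrite /F'.
  case: unpickle => [i|]; last exact: caratheodory_measurable_set0.
  by case: asboolP => [/mF//|_]; exact: caratheodory_measurable_set0.
apply/seteqP; split=> [x [i Pi Fi]|x [k _]].
  by exists (pickle i) => //; rewrite /F' pickleK; case: asboolP.
by rewrite /F'; case: unpickle => // i; case: asboolP => // Pi Fi; exists i.
Qed.

(** Half-open, because these are the boxes cut out by the half-spaces x_i <= c and their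
    complements. *)
Let hbox a b : set V := [set x | forall i, a ord0 i < x ord0 i <= b ord0 i].

Lemma caratheodory_hbox a b : lebn.-caratheodory (hbox a b).
Proof.
rewrite (_ : hbox a b = ~` \bigcup_(i in [set: 'I_n.+1])
   ([set x : V | x ord0 i <= a ord0 i] `|` ~` [set x : V | x ord0 i <= b ord0 i])).
  apply/caratheodory_measurable_setC/caratheodory_bigcup_count => i _.
  apply: caratheodory_measurable_setU; first exact: caratheodory_halfspace.
  exact/caratheodory_measurable_setC/caratheodory_halfspace.
apply/seteqP; split => [x h [i _ [/=|/=]]|x /= h i].
- by have /andP[] := h i; rewrite ltNge => /negP.
- by have /andP[] := h i.
apply/andP; split; first by rewrite ltNge; apply/negP => xa; apply: h; exists i => //; left.
by apply: contrapT => xb; apply: h; exists i => //; right.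
Qed.

(** An open set is the union of the countably many half-open boxes with rational corners that it
    contains. *)
Lemma caratheodory_open A : open A -> lebn.-caratheodory A.
Proof.
move=> oA.
pose rrow (q : 'rV[rat]_n.+1) : V := map_mx ratr q.
rewrite (_ : A = \bigcup_(q in [set q : 'rV[rat]_n.+1 * 'rV[rat]_n.+1 |
   hbox (rrow q.1) (rrow q.2) `<=` A]) hbox (rrow q.1) (rrow q.2)).
  by apply: caratheodory_bigcup_count => q _; exact: caratheodory_hbox.
apply/seteqP; split => [x Ax|x [q /= qA /qA]//].
have /nbhs_ballP[r /= r0 xrA] : nbhs x A by exact: open_nbhs_nbhs.
have /choice[ql hl] : forall i : 'I_n.+1, exists q : rat, ratr q \in `](x ord0 i - r), (x ord0 i)[.
  by move=> i; apply: rat_in_itvoo; rewrite ltrBlDr ltrDl.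
have /choice[qr hr] : forall i : 'I_n.+1, exists q : rat, ratr q \in `](x ord0 i), (x ord0 i + r)[.
  by move=> i; apply: rat_in_itvoo; rewrite ltrDl.
exists (\row_i ql i, \row_i qr i) => /=.
  move=> y /= hy; apply: xrA; rewrite -ball_normE /ball_ /=.
  apply: rV_norm_lt => // j; rewrite !mxE.
  have := hl j; have := hr j; have := hy j; rewrite !mxE !in_itv/= ltr_norml.
  by move=> /andP[? ?] /andP[? ?] /andP[? ?]; apply/andP; split; lra.
move=> i; rewrite !mxE; have := hl i; have := hr i; rewrite !in_itv/=.
by move=> /andP[? ?] /andP[? ?]; apply/andP; split; lra.
Qed.

Lemma borel_caratheodory A : borel_set A -> lebn.-caratheodory A.
Proof.
apply: smallest_sub; last exact: caratheodory_open.
split; first exact: caratheodory_measurable_set0.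
- by move=> B mB; rewrite setTD; exact: caratheodory_measurable_setC.
- exact: caratheodory_measurable_bigcup.
Qed.

Lemma borel_open A : open A -> borel_set A.
Proof. exact: sub_sigma_algebra. Qed.

Lemma borel_setC A : borel_set A -> borel_set (~` A).
Proof. by move=> bA; rewrite -setTD; exact: sigma_algebraCD. Qed.

Lemma borel_closed A : closed A -> borel_set A.
Proof. by move=> cA; rewrite -(setCK A); apply: borel_setC; apply: borel_open; exact: closed_openC. Qed.

Lemma borel_bigcup (F : nat -> set V) : (forall i, borel_set (F i)) ->
  borel_set (\bigcup_i F i).
Proof. exact: sigma_algebra_bigcup. Qed.

Lemma borel_set0 : borel_set (@set0 V).
Proof. exact: sigma_algebra0. Qed.

Lemma borel_bigcup_count (T : countType) (F : T -> set V) (P : set T) :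
  (forall i, P i -> borel_set (F i)) -> borel_set (\bigcup_(i in P) F i).
Proof.
move=> mF.
pose F' k := if unpickle k is Some i then if `[< P i >] then F i else set0 else set0.
rewrite (_ : \bigcup_(i in P) F i = \bigcup_k F' k).
  apply: borel_bigcup => k; rewrite /F'.
  case: unpickle => [i|]; last exact: borel_set0.
  by case: asboolP => [/mF//|_]; exact: borel_set0.
apply/seteqP; split=> [x [i Pi Fi]|x [k _]].
  by exists (pickle i) => //; rewrite /F' pickleK; case: asboolP.
by rewrite /F'; case: unpickle => // i; case: asboolP => // Pi Fi; exists i.
Qed.

Lemma borel_bigcap_count (T : countType) (F : T -> set V) (P : set T) :
  (forall i, P i -> borel_set (F i)) -> borel_set (\bigcap_(i in P) F i).
Proof.
move=> bF; rewrite -(setCK (\bigcap_(i in P) F i)) setC_bigcap.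
by apply: borel_setC; apply: borel_bigcup_count => i Pi; apply: borel_setC; exact: bF.
Qed.

Lemma borel_setU A B : borel_set A -> borel_set B -> borel_set (A `|` B).
Proof.
move=> bA bB; rewrite (_ : A `|` B = \bigcup_(b in [set: bool]) if b then A else B).
  have F (b : bool) : borel_set (if b then A else B) by case: b.
  by apply: borel_bigcup_count => b _; exact: F.
by apply/seteqP; split => [x [] h|x [[] _ h]]; [exists true|exists false|left|right].
Qed.

Lemma borel_setI A B : borel_set A -> borel_set B -> borel_set (A `&` B).
Proof.
move=> bA bB; rewrite -(setCK (A `&` B)) setCI.
by apply: borel_setC; apply: borel_setU; exact: borel_setC.
Qed.

Lemma borel_setD A B : borel_set A -> borel_set B -> borel_set (A `\` B).
Proof. by move=> bA bB; rewrite setDE; apply: borel_setI => //; exact: borel_setC. Qed.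

Lemma closed_box a b : closed (box a b).
Proof.
rewrite (_ : box a b = \bigcap_(i in [set: 'I_n.+1])
   ((fun x : V => x ord0 i) @^-1` `[a ord0 i, b ord0 i]%classic)).
  apply: closed_bigI => i _; apply: preimage_closed; last exact: itv_closed.
  by move=> x _; exact: coord_continuous.
apply/seteqP; split => [x h i _|x h i] /=; first by rewrite in_itv/=.
by have := h i I; rewrite /= in_itv.
Qed.

(** For finite measure, intersect unions of closed boxes that cover [A] with excess 1/(k+1). *)
Lemma lebn_hull A : exists H, [/\ borel_set H, A `<=` H & lebn H = lebn A].
Proof.
have [Aoo|] := ltP (lebn A) +oo%E; last first.
  rewrite leye_eq => /eqP Aoo; exists setT; split => //.
    by apply: borel_open; exact: openT.
  by apply/eqP; rewrite Aoo -leye_eq -Aoo; exact: le_lebn.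
have /choice[G hG] : forall k, exists G : nat -> V * V,
    A `<=` \bigcup_j box (G j).1 (G j).2 /\
   (\sum_(0 <= j <oo) (boxvol (G j).1 (G j).2)%:E <= lebn A + k.+1%:R^-1%:E)%E.
  by move=> k; apply: lebn_approx.
pose H := \bigcap_(k in setT) \bigcup_j box (G k j).1 (G k j).2.
have AH : A `<=` H by move=> x Ax k _; exact: (hG k).1.
exists H; split => //.
  by apply: borel_bigcap_count => k _; apply: borel_bigcup => j; apply: borel_closed; exact: closed_box.
apply/eqP; rewrite eq_le; apply/andP; split; last exact: le_lebn.
apply/lee_addgt0Pr => /= e e0.
have [k _ hk] := near_infty_natSinv_lt (PosNum e0).
have {}hk := hk k (leqnn k).
apply: (@le_trans _ _ (lebn A + k.+1%:R^-1%:E)%E); last by rewrite leeD2l// lee_fin ltW.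
apply: le_trans (hG k).2; apply: lebn_cover.
by move=> x /(_ k I).
Qed.

End Borel.

(** * Volume of Lipschitz images *)

Section Lip.
Variables (R : realType) (n : nat).
Local Notation V := 'rV[R]_n.+1.
Local Notation lebn := (@lebn R n.+1).
Implicit Types (a b x y : V) (A B : set V).

(** The left side is a polynomial in [d], hence continuous at 0. *)
Lemma prod_perturb m (c : 'I_m -> R) (e : R) : 0 < e ->
  exists2 d, 0 < d & \prod_i (c i + d) <= \prod_i c i + e.
Proof.
move=> e0; pose p := \prod_i ((c i)%:P + 'X).
have pE d : p.[d] = \prod_i (c i + d).
  by rewrite horner_prod; apply: eq_bigr => i _; rewrite !hornerE.
have /cvgrPdist_lt /(_ _ e0) : horner p x @[x --> (0 : R)] --> p.[0].
  exact: continuous_horner.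
case=> d /= d0 hd; exists (d / 2); first by rewrite divr_gt0.
rewrite -pE; have := hd (d / 2); rewrite /= sub0r normrN gtr0_norm ?divr_gt0//.
rewrite ltr_pdivrMr// ltr_pMr// ltr1n => /(_ isT).
rewrite pE; under eq_bigr do rewrite addr0.
by rewrite ltr_distlC => /andP[_ /ltW].
Qed.

Lemma lebn_bigsetU (T : Type) (r : seq T) (P : pred T) (F : T -> set V) :
  (lebn (\big[setU/set0]_(i <- r | P i) F i) <= \sum_(i <- r | P i) lebn (F i))%E.
Proof.
elim/big_ind2 : _ => [|X x Y y Xx Yy|//]; first by rewrite lebn0.
by apply: le_trans (leeD Xx Yy); exact: (outer_measureU2 (lebn_outer R n)).
Qed.

Section lipschitz.
Variables (A : set V) (g : V -> V) (K : 'I_n.+1 -> R).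
Hypothesis K0 : forall i, 0 < K i.
Hypothesis gK : forall x y i, A x -> A y ->
  `|g y ord0 i - g x ord0 i| <= K i * `|y - x|.

(** The cube has diameter [s] in the sup norm, so the i-th coordinate of the image stays in an
    interval of length K_i s. Separate constants for the coordinates make the bound sharp for
    diagonal matrices and for the thin images in Sard's theorem. *)
Lemma lebn_lip_cube c (s : R) : 0 < s ->
  (lebn (g @` (A `&` box c (c + const_mx s))) <= (\prod_i (K i * s))%:E)%E.
Proof.
move=> s0; set Q := A `&` _.
have [->|/set0P[x0 Qx0]] := eqVneq Q set0.
  rewrite image_set0 lebn0 lee_fin; apply: prodr_ge0 => i _.
  by rewrite mulr_ge0// ltW.
pose S i := [set g x ord0 i | x in Q].
have S0 i : S i !=set0 by exists (g x0 ord0 i); exists x0.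
have Qd x y : Q x -> Q y -> `|y - x| <= s.
  move=> [_ Qx] [_ Qy]; apply: rV_norm_le => [|i]; first exact: ltW.
  rewrite !mxE; have := Qx i; have := Qy i; rewrite !mxE ler_norml.
  by move=> /andP[? ?] /andP[? ?]; apply/andP; split; lra.
have Sd i u v : S i u -> S i v -> v <= u + K i * s.
  move=> [x Qx <-] [y Qy <-].
  have := gK i Qx.1 Qy.1; have : K i * `|y - x| <= K i * s by rewrite ler_wpM2l ?Qd// ltW.
  by move=> h1 h2; have := le_trans h2 h1; rewrite ler_norml => /andP[_]; lra.
have Sub i : has_ubound (S i).
  have [u Su] := S0 i; exists (u + K i * s) => v Sv; exact: Sd.
have Slb i : has_lbound (S i).
  have [u Su] := S0 i; exists (u - K i * s) => v Sv; have := Sd i v u Sv Su; lra.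
apply: (@le_trans _ _ (lebn (box (\row_i inf (S i)) (\row_i sup (S i))))).
  apply: le_lebn => _ [x Qx <-] i; rewrite !mxE.
  by rewrite ge_inf ?ub_le_sup//; exists x.
apply: le_trans (lebn_box _ _) _; rewrite lee_fin; apply: ler_prod => i _.
rewrite le_max lexx/= ge_max mulr_ge0 ?(ltW s0) ?(ltW (K0 i))//= !mxE.
rewrite lerBlDr addrC; apply: sup_le_ub => // v Sv.
by rewrite -lerBlDr; apply: lb_le_inf => // u Su; rewrite lerBlDr; exact: Sd.
Qed.

(** The box is covered by a grid of cubes of side [d]; rounding up to whole cubes enlarges each side
    by at most [d]. *)
Lemma lebn_lip_box a b (d : R) : 0 < d ->
  (lebn (g @` (A `&` box a b)) <=
   (\prod_i (K i * (Num.max 0 (b ord0 i - a ord0 i) + d)))%:E)%E.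
Proof.
move=> d0; pose c i := Num.max 0 (b ord0 i - a ord0 i).
have c0 i : 0 <= c i by rewrite le_max lexx.
pose m i := (Num.truncn (c i / d)).+1.
(* A common bound, so that the cubes are indexed by functions into a single ordinal type; [Fa] cuts
   the i-th index down to [m i] values. *)
pose M := (\max_i m i)%N.
have mM i : (m i <= M)%N by exact: leq_bigmax.
pose Fa (i : 'I_n.+1) := [pred k : 'I_M | (k < m i)%N].
pose C (k : {ffun 'I_n.+1 -> 'I_M}) : V := \row_i (a ord0 i + (k i)%:R * d).
apply: (@le_trans _ _ (lebn (\big[setU/set0]_(k in family Fa)
    (g @` (A `&` box (C k) (C k + const_mx d)))))).
  apply: le_lebn => _ [x [Ax ax] <-].
  have x0 i : 0 <= (x ord0 i - a ord0 i) / d.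
    by apply: divr_ge0; [rewrite subr_ge0; case/andP: (ax i)|exact: ltW].
  have kM i : (Num.truncn ((x ord0 i - a ord0 i) / d) < m i)%N.
    rewrite ltnS; apply: le_truncn.
    rewrite ler_pM2r ?invr_gt0// /c le_max lerB ?orbT//.
    by case/andP: (ax i).
  pose k : {ffun 'I_n.+1 -> 'I_M} := [ffun i => Ordinal (leq_trans (kM i) (mM i))].
  rewrite -bigcup_seq_cond; exists k => /=.
    by rewrite mem_index_enum/=; apply/familyP => i; rewrite inE ffunE/=.
  exists x => //; split => // i; rewrite !mxE ffunE /=.
  have /andP[h1 h2] := truncn_itv (x0 i).
  apply/andP; split; first by rewrite addrC -lerBrDr -ler_pdivlMr.
  by move: h2; rewrite ltr_pdivrMr// -natr1 mulrDl mul1r => h2; lra.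
apply: le_trans (lebn_bigsetU _ _ _) _.
apply: (@le_trans _ _ (\sum_(k in family Fa) (\prod_i (K i * d))%:E)%E).
  by apply: lee_sum => k _; exact: lebn_lip_cube.
rewrite sumEFin lee_fin sumr_const card_family.
rewrite foldrE big_map big_enum/= -[leLHS]mulr_natr natr_prod -big_split/=.
apply: ler_prod => i _; rewrite mulr_ge0 ?mulr_ge0 ?ler0n ?(ltW (K0 i)) ?(ltW d0)//=.
rewrite -mulrA ler_pM2l//.
apply: (@le_trans _ _ ((m i)%:R * d)).
  rewrite mulrC ler_pM2r// ler_nat -sum1_card.
  by rewrite (big_ord_narrow (mM i)) sum1_card card_ord.
rewrite -natr1 mulrDl mul1r lerD2r -ler_pdivlMr//.
by rewrite truncn_le divr_ge0// ltW.
Qed.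

(** Half of the error [e] pays for covering [A] by boxes, the other half, distributed geometrically,
    for rounding these boxes up to cubes. *)
Lemma lebn_lip : (lebn (g @` A) <= (\prod_i K i)%:E * lebn A)%E.
Proof.
set k := \prod_i K i; have k0 : 0 < k by apply: prodr_gt0.
have [Aoo|] := ltP (lebn A) +oo%E; last first.
  by rewrite leye_eq => /eqP ->; rewrite gt0_muley ?lte_fin// leey.
apply/lee_addgt0Pr => e e0.
have e20 : 0 < e / (2 * k) by rewrite divr_gt0// mulr_gt0.
have [G [AG Ge]] := lebn_approx e20 Aoo.
have /choice[d hd] : forall j, exists d : R, 0 < d /\
    \prod_i (Num.max 0 ((G j).2 ord0 i - (G j).1 ord0 i) + d) <=
      boxvol (G j).1 (G j).2 + (e / (2 * k)) / (2 ^ j.+1)%:R.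
  move=> j; have [|d d0 hd] := @prod_perturb _
   (fun i => Num.max 0 ((G j).2 ord0 i - (G j).1 ord0 i)) (e / (2 * k) / (2 ^ j.+1)%:R).
    by rewrite divr_gt0// ltr0n expn_gt0.
  by exists d.
apply: (@le_trans _ _ (lebn (\bigcup_j (g @` (A `&` box (G j).1 (G j).2))))).
  apply: le_lebn => _ [x Ax <-].
  by have [j _ xj] := AG _ Ax; exists j => //; exists x.
apply: le_trans (outer_measure_sigma_subadditive (lebn_outer R n) _) _.
apply: (@le_trans _ _ (\sum_(0 <= j <oo) k%:E * ((boxvol (G j).1 (G j).2)%:E +
   ((e / (2 * k)) / (2 ^ j.+1)%:R)%:E))%E).
  apply: lee_nneseries => [j _ _|j _]; first exact: lebn_ge0.
  apply: le_trans (lebn_lip_box _ _ (hd j).1) _.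
  by rewrite big_split/= -EFinD -EFinM lee_fin ler_pM2l//; exact: (hd j).2.
rewrite nneseriesZl; last first.
  move=> j _; rewrite -EFinD lee_fin addr_ge0// ?boxvol_ge0//.
  by rewrite divr_ge0// ltW.
apply: (@le_trans _ _ (k%:E * (lebn A + (e / k)%:E))%E).
  rewrite lee_pmul2l//; apply: le_trans (epsilon_trick _ _ _) _.
  - by move=> j; rewrite lee_fin boxvol_ge0.
  - exact: ltW.
  apply: (@le_trans _ _ ((lebn A + (e / (2 * k))%:E) + (e / (2 * k))%:E)%E).
    by rewrite leeD2r.
  by rewrite -addeA leeD2l// -EFinD lee_fin; rewrite [leLHS](_ : _ = e / k)//; field; lra.
rewrite ge0_muleDr ?lebn_ge0//; last by rewrite lee_fin divr_ge0// ltW.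
rewrite leeD2l// -EFinM lee_fin mulrC divfK//; lra.
Qed.

End lipschitz.
End Lip.

(** * Volume of linear images *)

Section Linear.
Variables (R : realType) (n : nat).
Local Notation V := 'rV[R]_n.+1.
Local Notation lebn := (@lebn R n.+1).
Implicit Types (x y : V) (A B : set V) (M : 'M[R]_n.+1).

Lemma mulmx_coord_le (v : V) M j :
  `|(v *m M) ord0 j| <= (\sum_i `|M i j|) * `|v|.
Proof.
rewrite mxE (le_trans (ler_norm_sum _ _ _))// mulr_suml; apply: ler_sum => i _.
by rewrite normrM mulrC ler_wpM2l// coord_le_norm.
Qed.

Lemma lebn_mulmx_sum M A : (forall j, 0 < \sum_i `|M i j|) ->
  (lebn ((fun x => x *m M) @` A) <= (\prod_j \sum_i `|M i j|)%:E * lebn A)%E.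
Proof.
move=> M0; apply: lebn_lip => // x y j _ _.
have := mulmx_coord_le (y - x) M j.
by rewrite mulmxBl !mxE.
Qed.

Lemma lebn_mulmx_diag (d : V) A : (forall j, d ord0 j != 0) ->
  (lebn ((fun x => x *m diag_mx d) @` A) <= (\prod_j `|d ord0 j|)%:E * lebn A)%E.
Proof.
move=> d0; have E j : \sum_i `|diag_mx d i j| = `|d ord0 j|.
  rewrite (bigD1 j)//= big1 ?mxE ?eqxx ?addr0// => i /negbTE ij.
  by rewrite mxE ij mulr0n normr0.
under [X in (_ <= X%:E * _)%E]eq_bigr do rewrite -E.
by apply: lebn_mulmx_sum => j; rewrite E normr_gt0.
Qed.

(* Conjugating by [diag_mx d] with rapidly growing weights makes the off-diagonal entries of a
   triangular matrix negligible, and the crude coordinatewise bound then tends to |det|. *)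
Lemma lebn_mulmx_weighted M (d : V) A : (forall j, 0 < d ord0 j) ->
  (forall j, 0 < \sum_i `|M i j| * (d ord0 j / d ord0 i)) ->
  (lebn ((fun x => x *m M) @` A) <=
    (\prod_j \sum_i `|M i j| * (d ord0 j / d ord0 i))%:E * lebn A)%E.
Proof.
move=> d0 M0; pose d' : V := \row_i (d ord0 i)^-1.
pose M' := diag_mx d' *m M *m diag_mx d.
have M'E i j : `|M' i j| = `|M i j| * (d ord0 j / d ord0 i).
  rewrite /M' mul_mx_diag mul_diag_mx !mxE !normrM (gtr0_norm (d0 j)).
  by rewrite gtr0_norm ?invr_gt0//; ring.
have dd' : diag_mx d *m diag_mx d' = 1%:M.
  apply/matrixP => i j; rewrite mul_diag_mx !mxE; case: eqP => [->|_].
    by rewrite !mulr1n divff// gt_eqF.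
  by rewrite !mulr0n mulr0.
have -> : (fun x => x *m M) @` A = (fun x => x *m diag_mx d') @`
   ((fun x => x *m M') @` ((fun x => x *m diag_mx d) @` A)).
  rewrite !image_comp; apply: eq_imagel => x _ /=.
  by rewrite /M' -!mulmxA dd' mulmx1 (mulmxA (diag_mx d)) dd' mul1mx.
apply: le_trans (lebn_mulmx_diag _ _) _.
  by move=> j; rewrite mxE invr_eq0 gt_eqF.
have E j : \sum_i `|M' i j| = \sum_i `|M i j| * (d ord0 j / d ord0 i).
  by apply: eq_bigr => i _; exact: M'E.
apply: (@le_trans _ _ ((\prod_j `|d' ord0 j|)%:E *
   ((\prod_j \sum_i `|M' i j|)%:E * ((\prod_j `|d ord0 j|)%:E * lebn A)))%E).
  rewrite lee_wpmul2l ?lee_fin ?prodr_ge0//.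
  apply: le_trans (lebn_mulmx_sum _ _) _.
    by move=> j; rewrite E.
  rewrite lee_wpmul2l ?lee_fin//.
    by apply: prodr_ge0 => i _; exact: sumr_ge0.
  by apply: lebn_mulmx_diag => j; rewrite gt_eqF.
have dd1 : (\prod_j `|d' ord0 j|) * (\prod_j `|d ord0 j|) = 1.
  rewrite -big_split/= big1// => j _.
  by rewrite mxE -normrM mulVf ?normr1// gt_eqF.
rewrite muleCA !muleA -!EFinM -mulrA dd1 mulr1.
by under eq_bigr do rewrite E.
Qed.

(** [w] records an order of the coordinates in which [M] is triangular. With the weights d_i = l^(w
    i), an off-diagonal entry is multiplied by l^(w j - w i) <= l, which is as small as desired. *)
Lemma lebn_mulmx_trig M (w : 'I_n.+1 -> nat) A :
  (forall i, M i i != 0) ->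
  (forall i j, i != j -> M i j != 0 -> (w i < w j)%N) ->
  (lebn ((fun x => x *m M) @` A) <= (\prod_j `|M j j|)%:E * lebn A)%E.
Proof.
move=> M0 Mw; set m := \prod_j _; have m0 : 0 < m.
  by apply: prodr_gt0 => i _; rewrite normr_gt0.
have [Aoo|] := ltP (lebn A) +oo%E; last first.
  by rewrite leye_eq => /eqP ->; rewrite gt0_muley ?lte_fin// leey.
have fA : lebn A \is a fin_num by rewrite ge0_fin_numE ?lebn_ge0.
pose a := fine (lebn A); have a0 : 0 <= a by rewrite fine_ge0// lebn_ge0.
apply/lee_addgt0Pr => e e0.
(* The error in the determinant gets multiplied by the measure [a] of [A]; the summand 1 covers the
   case a = 0. *)
have e10 : 0 < e / (a + 1) by rewrite divr_gt0// ltr_wpDl.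
have [d d0 hd] := prod_perturb (fun j => `|M j j|) e10.
pose S := 1 + \sum_i \sum_j `|M i j|.
have S0 : 0 < S.
  by rewrite ltr_wpDr//; apply: sumr_ge0 => i _; apply: sumr_ge0.
(* [S] bounds every off-diagonal column sum, so after weighting these sums are at most [d]. *)
pose l := Num.min 1 (d / S).
have l0 : 0 < l by rewrite lt_min ltr01 divr_gt0.
have l1 : l <= 1 by rewrite ge_min lexx.
pose D : V := \row_i l ^+ (w i).
have D0 i : 0 < D ord0 i by rewrite mxE exprn_gt0.
have offd i j : i != j -> `|M i j| * (D ord0 j / D ord0 i) <= `|M i j| * l.
  move=> ij; have [->|Mij] := eqVneq (M i j) 0; first by rewrite normr0 !mul0r.
  have wij := Mw _ _ ij Mij.
  rewrite ler_wpM2l// !mxE ler_pdivrMr ?exprn_gt0// -exprS.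
  by apply: ler_wiXn2l => //; exact: ltW.
have Kj j : \sum_i `|M i j| * (D ord0 j / D ord0 i) <= `|M j j| + d.
  rewrite (bigD1 j)//= divff ?gt_eqF// mulr1 lerD2l.
  apply: (@le_trans _ _ (\sum_(i | i != j) `|M i j| * l)).
    by apply: ler_sum => i ij; exact: offd.
  rewrite -mulr_suml; apply: (@le_trans _ _ (S * (d / S))); last first.
    by rewrite mulrC divfK// gt_eqF.
  apply: ler_pM => //; [exact: sumr_ge0|exact: ltW| |by rewrite ge_min lexx orbT].
  rewrite /S ler_wpDl//; apply: (@le_trans _ _ (\sum_i `|M i j|)).
    by rewrite [leRHS](bigD1 j)//= lerDr.
  by apply: ler_sum => i _; rewrite [leRHS](bigD1 j)//= lerDl sumr_ge0.
apply: le_trans (lebn_mulmx_weighted _ D0 _) _.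
  move=> j; rewrite (bigD1 j)//= ltr_pwDl//.
    by rewrite divff ?gt_eqF// mulr1 normr_gt0.
  by apply: sumr_ge0 => i _; rewrite mulr_ge0// divr_ge0// ltW.
apply: (@le_trans _ _ ((m + e / (a + 1))%:E * lebn A)%E).
  rewrite lee_wpmul2r ?lebn_ge0// lee_fin; apply: le_trans hd.
  apply: ler_prod => j _; rewrite Kj andbT; apply: sumr_ge0 => i _.
  by rewrite mulr_ge0// divr_ge0// ltW.
rewrite -(fineK fA) -/a -!EFinM -EFinD lee_fin mulrDl lerD2l.
by rewrite mulrAC ler_pdivrMr ?ltr_wpDl// ler_pM2l// lerDl.
Qed.

(** LUP decomposition: the permutation and the unit lower triangular factor do not increase the
    measure, and the diagonal of the upper factor carries |det M|. *)
Lemma lebn_mulmx M A : M \in unitmx ->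
  (lebn ((fun x => x *m M) @` A) <= `|\det M|%:E * lebn A)%E.
Proof.
move=> uM; have := cormen_lup_correct M; have := cormen_lup_detL M.
have := cormen_lup_lower M; have := cormen_lup_upper M; have := cormen_lup_perm M.
case: cormen_lup => [[P L] U] /= /is_perm_mxP[s ->] Uu Ll dL PM.
have dU : \det U = \prod_i U i i.
  rewrite -det_tr det_trig; first by apply: eq_bigr => i _; rewrite mxE.
  by apply/is_trig_mxP => i j ij; rewrite mxE Uu.
have ME : M = perm_mx (s^-1)%g *m (L *m U).
  have PM' : perm_mx s *m M = L *m U by [].
  by rewrite -PM' mulmxA -perm_mxM mulVg perm_mx1 mul1mx.
have dM : `|\det M| = \prod_i `|U i i|.
  by rewrite ME !det_mulmx dL mul1r normrM det_perm normr_sign mul1r dU normr_prod.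
have U0 i : U i i != 0.
  have : \det U != 0.
    move: uM; rewrite unitmxE unitfE ME !det_mulmx dL mul1r mulf_eq0 negb_or.
    by case/andP.
  by rewrite dU prodf_seq_neq0 => /allP /(_ i (mem_index_enum _)).
have -> : (fun x => x *m M) @` A = (fun x => x *m U) @`
   ((fun x => x *m L) @` ((fun x => x *m perm_mx (s^-1)%g) @` A)).
  by rewrite !image_comp; apply: eq_imagel => x _ /=; rewrite ME !mulmxA.
apply: le_trans (lebn_mulmx_trig (w := @nat_of_ord _) _ U0 _) _.
  move=> i j ij; rewrite ltnNge; apply: contra; rewrite leq_eqVlt => /orP[/eqP/val_inj ji|/Uu -> //].
  by rewrite ji eqxx in ij.
rewrite dM; apply: lee_wpmul2l; first by rewrite lee_fin prodr_ge0.
(* A lower triangular matrix is triangular for the reversed order of the coordinates. *)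
apply: le_trans (lebn_mulmx_trig (w := fun i => n - i)%N _ _ _) _.
- by move=> i; rewrite Ll// eqxx oner_eq0.
- move=> i j ij Lij; rewrite ltn_sub2l//; last first.
    rewrite ltnNge; apply: contra Lij => ij'; by rewrite Ll// (negbTE ij).
  rewrite ltnNge; apply: contra Lij => ij'; rewrite Ll ?(negbTE ij)//.
  by rewrite (leq_trans _ ij')// -ltnS.
rewrite big1 ?mul1e; last by move=> i _; rewrite Ll// eqxx normr1.
have E j : \sum_i `|(perm_mx (s^-1)%g : 'M[R]_n.+1) i j| = 1.
  rewrite (bigD1 (s j))//= big1 ?addr0//.
    by rewrite !mxE permK eqxx normr1.
  move=> i ij; rewrite !mxE; case: eqP => [sij|_]; last by rewrite normr0.
  by rewrite -sij permKV eqxx in ij.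
apply: le_trans (lebn_mulmx_sum _ _) _ => [j|]; first by rewrite E.
by rewrite big1 ?mul1e.
Qed.

End Linear.

(** * The layer-cake integral *)

Section LayerCake.
Variable (R : realType).
Local Notation mu := (@lebesgue_measure R).
Local Open Scope ereal_scope.

Lemma measurable_nonincreasing (D : set R) (phi : R -> \bar R) : measurable D ->
  (forall s t : R, (s <= t)%R -> phi t <= phi s) -> measurable_fun D phi.
Proof.
move=> mD h; move=> mD'; apply: (measurability _ (ErealGenOInfty.measurableE R)) => //.
move=> /= _ [_ [x ->]] <-; apply: measurableI => //; apply: is_interval_measurable.
move=> s t /=; rewrite !in_itv/= !andbT => fs ft u /andP[su ut].
by rewrite in_itv/= andbT (lt_le_trans ft)// h.
Qed.

(** The image of Lebesgue measure under division by [c] is [c] times Lebesgue measure, by uniqueness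
    from its values on half-open intervals. *)
Lemma integral_scale (c : R) (phi : R -> \bar R) : (0 < c)%R ->
  measurable_fun (`]0%R, +oo[%classic : set R) phi -> (forall t, 0 <= phi t) ->
  \int[mu]_(t in `]0%R, +oo[) phi (t / c)%R = c%:E * \int[mu]_(t in `]0%R, +oo[) phi t.
Proof.
move=> c0 mphi phi0.
pose T0 : measurableTypeR R -> measurableTypeR R := fun t => (t / c)%R.
have mT : measurable_fun setT T0 by exact: measurable_funM.
pose Tmix := isMeasurableFun.Build _ _ _ _ T0 mT.
pose T : {mfun measurableTypeR R >-> measurableTypeR R} := HB.pack T0 Tmix.
have TD : T @^-1` `]0%R, +oo[%classic = `]0%R, +oo[%classic.
  by apply/seteqP; split => t /=; rewrite !in_itv/= !andbT /T/= /T0 pmulr_lgt0 ?invr_gt0.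
have E A : measurable A -> pushforward mu T A = mscale (NngNum (ltW c0)) mu A.
  move=> mA; rewrite /mscale/=.
  have c'0 : (0 <= c^-1)%R by rewrite invr_ge0 ltW.
  pose m : {measure set (measurableTypeR R) -> \bar R} :=
    mscale (NngNum c'0) (pushforward mu T).
  have -> : mu A = m mT A.
    apply: (@lebesgue_measure_unique R (m mT)) => // _ [[a b]] _ <-.
    change (mu `]a, b]%classic = (c^-1)%:E * mu (T0 @^-1` `]a, b]%classic)).
    rewrite (_ : T0 @^-1` _ = `](a * c)%R, (b * c)%R]%classic); last first.
      apply/seteqP; split => t /=; rewrite !in_itv/= /T0.
        by rewrite ltr_pdivlMr// ler_pdivrMr.
      by rewrite ltr_pdivlMr// ler_pdivrMr.
    rewrite !lebesgue_measure_itv/= !lte_fin ltr_pM2r//; case: ifPn; rewrite ?mule0//.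
    by rewrite -!EFinB -EFinM -mulrBl mulrC mulfK// gt_eqF.
  by rewrite /m /mscale/= muleA -EFinM divff ?mul1e// gt_eqF.
rewrite -{1}TD -(@ge0_integral_pushforward _ _ _ _ _ _ mT mu _ phi)//.
rewrite (@eq_measure_integral _ _ _ _ (mscale (NngNum (ltW c0)) mu)).
  by rewrite ge0_integral_mscale.
by move=> A mA _; exact: E.
Qed.

(** Tonelli's theorem for the indicator of the region [S] below the graph. *)
Lemma layer_cake (D : set R) (f : R -> \bar R) : measurable D ->
  measurable_fun D f -> (forall x, D x -> 0 <= f x) ->
  \int[mu]_(x in D) f x = \int[mu]_(t in `]0%R, +oo[) mu (D `&` [set x | t%:E < f x]).
Proof.
move=> mD mf f0; pose g : R -> \bar R := f \_ D.
have mg : measurable_fun setT g by exact/(measurable_restrictT _ _).1.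
have g0 x : 0 <= g x by exact: erestrict_ge0.
pose S : set (R * R) := [set p | (0 < p.2)%R] `&` [set p | p.2%:E < g p.1].
have mS : measurable (S : set (measurableTypeR R * measurableTypeR R)).
  apply: measurableI.
    rewrite -[X in measurable X]setTI.
    have := @measurable_snd _ _ (measurableTypeR R) (measurableTypeR R).
    by move=> /(_ measurableT `]0%R, +oo[%classic (measurable_itv _)); rewrite set_itvoy.
  rewrite -[X in measurable X]setTI; apply: measurable_lte => //.
    by apply/measurable_EFinP; exact: measurable_snd.
  by apply: measurableT_comp => //; exact: measurable_fst.
(* The vertical fibre of [S] over a point where the function has the value [y]; its measure is
   [y]. *)
pose h (y : \bar R) : set R := [set t : R | 0 < t]%R `&` [set t : R | t%:E < y].
have hE y : 0 <= y -> measurable (h y) /\ mu (h y) = y.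
  case: y => [r r0| _|//].
    have -> : h r%:E = `]0%R, r[%classic.
      by apply/seteqP; split => t /=; rewrite /h/= in_itv/= lte_fin => /andP.
    split => //; rewrite lebesgue_measure_itv/= lte_fin.
    by move: r0; rewrite lee_fin; case: ltgtP => //= [_ _|<- //]; rewrite sube0.
  have -> : h +oo = `]0%R, +oo[%classic.
    by apply/seteqP; split => t /=; rewrite /h/= in_itv/= andbT; [case|rewrite ltry].
  by split => //; rewrite lebesgue_measure_itv/= ltry.
rewrite integral_mkcond -/g.
transitivity (\int[mu]_x \int[mu]_t (\1_S (x, t))%:E).
  apply: eq_integral => x _.
  have [mh {1}<-] := hE _ (g0 x).
  rewrite -(setIT (h _)) -integral_indic//; exact: eq_integral.
rewrite (@fubini_tonelli _ _ _ _ _ mu mu (fun p => (\1_S p)%:E))//=; last first.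
  by apply/measurable_EFinP; exact: measurable_indic.
rewrite [RHS]integral_mkcond; apply: eq_integral => t _.
have [t0|t0] := ltP 0%R t.
- rewrite patchE mem_set/=; last by rewrite in_itv/= t0.
  have := emeasurable_fun_o_infty mD mf t%:E; set W := D `&` _ => mW.
  have -> : mu W = \int[mu]_x (\1_W x)%:E by rewrite integral_indic ?setIT.
  apply: eq_integral => x _; rewrite !indicE (_ : ((x, t) \in S) = (x \in W))//.
  apply/idP/idP => /set_mem.
    rewrite /S/= /g patchE => -[_ /=]; case: ifPn => [/set_mem Dx tf|_].
      exact: mem_set.
    by rewrite lte_fin ltNge (ltW t0).
  by move=> [Dx tf]; apply: mem_set; split => //=; rewrite /g patchE mem_set.
- rewrite patchE memNset/=; last by rewrite in_itv/= andbT; apply/negP; rewrite -leNgt.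
  rewrite integral0_eq// => x _; rewrite indicE memNset// => -[/= t1 _].
  by rewrite ltNge t0 in t1.
Qed.

End LayerCake.

Section Intn.
Variables (R : realType) (n : nat).
Local Notation V := 'rV[R]_n.+1.
Local Notation lebn := (@lebn R n.+1).
Local Notation mu := (@lebesgue_measure R).
Implicit Types (g h : V -> \bar R) (A B : set V) (t : R).
Local Open Scope ereal_scope.

Definition lvl g t : set V := [set x | t%:E < g x].

Lemma measurable_lvl (D : set R) g : measurable D ->
  measurable_fun D (fun t => lebn (lvl g t)).
Proof.
move=> mD; apply: measurable_nonincreasing => // s t st; apply: le_lebn => x /=.
by apply: le_lt_trans; rewrite lee_fin.
Qed.

Lemma intn_ge0 g : 0 <= intn g.
Proof. by apply: integral_ge0 => t _; exact: lebn_ge0. Qed.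

Lemma intn_le (g : V -> \bar R) (phi : R -> \bar R) :
  measurable_fun (`]0%R, +oo[%classic : set R) phi ->
  (forall t, (0 < t)%R -> lebn (lvl g t) <= phi t) ->
  intn g <= \int[mu]_(t in `]0%R, +oo[) phi t.
Proof.
move=> mphi h; apply: ge0_le_integral => //.
- by move=> t _; exact: lebn_ge0.
- exact: measurable_lvl.
- by move=> t /=; rewrite in_itv/= andbT => /h.
Qed.

Lemma le_intn g h : (forall x, g x <= h x) -> intn g <= intn h.
Proof.
move=> gh; apply: intn_le; first exact: measurable_lvl.
by move=> t _; apply: le_lebn => x /= /lt_le_trans; apply.
Qed.

(** The form in which the pieces are used: [C] is the distortion of volumes and [c] that of values,
    the latter entering through the substitution t / c. *)
Lemma intn_compare (C c : R) g h : (0 <= C)%R -> (0 < c)%R ->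
  (forall t, (0 < t)%R -> lebn (lvl g t) <= C%:E * lebn (lvl h (t / c)%R)) ->
  intn g <= (C * c)%:E * intn h.
Proof.
move=> C0 c0 gh.
have mh : measurable_fun (`]0%R, +oo[%classic : set R) (fun t => lebn (lvl h (t / c)%R)).
  apply: measurable_nonincreasing => // s t st; apply: le_lebn => x /=.
  by apply: le_lt_trans; rewrite lee_fin ler_pM2r ?invr_gt0.
apply: le_trans (intn_le _ gh) _; first exact: measurable_funeM.
rewrite ge0_integralZl//; last by move=> t _; exact: lebn_ge0.
rewrite (@integral_scale _ c (fun t => lebn (lvl h t)))//.
- by rewrite EFinM muleA.
- exact: measurable_lvl.
- by move=> t; exact: lebn_ge0.
Qed.

Lemma intn_cst0 : intn (fun _ : V => 0) = 0 :> \bar R.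
Proof.
apply: integral0_eq => t /=; rewrite in_itv/= andbT => t0.
rewrite (_ : [set _ | _] = set0) ?lebn0//.
by rewrite -subset0 => x /=; rewrite lte_fin ltNge (ltW t0).
Qed.

Lemma intn_scale (c : R) g : (0 <= c)%R -> intn (fun x => c%:E * g x) = c%:E * intn g.
Proof.
rewrite le_eqVlt => /predU1P[<-|c0].
  by rewrite mul0e -intn_cst0; congr intn; apply/funext => x; rewrite mul0e.
have lvlE (d : R) k t : (0 < d)%R -> lvl (fun x => d%:E * k x) t = lvl k (t / d)%R.
  move=> d0; apply/seteqP; split => x /=; rewrite /lvl/=.
    by rewrite mulrC EFinM lte_pdivrMl.
  by rewrite mulrC EFinM lte_pdivrMl.
apply/eqP; rewrite eq_le; apply/andP; split.
  by rewrite -[c in leRHS]mul1r; apply: intn_compare => // t t0; rewrite lvlE// mul1e.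
rewrite -lee_pdivlMl// -[c^-1%R]mul1r; apply: intn_compare; rewrite ?invr_gt0// => t t0.
by rewrite lvlE// invrK mulfK ?gt_eqF// mul1e.
Qed.

Lemma intn_sigma_subadditive g (G : nat -> V -> \bar R) :
  (forall t x, (0 < t)%R -> lvl g t x -> exists k, lvl (G k) t x) ->
  intn g <= \sum_(0 <= k <oo) intn (G k).
Proof.
move=> gG; rewrite -integral_nneseries//.
- apply: intn_le => [|t t0].
    apply: ge0_emeasurable_sum => // k *; [exact: lebn_ge0|exact: measurable_lvl].
  apply: le_trans (lebn_sigma_subadditive _).
  by apply: le_lebn => x /gG-/(_ t0)[k xk]; exists k.
- by move=> k; exact: measurable_lvl.
- by move=> k t _; exact: lebn_ge0.
Qed.

Lemma intnU g h1 h2 :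
  (forall t x, (0 < t)%R -> lvl g t x -> lvl h1 t x \/ lvl h2 t x) ->
  intn g <= intn h1 + intn h2.
Proof.
move=> gh; rewrite /intn -ge0_integralD//; try exact: measurable_lvl; try by move=> *; exact: lebn_ge0.
apply: intn_le => [|t t0].
  by apply: emeasurable_funD; exact: measurable_lvl.
apply: le_trans (outer_measureU2 (lebn_outer R n) _ _).
by apply: le_lebn => x /gh-/(_ t0).
Qed.

Lemma lvl_on A g t : (0 < t)%R ->
  lvl (fun x => if `[< A x >] then g x else 0) t = lvl g t `&` A.
Proof.
move=> t0; apply/seteqP; split => x; rewrite /lvl/=; case: asboolP => //.
- by rewrite lte_fin ltNge (ltW t0).
- by move=> _ [].
- by move=> ? [].
Qed.

Lemma intn_on_disjoint g (B : nat -> set V) :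
  (forall k, lebn.-caratheodory (B k)) -> trivIset setT B ->
  \sum_(0 <= k <oo) intn_on (B k) g <= intn g.
Proof.
move=> mB tB; rewrite -integral_nneseries//.
- apply: ge0_le_integral => //.
  + by move=> t _; apply: nneseries_ge0 => k _ _; exact: lebn_ge0.
  + apply: ge0_emeasurable_sum => // k *; [exact: lebn_ge0|exact: measurable_lvl].
  + exact: measurable_lvl.
  move=> t /=; rewrite in_itv/= andbT => t0.
  have := caratheodory_lime_le mB tB (lvl g t).
  apply: le_trans; rewrite -[leLHS]adde0; apply: leeD; last exact: lebn_ge0.
  apply: lee_nneseries => k *; first exact: lebn_ge0.
  by rewrite -(lvl_on (B k) g t0).
- by move=> k; exact: measurable_lvl.
- by move=> k t _; exact: lebn_ge0.
Qed.

Lemma intn_on_split g A B : lebn.-caratheodory B ->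
  intn_on A g = intn_on (A `&` B) g + intn_on (A `\` B) g.
Proof.
move=> mB; rewrite /intn_on /intn -ge0_integralD//; try exact: measurable_lvl; try by move=> *; exact: lebn_ge0.
apply: eq_integral => t /set_mem /=; rewrite in_itv/= andbT => t0.
have H C := lvl_on C g t0; rewrite /lvl in H; rewrite (H A) (H (A `&` B)) (H (A `\` B)) setDE !setIA.
exact: mB.
Qed.

Lemma le_intn_on A B g h : A `<=` B -> (forall x, A x -> g x <= h x) ->
  (forall x, 0 <= h x) -> intn_on A g <= intn_on B h.
Proof.
move=> AB gh h0; apply: le_intn => x; case: asboolP => [Ax|_].
  by case: asboolP => [_|/(_ (AB _ Ax))//]; exact: gh.
by case: asboolP.
Qed.

Lemma intn_onZ A (c : R) g : (0 <= c)%R ->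
  intn_on A (fun x => c%:E * g x) = c%:E * intn_on A g.
Proof.
move=> c0; rewrite -intn_scale//; congr intn; apply/funext => x.
by case: asboolP => // _; rewrite mule0.
Qed.

Lemma intn_on_ge0 A g : 0 <= intn_on A g. Proof. exact: intn_ge0. Qed.

(** Superadditivity for overlapping sets, counted with multiplicity; it serves the images of
    disjoint pieces, which may overlap. In the induction [A] is split along [F N], and on the inner
    part the constant [c0] becomes [c0 + c N]; hence the generality in [A] and [c0]. *)
Lemma intn_on_mult_fin (F : nat -> set V) (c : nat -> R) g :
  (forall k, lebn.-caratheodory (F k)) -> (forall k, 0 <= c k)%R -> (forall x, 0 <= g x) ->
  forall N A (c0 : R), (0 <= c0)%R ->
  c0%:E * intn_on A g + \sum_(k < N) (c k)%:E * intn_on (A `&` F k) g <=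
  intn_on A (fun x => (c0 + \sum_(k < N | `[< F k x >]) c k)%:E * g x).
Proof.
move=> mF cp g0; elim => [|N IH] A c0 c00.
  rewrite big_ord0 adde0 -(intn_onZ A g c00).
  suff -> : (fun x => (c0 + \sum_(k < 0 | `[< F k x >]) c k)%:E * g x) =
            (fun x => c0%:E * g x) by [].
  by apply/funext => x; rewrite big_ord0 addr0.
pose G x := (c0 + \sum_(k < N.+1 | `[< F k x >]) c k)%:E * g x; rewrite -/G.
rewrite (intn_on_split G A (mF N)).
apply: (@le_trans _ _ (
  ((c0 + c N)%:E * intn_on (A `&` F N) g +
   \sum_(k < N) (c k)%:E * intn_on (A `&` F N `&` F k) g) +
  (c0%:E * intn_on (A `\` F N) g +
   \sum_(k < N) (c k)%:E * intn_on ((A `\` F N) `&` F k) g))).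
  rewrite big_ord_recr/= (intn_on_split g A (mF N)).
  rewrite (eq_bigr (fun k : 'I_N => (c k)%:E * intn_on (A `&` F N `&` F k) g +
     (c k)%:E * intn_on ((A `\` F N) `&` F k) g)); last first.
    move=> k _; rewrite -ge0_muleDr ?intn_on_ge0//; congr (_ * _).
    rewrite (intn_on_split g _ (mF N)) !setDE.  by rewrite (setIAC A (F k)) (setIAC A (F k) (~` _)).
  rewrite big_split/= EFinD ge0_muleDl ?lee_fin// ge0_muleDr ?intn_on_ge0//.
  by rewrite [leRHS]addeACA [in leRHS](addeAC (c0%:E * _)) [leLHS]addeA [leLHS]addeAC.
apply: leeD.
  apply: le_trans (IH _ _ _) _; first exact: addr_ge0.
  apply: le_intn_on => // [x [Ax Fx]|x]; last first.
    by rewrite mule_ge0// lee_fin addr_ge0// sumr_ge0.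
  rewrite /G big_mkcond [in leRHS]big_mkcond big_ord_recr/=.
  by rewrite asboolT// addrA (addrAC c0).
apply: le_trans (IH _ _ c00) _.
apply: le_intn_on => // [x [Ax Fx]|x]; last first.
  by rewrite mule_ge0// lee_fin addr_ge0// sumr_ge0.
rewrite /G big_mkcond [in leRHS]big_mkcond big_ord_recr/=.
by rewrite asboolF// addr0.
Qed.

Lemma intn_on_mult (F : nat -> set V) (c : nat -> R) g h :
  (forall k, lebn.-caratheodory (F k)) -> (forall k, 0 <= c k)%R -> (forall x, 0 <= g x) ->
  (forall N x, (\sum_(k < N | `[< F k x >]) c k)%:E * g x <= h x) ->
  \sum_(0 <= k <oo) (c k)%:E * intn_on (F k) g <= intn h.
Proof.
move=> mF cp g0 gh; apply: lime_le.
  by apply: is_cvg_nneseries => k _ _; rewrite mule_ge0 ?lee_fin ?intn_on_ge0.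
apply: nearW => N; rewrite big_mkord.
have := intn_on_mult_fin mF cp g0 N setT (lexx 0%R).
rewrite mul0e add0e; under eq_bigr do rewrite setTI.
move=> /le_trans; apply; apply: le_intn => x; rewrite asboolT// add0r; exact: gh.
Qed.

(** Continuity from below: the partial unions have the measure of the partial sums over the
    disjointed sets. *)
Lemma caratheodory_bigcup_le (E : nat -> set V) (M : \bar R) :
  (forall k, lebn.-caratheodory (E k)) ->
  (forall N, lebn (\big[setU/set0]_(k < N) E k) <= M) -> lebn (\bigcup_k E k) <= M.
Proof.
move=> mE EM; rewrite seqDU_bigcup_eq.
have mD k : lebn.-caratheodory (seqDU E k).
  apply: (caratheodory_measurable_setD (mu := lebn_outer R n)) => //.
  exact: (caratheodory_measurable_bigsetU (mu := lebn_outer R n)).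
apply: le_trans (lebn_sigma_subadditive _) _; apply: lime_le.
  by apply: is_cvg_nneseries => k *; exact: lebn_ge0.
apply: nearW => N; apply: le_trans (EM N); rewrite big_mkord.
have := caratheodory_additive mD (trivIset_seqDU E) N setT.
rewrite setTI; under [in X in _ = X -> _]eq_bigr do rewrite setTI.
by move=> <-; rewrite -bigsetU_seqDU.
Qed.

(** Borel hulls of the level sets at rational heights are made monotone and glued to a function [h].
    Its level set at [t] is the increasing union of the sets [H' q] as [q] decreases to [t], so the
    bound on their measures survives. *)
Lemma borel_hull g : (forall x, 0 <= g x) ->
  exists h, [/\ borel_fun h, forall x, g x <= h x &
    forall t, (0 < t)%R -> lebn (lvl h t) <= lebn (lvl g t)].
Proof.
move=> g0.
have /choice[H hH] : forall q : rat, exists H, [/\ borel_set H, lvl g (ratr q) `<=` H &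
    lebn H = lebn (lvl g (ratr q))] by move=> q; exact: lebn_hull.
(* the hulls [H q] need not decrease with [q] *)
pose H' (q : rat) := \bigcap_(r in [set r : rat | r <= q]%R) H r.
have bH' q : borel_set (H' q) by apply: borel_bigcap_count => r _; case: (hH r).
have H'mono q r : (q <= r)%R -> H' r `<=` H' q.
  by move=> qr x xr s /= sq; apply: xr => /=; exact: le_trans qr.
have gH' q : lvl g (ratr q) `<=` H' q.
  move=> x gx r /= rq; have [_ h _] := hH r; apply: h.
  by apply: le_lt_trans gx; rewrite lee_fin ler_rat.
have lH' q : lebn (H' q) <= lebn (lvl g (ratr q)).
  have [_ _ <-] := hH q; apply: le_lebn => x; apply => /=; exact: lexx.
pose h (x : V) : \bar R := ereal_sup [set (ratr q : R)%:E | q in [set q | H' q x]].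
have hE t : lvl h t = \bigcup_(q in [set q : rat | t < ratr q]%R) H' q.
  apply/seteqP; split => [x|x [q /= tq Hx]].
    by move=> /ereal_sup_gt[_ [q /= Hq <-]]; rewrite lte_fin => tq; exists q.
  apply: (@lt_le_trans _ _ (ratr q)%:E); first by rewrite lte_fin.
  by apply: ereal_sup_ubound; exists q.
exists h; split.
- by move=> t; rewrite -/(lvl h t) hE; apply: borel_bigcup_count => q _; exact: bH'.
- move=> x; rewrite leNgt; apply/negP => hg.
  have [q [hq qg]] : exists q : rat, h x < (ratr q)%:E /\ (ratr q)%:E < g x.
    have : -oo < h x.
      (* Since g >= 0, its level set at height -1 is the whole space; thus h >= -1, and a value of
         [h] below that of [g] is a real number. *)
      apply: (@lt_le_trans _ _ (ratr (-1 : rat))%:E); first exact: ltNyr.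
      apply: ereal_sup_ubound; exists (-1)%R => //; apply: gH' => /=.
      by apply: lt_le_trans (g0 x); rewrite lte_fin rmorphN rmorph1 ltrN10.
    case: (h x) hg => [r| |//] hg _; last by rewrite ltNge leey in hg.
    case: (g x) hg => [s| |//]; last first.
      move=> _; have [|q] := @rat_in_itvoo _ r (r + 1)%R; first by rewrite ltrDl.
      by rewrite in_itv/= => /andP[? _]; exists q; rewrite lte_fin ltry.
    by rewrite lte_fin => /rat_in_itvoo[q]; rewrite in_itv/= => /andP[? ?]; exists q; rewrite !lte_fin.
  have : (ratr q)%:E <= h x by apply: ereal_sup_ubound; exists q => //; exact: gH'.
  by rewrite leNgt hq.
move=> t t0; rewrite hE.
pose E k := if unpickle k is Some q then
  if (t < ratr q)%R then H' q else set0 else set0.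
have -> : \bigcup_(q in [set q : rat | t < ratr q]%R) H' q = \bigcup_k E k.
  apply/seteqP; split => [x [q /= tq xq]|x [k _]].
    by exists (pickle q); [|rewrite /E pickleK tq].
  by rewrite /E; case: unpickle => // q; case: ifP => // tq xq; exists q.
have bE k : borel_set (E k).
  rewrite /E; case: (unpickle k) => [q|]; last exact: borel_set0.
  by case: ifP => _; [exact: bH'|exact: borel_set0].
apply: caratheodory_bigcup_le => [k|N]; first exact: (borel_caratheodory (bE k)).
(* By monotonicity a finite union lies in the set of the smallest height [r] involved, which still
   exceeds [t]. *)
have [r tr EH] : exists2 r : rat, (t < ratr r)%R & \big[setU/set0]_(k < N) E k `<=` H' r.
  elim: N => [|N [r tr EH]].
    have [|q] := @rat_in_itvoo _ t (t + 1)%R; first by rewrite ltrDl.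
    by rewrite in_itv/= => /andP[tq _]; exists q => //; rewrite big_ord0.
  rewrite big_ord_recr/= {2}/E; case: unpickle => [q|]; last by exists r; rewrite ?setU0.
  case: ifP => tq; last by exists r; rewrite ?setU0.
  exists (Num.min r q).
    by rewrite /Num.min; case: ifP.
  move=> x [/EH|]; apply: H'mono; by rewrite ge_min lexx ?orbT.
apply: le_trans (le_lebn EH) _; apply: le_trans (lH' r) _; apply: le_lebn => x /=.
by apply: lt_trans; rewrite lte_fin.
Qed.

End Intn.

(** * Length and arc-length parametrization *)

Section Enorm.
Variables (R : realType) (n : nat).
Local Notation V := 'rV[R]_n.
Implicit Types (u v w : V).

Lemma enorm_ge0 v : 0 <= enorm v. Proof. exact: sqrtr_ge0. Qed.

Lemma enorm2 v : enorm v ^+ 2 = \sum_i v ord0 i ^+ 2.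
Proof. by rewrite sqr_sqrtr// sumr_ge0// => i _; rewrite sqr_ge0. Qed.

Lemma enorm0 : enorm (0 : V) = 0.
Proof. by rewrite /enorm big1 ?sqrtr0// => i _; rewrite mxE expr0n. Qed.

Lemma enormN v : enorm (- v) = enorm v.
Proof. by rewrite /enorm; under eq_bigr do rewrite mxE sqrrN. Qed.

Lemma enormB u v : enorm (u - v) = enorm (v - u).
Proof. by rewrite -enormN opprB. Qed.

Lemma enormZ (k : R) v : enorm (k *: v) = `|k| * enorm v.
Proof.
rewrite /enorm; under eq_bigr do rewrite mxE exprMn.
by rewrite -mulr_sumr sqrtrM ?sqr_ge0// sqrtr_sqr.
Qed.

(** Lagrange's identity: twice the difference of the two sides is a sum of squares. *)
Lemma cauchy_schwarz u v :
  (\sum_i u ord0 i * v ord0 i) ^+ 2 <= (\sum_i u ord0 i ^+ 2) * (\sum_i v ord0 i ^+ 2).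
Proof.
set a := fun i => u ord0 i; set b := fun i => v ord0 i.
have h : 0 <= \sum_i \sum_j (a i * b j - a j * b i) ^+ 2.
  by apply: sumr_ge0 => i _; apply: sumr_ge0 => j _; rewrite sqr_ge0.
have E : \sum_i \sum_j (a i * b j - a j * b i) ^+ 2 =
  ((\sum_i a i ^+ 2) * (\sum_i b i ^+ 2) - (\sum_i a i * b i) ^+ 2) *+ 2.
  transitivity (\sum_i \sum_j (a i ^+ 2 * b j ^+ 2) + \sum_i \sum_j (a j ^+ 2 * b i ^+ 2)
     - (\sum_i \sum_j (a i * b i * (a j * b j))) *+ 2).
    rewrite -big_split/= -sumrMnl -sumrB; apply: eq_bigr => i _.
    rewrite -big_split/= -sumrMnl -sumrB; apply: eq_bigr => j _; ring.
  rewrite [X in _ + X - _]exchange_big/= -mulr2n mulrnBl; congr (_ *+ _ - _ *+ _).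
    by rewrite mulr_suml; apply: eq_bigr => i _; rewrite mulr_sumr.
  by rewrite expr2 mulr_suml; apply: eq_bigr => i _; rewrite mulr_sumr.
by move: h; rewrite E pmulrn_lge0// subr_ge0.
Qed.

Lemma enormD u v : enorm (u + v) <= enorm u + enorm v.
Proof.
rewrite -(@ler_pXn2r _ 2)// ?nnegrE ?addr_ge0 ?enorm_ge0//.
rewrite sqrrD !enorm2.
have -> : \sum_i (u + v) ord0 i ^+ 2 = \sum_i u ord0 i ^+ 2 +
   (\sum_i u ord0 i * v ord0 i) *+ 2 + \sum_i v ord0 i ^+ 2.
  by rewrite -sumrMnl -!big_split/=; apply: eq_bigr => i _; rewrite mxE sqrrD.
rewrite lerD2r lerD2l lerMn2r/=.
apply: le_trans (ler_norm _) _; rewrite -(@ler_pXn2r _ 2)// ?nnegrE ?mulr_ge0 ?enorm_ge0//.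
by rewrite exprMn !enorm2 real_normK ?num_real// cauchy_schwarz.
Qed.

Lemma enorm_triangle w u v : enorm (u - v) <= enorm (u - w) + enorm (w - v).
Proof. by rewrite -(subrKA w); exact: enormD. Qed.

Lemma norm_le_enorm v : `|v| <= enorm v.
Proof.
apply: rV_norm_le => [|i]; first exact: enorm_ge0.
rewrite -(@ler_pXn2r _ 2)// ?nnegrE ?enorm_ge0// enorm2 real_normK ?num_real//.
by rewrite (bigD1 i)//= lerDl sumr_ge0// => j _; rewrite sqr_ge0.
Qed.

Lemma enorm_le_norm v : enorm v <= n%:R * `|v|.
Proof.
rewrite -(@ler_pXn2r _ 2)// ?nnegrE ?enorm_ge0 ?mulr_ge0// enorm2.
apply: (@le_trans _ _ (\sum_(i < n) `|v| ^+ 2)).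
  apply: ler_sum => i _; rewrite -real_normK ?num_real//.
  by rewrite ler_pXn2r ?nnegrE// coord_le_norm.
rewrite sumr_const card_ord exprMn -[leLHS]mulr_natl ler_wpM2r ?sqr_ge0//.
by rewrite -natrX ler_nat; case: (n) => // k; rewrite expnS expn1 leq_pmulr.
Qed.

Lemma enorm_eq0 v : enorm v = 0 -> v = 0.
Proof. by move=> v0; apply/eqP; rewrite -normr_le0 (le_trans (norm_le_enorm v))// v0. Qed.

End Enorm.

Section Length.
Variables (R : realType) (n : nat) (g : curve R n).
Implicit Types (a b c s t u v : R).
Local Notation gam := (cpath g).

Lemma clength_chord a b : a <= b ->
  ((enorm (gam b - gam a))%:E <= clength g a b)%E.
Proof.
move=> ab; apply: ereal_sup_ubound; exists 1%N, (fun k => if k is 0%N then a else b).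
do 2 split => //; split; first by case.
by rewrite big_ord_recl big_ord0 /= addr0.
Qed.

Lemma clength_ge0 a b : a <= b -> (0 <= clength g a b)%E.
Proof. by move=> ab; apply: le_trans (clength_chord ab); rewrite lee_fin enorm_ge0. Qed.

(** The chords telescope against [F]. This is the working description of length: the least increment
    of a function whose increments dominate the chords. *)
Lemma clength_le (F : R -> R) a b :
  (forall u v, a <= u -> u <= v -> v <= b -> enorm (gam v - gam u) <= F v - F u) ->
  (clength g a b <= (F b - F a)%:E)%E.
Proof.
move=> h; apply: ge_ereal_sup => _ [k [t [ta [tb [tS ->]]]]]; rewrite lee_fin.
have tm i j : (i <= j)%N -> (j <= k)%N -> t i <= t j.
  elim: j => [|j IH]; first by rewrite leqn0 => /eqP ->.
  rewrite leq_eqVlt => /predU1P[-> //|]; rewrite ltnS => ij jk.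
  by apply: le_trans (tS _ jk); apply: IH => //; exact: ltnW.
apply: (@le_trans _ _ (\sum_(i < k) (F (t i.+1) - F (t i)))).
  apply: ler_sum => i _; apply: h; first by rewrite -ta tm// ltnW.
    exact: tS.
  by rewrite -tb tm.
rewrite -(big_mkord xpredT (fun i => F (t i.+1) - F (t i))) telescope_sumr//.
by rewrite ta tb.
Qed.

Lemma clength_append a b c : a <= b -> b <= c ->
  (clength g a b + (enorm (gam c - gam b))%:E <= clength g a c)%E.
Proof.
move=> ab bc; rewrite -leeBrDr//; apply: ge_ereal_sup => _ [k [t [ta [tb [tS ->]]]]].
rewrite leeBrDr//; apply: ereal_sup_ubound.
exists k.+1, (fun i => if (i <= k)%N then t i else c); split => //; split.
  by rewrite ltnn.
split => [i|].
  rewrite ltnS => ik; have [->|/= ik'] := eqVneq i k; first by rewrite leqnn ltnn tb.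
  have {ik ik'} ik : (i < k)%N by rewrite ltn_neqAle ik' ik.
  by rewrite (ltnW ik) ik; exact: tS.
rewrite big_ord_recr/= leqnn ltnn tb; congr (_%:E); congr (_ + _).
by apply: eq_bigr => i _; rewrite (ltnW (ltn_ord i)) (ltn_ord i).
Qed.

End Length.

Section RectifiableArc.
Variables (R : realType) (n : nat) (g : curve R n) (a b : R).
Implicit Types (c s t u v w : R).
Local Notation gam := (cpath g).
Hypothesis ab : a <= b.
Hypothesis fin : forall u v, a <= u -> u <= v -> v <= b -> (clength g u v < +oo)%E.
Hypothesis cont : forall t e, a <= t -> t <= b -> 0 < e ->
  exists2 d, 0 < d & forall u, a <= u -> u <= b -> `|u - t| < d -> enorm (gam u - gam t) < e.

Let ell u v := fine (clength g u v).

Lemma ellE u v : a <= u -> u <= v -> v <= b -> clength g u v = (ell u v)%:E.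
Proof.
by move=> au uv vb; rewrite fineK// ge0_fin_numE ?clength_ge0//; exact: fin.
Qed.

Lemma ell_append u v w : a <= u -> u <= v -> v <= w -> w <= b ->
  enorm (gam w - gam v) <= ell u w - ell u v.
Proof.
move=> au uv vw wb; have := clength_append g uv vw.
rewrite !ellE//; [|exact: le_trans uv vw|exact: le_trans vw wb].
by rewrite -EFinD lee_fin lerBrDl.
Qed.

Lemma ell_le (F : R -> R) u v : a <= u -> u <= v -> v <= b ->
  (forall s t, u <= s -> s <= t -> t <= v -> enorm (gam t - gam s) <= F t - F s) ->
  ell u v <= F v - F u.
Proof. by move=> au uv vb /clength_le; rewrite ellE. Qed.

Lemma ell_ge0 u v : u <= v -> 0 <= ell u v.
Proof. by move=> uv; rewrite fine_ge0// clength_ge0. Qed.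

Lemma ellxx u : a <= u -> u <= b -> ell u u = 0.
Proof.
move=> au ub; apply/eqP; rewrite eq_le ell_ge0// andbT.
have := @ell_le (fun=> 0) u u au (lexx u) ub; rewrite subrr; apply.
move=> s t us st tu; have -> : s = t by apply/eqP; rewrite eq_le st (le_trans tu us).
by rewrite !subrr enorm0.
Qed.

Lemma ell_mono u v w : a <= u -> u <= v -> v <= w -> w <= b -> ell u v <= ell u w.
Proof.
move=> au uv vw wb; rewrite -subr_ge0; apply: le_trans (ell_append au uv vw wb).
exact: enorm_ge0.
Qed.

(** For the upper bound, the length from [u] up to [v], continued beyond [v] by the length from [v],
    dominates all chords. *)
Lemma ell_add u v w : a <= u -> u <= v -> v <= w -> w <= b ->
  ell u w = ell u v + ell v w.
Proof.
move=> au uv vw wb; have av := le_trans au uv; have vb := le_trans vw wb.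
apply/eqP; rewrite eq_le; apply/andP; split.
  pose F s := if s <= v then ell u s else ell u v + ell v s.
  have := @ell_le F u w au (le_trans uv vw) wb.
  have -> : F u = 0 by rewrite /F uv ellxx// (le_trans uv).
  have -> : F w = ell u v + ell v w.
    rewrite /F; case: ifP => // wv; have -> : w = v by apply/eqP; rewrite eq_le wv.
    by rewrite ellxx ?addr0.
  rewrite subr0; apply => s t us st tw; rewrite /F.
  have [tv|vt] := leP t v; first by rewrite (le_trans st tv); exact: ell_append au us st (le_trans tv vb).
  have [sv|vs] := leP s v; last first.
    rewrite opprD addrACA subrr add0r; exact: ell_append av (ltW vs) st (le_trans tw wb).
  apply: le_trans (enorm_triangle (gam v) _ _) _.
  have h1 := ell_append au us sv vb.
  have h2 := ell_append av (lexx v) (ltW vt) (le_trans tw wb).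
  by rewrite ellxx// subr0 in h2; lra.
rewrite addrC -lerBrDr; apply: (@ell_le (ell u)) => // s t vs st tw.
by apply: ell_append => //; [exact: le_trans uv vs|exact: le_trans tw wb].
Qed.

(** If the length jumped by [e] just after [t], the length function lowered by [e] beyond [t] would
    still dominate all chords, by continuity of the curve at [t]; this contradicts the minimality of
    length. [ell_left] is the mirror image. *)
Lemma ell_right t e : a <= t -> t < b -> 0 < e ->
  exists2 u, t < u <= b & ell a u < ell a t + e.
Proof.
move=> at_ tb e0; apply: contrapT => h.
have J u : t < u -> u <= b -> ell a t + e <= ell a u.
  by move=> tu ub; rewrite leNgt; apply/negP => hu; apply: h; exists u => //; rewrite tu ub.
pose F u := if u <= t then ell a u else ell a u - e.
have := @ell_le F a b (lexx a) ab (lexx b).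
rewrite /F at_ ellxx// (negbTE (_ : ~~ (b <= t))) -?ltNge//.
suff h' : forall s u, a <= s -> s <= u -> u <= b -> enorm (gam u - gam s) <= F u - F s.
  by move=> /(_ h'); rewrite /ell; lra.
move=> s u as_ su ub; rewrite /F.
have [ut|tu] := leP u t; first by rewrite (le_trans su ut); exact: ell_append.
have [st|ts] := leP s t; last by rewrite opprB subrKA; exact: ell_append.
apply/ler_addgt0Pr => d d0.
have [r r0 hr] := cont at_ (ltW tb) d0.
(* A point just after [t]: the chord from [t] to [w] is shorter than [d], while the length has
   already grown by [e]. *)
pose w := Num.min u (t + r / 2).
have tw : t < w by rewrite lt_min tu ltrDl divr_gt0.
have wu : w <= u by rewrite ge_min lexx.
have wb := le_trans wu ub; have aw := le_trans at_ (ltW tw).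
have gw : enorm (gam w - gam t) < d.
  apply: hr => //; rewrite gtr0_norm ?subr_gt0// ltrBlDl /w gt_min; apply/orP; right.
  by rewrite ltrD2l ltr_pdivrMr// ltr_pMr// ltr1n.
have h1 := ell_append (lexx a) aw wu ub.
have h2 := ell_append (lexx a) as_ st (ltW tb).
have h3 := J _ tw wb.
have h4 := enorm_triangle (gam w) (gam u) (gam s).
have h5 := enorm_triangle (gam t) (gam w) (gam s).
lra.
Qed.

Lemma ell_left t e : a < t -> t <= b -> 0 < e ->
  exists2 u, a <= u < t & ell a t - e < ell a u.
Proof.
move=> at_ tb e0; apply: contrapT => h.
have J u : a <= u -> u < t -> ell a u <= ell a t - e.
  by move=> tu ub; rewrite leNgt; apply/negP => hu; apply: h; exists u => //; rewrite tu ub.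
pose F u := if u < t then ell a u else ell a u - e.
have := @ell_le F a b (lexx a) ab (lexx b).
rewrite /F at_ ellxx// ltNge tb/=.
suff h' : forall s u, a <= s -> s <= u -> u <= b -> enorm (gam u - gam s) <= F u - F s.
  by move=> /(_ h'); rewrite /ell; lra.
move=> s u as_ su ub; rewrite /F.
have [tu|ut] := leP t u; last by rewrite (le_lt_trans su ut); apply: ell_append.
have [ts|st] := leP t s; first by rewrite opprB subrKA; exact: ell_append.
apply/ler_addgt0Pr => d d0.
have [r r0 hr] := cont (ltW at_) tb d0.
pose w := Num.max s (t - r / 2).
have wt : w < t by rewrite gt_max st ltrBlDr ltrDl divr_gt0.
have sw : s <= w by rewrite le_max lexx.
have wb := le_trans (ltW wt) tb; have aw := le_trans as_ sw.
have gw : enorm (gam w - gam t) < d.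
  apply: hr => //; rewrite distrC gtr0_norm ?subr_gt0// ltrBlDl -ltrBlDr /w lt_max; apply/orP; right.
  by rewrite ltrD2l ltrN2 ltr_pdivrMr// ltr_pMr// ltr1n.
have h1 := ell_append (lexx a) as_ sw wb.
have h2 := ell_append (lexx a) (ltW at_) tu ub.
have h3 := J _ aw wt.
have h4 := enorm_triangle (gam w) (gam u) (gam s).
have h5 := enorm_triangle (gam t) (gam u) (gam w).
rewrite (enormB (gam t)) in h5.
lra.
Qed.

Lemma ell_surj s : 0 <= s -> s <= ell a b -> exists2 t, a <= t <= b & ell a t = s.
Proof.
move=> s0 sb; pose S := [set t | a <= t <= b /\ ell a t <= s].
have Sa : S a by split; rewrite ?lexx ?ab// ellxx.
have Sub : has_ubound S by exists b => t [/andP[]].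
have St := ub_le_sup Sub; set t := sup S in St.
have at_ : a <= t by exact: St.
have tb : t <= b by apply: sup_le_ub; [exists a|move=> u [/andP[]]].
exists t; first by rewrite at_ tb.
apply/eqP; rewrite eq_le; apply/andP; split; rewrite leNgt; apply/negP => h.
- have [at'|ta] := ltP a t; last first.
    have e : t = a by apply/eqP; rewrite eq_le ta at_.
    by move: h; rewrite e ellxx// ltNge s0.
  have [|u /andP[au ut] hu] := @ell_left t (ell a t - s) at' tb; first by rewrite subr_gt0.
  suff : t <= u by rewrite leNgt ut.
  apply: sup_le_ub; first by exists a.
  move=> v [/andP[av vb] vs]; rewrite leNgt; apply/negP => uv.
  have := ell_mono (lexx a) au (ltW uv) vb; lra.
- have [tb'|bt] := ltP t b; last first.
    have e : t = b by apply/eqP; rewrite eq_le bt tb.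
    by move: h; rewrite e ltNge sb.
  have [|u /andP[tu ub] hu] := @ell_right t (s - ell a t) at_ tb'; first by rewrite subr_gt0.
  suff : u <= t by rewrite leNgt tu.
  apply: St; split; first by rewrite ub (le_trans at_ (ltW tu)).
  lra.
Qed.

Lemma chord_le_ell t u : a <= t -> t <= b -> a <= u -> u <= b ->
  enorm (gam t - gam u) <= `|ell a t - ell a u|.
Proof.
wlog ut : t u / u <= t => [h|] at_ tb au ub.
  have [|tu] := leP u t; first by move=> ?; exact: h.
  by rewrite enormB distrC; apply: h => //; exact: ltW.
by rewrite ger0_norm ?subr_ge0 ?ell_mono//; exact: ell_append.
Qed.

Lemma arcparam_ell t : a <= t -> t <= b -> arcparam g a b (ell a t) = gam t.
Proof.
move=> at_ tb; rewrite /arcparam; set S := [set _ | _].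
have /getPex[/andP[h1 h2] h3] : exists u, S u by exists t; rewrite /S/= at_ tb.
apply/eqP; rewrite -subr_eq0; apply/eqP/enorm_eq0/eqP.
by rewrite eq_le enorm_ge0 andbT (le_trans (chord_le_ell _ _ _ _))// /ell h3 subrr normr0.
Qed.

Lemma arcparam_lip s s' : 0 <= s -> s <= ell a b -> 0 <= s' -> s' <= ell a b ->
  enorm (arcparam g a b s - arcparam g a b s') <= `|s - s'|.
Proof.
move=> s0 sL s'0 s'L; have [t /andP[at_ tb] <-] := ell_surj s0 sL.
have [u /andP[au ub] <-] := ell_surj s'0 s'L.
by rewrite !arcparam_ell//; exact: chord_le_ell.
Qed.

Lemma arc_length_le (F : R -> R) :
  (forall s s', 0 <= s -> s <= s' -> s' <= ell a b ->
    enorm (arcparam g a b s' - arcparam g a b s) <= F s' - F s) ->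
  ell a b <= F (ell a b) - F 0.
Proof.
move=> h; rewrite -(ellxx (lexx a) ab).
apply: (@ell_le (fun t => F (ell a t))) => // s t as_ st tb.
have at_ := le_trans as_ st; have sb := le_trans st tb.
rewrite -!arcparam_ell//; apply: h; [exact: ell_ge0|exact: ell_mono|exact: ell_mono].
Qed.

End RectifiableArc.

(** * Arc-length parametrizations and sets of parameters *)

Section UnitSpeed.
Variables (R : realType) (n : nat).
Local Notation V := 'rV[R]_n.
Local Notation lam := (@lebesgue_measure R).
Implicit Types (c : R -> V) (L : R) (A : set R).

(* [c] is an arc-length parametrization on [0, L]; the last clause says that its length is
   at least [L], the length being tested against increasing functions dominating the chords. *)
Definition unit_speed c L : Prop :=
  [/\ 0 <= L,
      forall s s' : R, 0 <= s -> s <= L -> 0 <= s' -> s' <= L -> enorm (c s - c s') <= `|s - s'| &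
      forall F : R -> R, (forall s s' : R, 0 <= s -> s <= s' -> s' <= L ->
        enorm (c s' - c s) <= F s' - F s) -> L <= F L - F 0].

Lemma le_lam A B : A `<=` B -> (lam A <= lam B)%E.
Proof. exact: (le_outer_measure (@wlength R idfun)^*%mu). Qed.

Lemma lam_sigma_subadditive (F : nat -> set R) :
  (lam (\bigcup_k F k) <= \sum_(0 <= k <oo) lam (F k))%E.
Proof. exact: (outer_measure_sigma_subadditive (@wlength R idfun)^*%mu). Qed.

(** The primitive of the indicator of [Z]: with [Z] the complement of a closed set, it is the length
    charged to the gaps. *)
Definition partial_length (Z : set R) (u : R) : R :=
  fine (lam (`[0, u]%classic `&` Z)).

Section gaps.
Variable Z : set R.
Hypothesis mZ : measurable Z.
Local Notation nu := (partial_length Z).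

Let mI u : measurable (`[0, u]%classic `&` Z).
Proof. exact: measurableI. Qed.

Lemma partial_length_fin u : (nu u)%:E = lam (`[0, u]%classic `&` Z).
Proof.
rewrite fineK// ge0_fin_numE//.
apply: (@le_lt_trans _ _ (lam `[0, u]%classic)).
  by apply: le_lam => x [].
by rewrite lebesgue_measure_itv/=; case: ifP => _; rewrite ltry.
Qed.

Lemma partial_length_le u v : u <= v -> nu u <= nu v.
Proof.
move=> uv; rewrite -lee_fin !partial_length_fin; apply: le_lam.
by apply: setSI; apply: subset_itvl; rewrite bnd_simp.
Qed.

Lemma partial_length_gap u v : 0 <= u -> u <= v -> (forall x, u < x < v -> Z x) -> nu u + (v - u) <= nu v.
Proof.
move=> u0 uv Zuv; have [->|uv'] := eqVneq u v; first by rewrite subrr addr0.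
have {uv'}uv' : u < v by rewrite lt_neqAle uv' uv.
rewrite -lee_fin EFinD !partial_length_fin.
have -> : (v - u)%:E = lam `]u, v[%classic.
  by rewrite lebesgue_measure_itv/= lte_fin uv' EFinB.
rewrite -measureU//; [|exact: mI|]; last first.
  rewrite -subset0 => x /= [[]]; rewrite !in_itv/= => /andP[_ xu] _ /andP[ux _].
  by rewrite ltNge xu in ux.
apply: le_lam => x /= [[]|]; rewrite !in_itv/=.
  by move=> /andP[-> xu] Zx; rewrite (le_trans xu).
by move=> /andP[ux xv]; split; [rewrite (ltW xv) (ltW (le_lt_trans u0 ux))|apply: Zuv; rewrite ux].
Qed.

End gaps.

(* [F u = sup {phi v : v <= u, v in A} + |[0, u] \ closure A|] dominates the chords of [c]
   (across a gap of [A] the curve is 1-Lipschitz), so that [L <= F L - F 0]. *)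
Lemma unit_speed_closure_le c L A (phi : R -> R) (m w : R) :
  unit_speed c L -> (forall u, A u -> 0 <= u <= L) -> 0 <= w ->
  (forall u v, A u -> A v -> u <= v -> enorm (c v - c u) <= phi v - phi u) ->
  (forall u, A u -> m <= phi u <= m + w) ->
  (lam (closure A) <= w%:E)%E.
Proof.
move=> [L0 clip clen] AL w0 Aphi Aw.
pose Z := ~` closure A.
have mcl : measurable (closure A) by apply: closed_measurable; exact: closed_closure.
have mZ : measurable Z by exact: measurableC.
pose nu := partial_length Z.
pose B u := [set x | x = m \/ exists2 v, A v & v <= u /\ x = phi v].
have Bn u : B u !=set0 by exists m; left.
have Bub u : ubound (B u) (m + w).
  by move=> _ [->|[v Av [_ ->]]]; [rewrite lerDl|case/andP: (Aw v Av)].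
pose psi u := sup (B u).
have psi_ge u v : A v -> v <= u -> phi v <= psi u.
  by move=> Av vu; apply: ub_le_sup; [exists (m + w)|right; exists v].
have psi_m u : m <= psi u by apply: ub_le_sup; [exists (m + w)|left].
have psi_w u : psi u <= m + w by apply: sup_le_ub.
have psi_mono u v : u <= v -> psi u <= psi v.
  move=> uv; apply: sup_le_ub => // _ [->//|[x Ax [xu ->]]].
  by apply: psi_ge => //; exact: le_trans uv.
have psi_le u v : A v -> u <= v -> psi u <= phi v.
  move=> Av uv; apply: sup_le_ub => // _ [->|[x Ax [xu ->]]].
    by case/andP: (Aw v Av).
  have := Aphi x v Ax Av (le_trans xu uv); have := enorm_ge0 (c v - c x); lra.
pose F u := psi u + nu u.
have FF (s s' : R) : 0 <= s -> s <= s' -> s' <= L -> enorm (c s' - c s) <= F s' - F s.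
  move=> s0 ss' s'L; have s'0 := le_trans s0 ss'; have sL := le_trans ss' s'L.
  have chord (u v : R) : 0 <= u -> u <= v -> v <= L -> enorm (c v - c u) <= v - u.
    move=> u0 uv vL; apply: le_trans (clip _ _ _ _ _ _) _ => //; try lra.
    by rewrite ger0_norm// subr_ge0.
  pose E := A `&` `[s, s']%classic.
  have [E0|/set0P[x0 Ex0]] := eqVneq E set0.
    have := partial_length_gap mZ s0 ss'; rewrite -/nu /F.
    have := psi_mono _ _ ss'; have := chord _ _ s0 ss' s'L.
    move=> h1 h2 h3; suff /h3 : forall x, s < x < s' -> Z x by lra.
    move=> x /andP[sx xs'] /(_ `]s, s'[%classic); case.
      by apply: open_nbhs_nbhs; split; [exact: interval_open|rewrite /= in_itv/= sx].
    move=> y [Ay]; rewrite /= in_itv/= => /andP[sy ys'].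
    suff : E y by rewrite E0.
    by split => //=; rewrite in_itv/= !ltW.
  have Es x : E x -> s <= x <= s' by move=> [_]; rewrite /= in_itv.
  have hi : has_inf E by split; [exists x0|exists s => x /Es/andP[]].
  have hs : has_sup E by split; [exists x0|exists s' => x /Es/andP[]].
  have sv : s <= inf E by apply: lb_le_inf; [exists x0|move=> x /Es/andP[]].
  have vs : sup E <= s' by apply: sup_le_ub; [exists x0|move=> x /Es/andP[]].
  have iE x : E x -> inf E <= x by apply: ge_inf; case: hi.
  have sE x : E x -> x <= sup E by apply: ub_le_sup; case: hs.
  have gapZ u v : (forall x, A x -> ~ (u < x < v)) -> forall x, u < x < v -> Z x.
    move=> h x /andP[ux xv] /(_ `]u, v[%classic); case.
      by apply: open_nbhs_nbhs; split; [exact: interval_open|rewrite /= in_itv/= ux].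
    by move=> y [Ay]; rewrite /= in_itv/=; exact: h.
  have is_ : inf E <= sup E by exact: le_trans (iE _ Ex0) (sE _ Ex0).
  have n1 := partial_length_gap mZ s0 sv; have n2 := partial_length_le Z is_.
  have n3 := partial_length_gap mZ (le_trans s0 (le_trans sv is_)) vs.
  have {}n1 : nu s + (inf E - s) <= nu (inf E).
    apply: n1; apply: gapZ => x Ax /andP[sx xi].
    suff /iE : E x by rewrite leNgt xi.
    by split => //=; rewrite in_itv/= (ltW sx) (le_trans (ltW xi))// (le_trans is_).
  have {}n3 : nu (sup E) + (s' - sup E) <= nu s'.
    apply: n3; apply: gapZ => x Ax /andP[sx xi].
    suff /sE : E x by rewrite leNgt sx.
    by split => //=; rewrite in_itv/= (ltW xi) (le_trans _ (ltW sx))// (le_trans sv).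
  rewrite -/nu in n2.
  (* [inf E] and [sup E] need not lie in [A], so points of [A] within e / 2 of them are used; if
     these come in the wrong order, one of them does for both. *)
  apply/ler_addgt0Pr => e e0; have e20 : 0 < e / 2 by rewrite divr_gt0.
  have [x Ex xi] := inf_adherent e20 hi; have [y Ey ys] := sup_adherent e20 hs.
  have [x' [y' [Ex' Ey' x'i y's xy]]] : exists x' y', [/\ E x', E y', x' < inf E + e / 2,
      sup E - e / 2 < y' & x' <= y'].
    have [xy|yx] := leP x y; first by exists x, y.
    by exists x, x; split => //; exact: lt_trans yx.
  have /andP[sx' x's'] := Es _ Ex'; have /andP[sy' y's'] := Es _ Ey'.
  have h1 := chord _ _ s0 sx' (le_trans x's' s'L).
  have h2 := chord _ _ (le_trans s0 sy') y's' s'L.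
  have h3 := Aphi _ _ Ex'.1 Ey'.1 xy.
  have h4 := psi_le s x' Ex'.1 sx'; have h5 := psi_ge s' y' Ey'.1 y's'.
  have h6 := enorm_triangle (c x') (c s') (c s).
  have h7 := enorm_triangle (c y') (c s') (c x').
  rewrite /F; lra.
(* The increment of [F] is at most [w] plus the length [nu L] of the gaps, whereas [L] is the
   measure of the closure plus [nu L]; subtract. *)
have := clen F FF; rewrite /F => h.
have nu0 : 0 <= nu 0 by rewrite fine_ge0.
have := psi_w L; have := psi_m 0 => h1 h2.
have clAL : closure A `<=` `[0, L]%classic.
  rewrite -(_ : closure `[0, L]%classic = `[0, L]%classic :> set R); last first.
    by apply/esym/closure_id; exact: itv_closed.
  by apply: closure_subset => u /AL; rewrite /= in_itv.
have : (lam `[0%R, L]%classic = lam (closure A) + lam (`[0%R, L]%classic `&` Z))%E.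
  rewrite -measureU//; last 2 first.
  - exact: measurableI.
  - by rewrite setIA (setIC (closure A)) -setIA setICr setI0.
  congr (lam _); rewrite -{1}(setIT `[0, L]%classic) -(setUv (closure A)) setIUr.
  by congr (_ `|` _); apply/setIidPr.
rewrite -partial_length_fin -/(nu L) lebesgue_measure_itv/= lte_fin.
case: ltgtP L0 => // [L0 _|<- _].
- rewrite sube0; case: (lam (closure A)) => [r| |]//=.
  by rewrite -EFinD => -[Lr]; rewrite lee_fin; lra.
- move=> /esym/eqP; rewrite padde_eq0 ?lee_fin ?fine_ge0//.
  by move=> /andP[/eqP -> _]; rewrite lee_fin.
Qed.

End UnitSpeed.

Section Reparam.
Variables (R : realType) (n : nat).
Local Notation V := 'rV[R]_n.
Local Notation lam := (@lebesgue_measure R).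
Implicit Types (c : R -> V) (L : R) (A : set R) (s u t : R).

(** On an interval, [unit_speed_closure_le] applies to the image of [A] with [phi] equal to [K]
    times a section of [P], whose oscillation is at most [K] times the length of the interval. The
    general case follows because outer measure is an infimum over covers by open intervals. *)
Lemma lam_image_le c L (A : set R) (P : R -> R) (K : R) : unit_speed c L -> 0 < K ->
  (forall s, A s -> 0 <= P s <= L) ->
  (forall s s', A s -> A s' -> s <= s' -> P s <= P s') ->
  (forall s s', A s -> A s' -> s <= s' -> enorm (c (P s') - c (P s)) <= K * (s' - s)) ->
  (lam (P @` A) <= K%:E * lam A)%E.
Proof.
move=> uc K0 PL Pm PK.
have itvP a b : (lam (P @` (A `&` `]a, b[)) <= K%:E * lam `]a, b[%classic)%E.
  have [ba|ab] := leP b a.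
    by rewrite set_itv_ge ?bnd_simp -?leNgt// setI0 image_set0 measure0 mule0.
  rewrite lebesgue_measure_itv/= lte_fin ab -EFinB -EFinM.
  set I := A `&` _; pose S u := get [set s | I s /\ P s = u].
  have IS u : (P @` I) u -> I (S u) /\ P (S u) = u.
    move=> [s Is su]; have : exists s, [set s | I s /\ P s = u] s by exists s.
    by move=> /getPex.
  apply: le_trans (unit_speed_closure_le (A := P @` I) (phi := fun u => K * S u)
    (m := K * a) (w := K * (b - a)) uc _ _ _ _).
  - by apply: le_lam; exact: subset_closure.
  - by move=> _ [s [As _] <-]; exact: PL.
  - by rewrite mulr_ge0 ?subr_ge0 ?(ltW K0) ?(ltW ab).
  - move=> u v /IS[Iu uE] /IS[Iv vE] uv; rewrite -{1}uE -{1}vE -mulrBr.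
    (* The section need not be monotone a priori, but monotonicity of [P] makes u = v if it reverses
       the order. *)
    have [Suv|vu] := leP (S u) (S v); first by apply: PK => //; [case: Iu|case: Iv].
    have e : u = v.
      by apply/eqP; rewrite eq_le uv -uE -vE; apply: (Pm _ _ Iv.1 Iu.1); exact: ltW.
    by rewrite e !subrr mulr0 enorm0.
  - move=> u /IS[[_ /=]]; rewrite in_itv/= => /andP[h1 h2] _.
    by rewrite -mulrDr subrKC !ler_pM2l ?(ltW h1) ?(ltW h2).
rewrite -lee_pdivrMl//.
have -> : lam A = ereal_inf
    [set (\sum_(0 <= k <oo) @wlength R idfun (F k))%E | F in open_itv_cover A].
  exact: outer_measure_open_itv_cover.
apply: le_ereal_inf_tmp => _ [F [Fitv AF] <-]; rewrite lee_pdivrMl//.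
rewrite -nneseriesZl; last by move=> k _; exact: wlength_ge0.
apply: (@le_trans _ _ (lam (\bigcup_k (P @` (A `&` F k))))).
  apply: le_lam => _ [s As <-]; have [k _ Fs] := AF _ As.
  by exists k => //; exists s.
apply: le_trans (lam_sigma_subadditive _) _.
apply: lee_nneseries => [k _ _|k _]; first by rewrite measure_ge0.
have [[a b] /= ->] := Fitv k; apply: le_trans (itvP a b) _.
by rewrite wlength_itv lebesgue_measure_itv.
Qed.

(** By the layer-cake formula it suffices to bound the measure of {f2 > t}. This set is covered by
    the images of its parts [E k t] in the pieces, each stretched at most by [K k], and by the null
    image of the rest. *)
Lemma integral_reparam c (L1 L2 : R) (P : R -> R) (S : nat -> set R) (K : nat -> R)
   (f1 f2 : R -> \bar R) :
  unit_speed c L2 -> (forall k, 0 < K k) ->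
  (forall k, measurable (S k)) -> trivIset setT S ->
  (forall k s, S k s -> 0 <= s <= L1) ->
  (forall s, 0 <= s <= L1 -> 0 <= P s <= L2) ->
  (forall u, 0 <= u <= L2 -> exists2 s, 0 <= s <= L1 & P s = u) ->
  (forall s s', 0 <= s -> s <= s' -> s' <= L1 -> P s <= P s') ->
  lam (P @` (`[0, L1] `\` \bigcup_k S k)) = 0%E ->
  (forall k s s', S k s -> S k s' -> s <= s' ->
    enorm (c (P s') - c (P s)) <= K k * (s' - s)) ->
  measurable_fun (`[0, L1]%classic : set R) f1 ->
  measurable_fun (`[0, L2]%classic : set R) f2 ->
  measurable_fun (`[0, L1]%classic : set R) (f2 \o P) ->
  (forall s, 0 <= f1 s)%E -> (forall s, 0 <= f2 s)%E ->
  (forall k s, S k s -> ((K k)%:E * f2 (P s) <= f1 s)%E) ->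
  (\int[lam]_(u in `[0%R, L2]) f2 u <= \int[lam]_(s in `[0%R, L1]) f1 s)%E.
Proof.
move=> uc K0 mS tS SL PL Psurj Pm Pnull PK mf1 mf2 mf2P f10 f20 f21.
have SL' k : S k `<=` `[0, L1]%classic by move=> s /SL; rewrite /= in_itv.
have mf2S k : measurable_fun (S k) (f2 \o P) by apply: measurable_funS mf2P.
pose E k t := S k `&` [set s | (t%:E < f2 (P s))%E].
have mE k : measurable_fun (`]0%R, +oo[%classic : set R) (fun t => (K k)%:E * lam (E k t))%E.
  apply: measurable_funeM; apply: measurable_nonincreasing => // s t st.
  by apply: le_lam; apply: setIS => x /=; apply: le_lt_trans; rewrite lee_fin.
rewrite (layer_cake _ mf2)//.
apply: (@le_trans _ _ (\int[lam]_(t in `]0%R, +oo[)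
   \sum_(0 <= k <oo) ((K k)%:E * lam (E k t)))%E).
  apply: ge0_le_integral => //.
  - apply: measurable_nonincreasing => // s t st.
    by apply: le_lam; apply: setIS => x /=; apply: le_lt_trans; rewrite lee_fin.
  - apply: ge0_emeasurable_sum => [k t _ _|k _]; last exact: mE.
    by rewrite mule_ge0// lee_fin ltW.
  move=> t _.
  apply: (@le_trans _ _ (lam (P @` (`[0%R, L1]%classic `\` \bigcup_k S k)) +
     lam (\bigcup_k (P @` E k t)))%E).
    apply: le_trans (outer_measureU2 (@wlength R idfun)^*%mu _ _).
    apply: le_lam => u [/=]; rewrite in_itv/= => /Psurj[s sL <-] tf.
    have [[k _ Sk]|nS] := pselect ((\bigcup_k S k) s).
      by right; exists k => //; exists s.
    by left; exists s => //; split => //=; rewrite in_itv.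
  rewrite Pnull add0e; apply: le_trans (lam_sigma_subadditive _) _.
  apply: lee_nneseries => [k _ _|k _]; first by rewrite measure_ge0.
  apply: (lam_image_le uc (K0 k)).
  - by move=> s [/SL sL _]; exact: PL.
  - move=> s s' [/SL/andP[s0 _] _] [/SL/andP[_ s'L] _] ss'; exact: Pm.
  - by move=> s s' [Ss _] [Ss' _]; exact: PK Ss Ss'.
rewrite integral_nneseries//; last first.
  by move=> k t _; rewrite mule_ge0// lee_fin ltW.
apply: (@le_trans _ _ (\sum_(0 <= k <oo) \int[lam]_(s in S k) f1 s)%E).
  apply: lee_nneseries => [k _ _|k _].
    by apply: integral_ge0 => t _; rewrite mule_ge0// lee_fin ltW.
  rewrite ge0_integralZl//; last 2 first.
  - apply: measurable_nonincreasing => // s t st.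
    by apply: le_lam; apply: setIS => x /=; apply: le_lt_trans; rewrite lee_fin.
  - by rewrite lee_fin ltW.
  have := layer_cake (mS k) (mf2S k) (fun s _ => f20 (P s)); rewrite /= => <-.
  rewrite -ge0_integralZl//; [|exact: mS|exact: mf2S|by rewrite lee_fin ltW].
  apply: ge0_le_integral => //.
  - exact: mS.
  - by move=> s _; apply: mule_ge0; [rewrite lee_fin ltW|exact: f20].
  - by apply: measurable_funeM; exact: mf2S.
  - by apply: measurable_funS mf1 => //; exact: SL'.
  - by move=> s; exact: f21.
have mU : measurable_fun (\bigcup_k S k) f1.
  by apply: measurable_funS mf1 => //; exact: bigcup_sub.
have := @ge0_integral_bigcup _ _ _ lam S f1 mS mU (fun s _ => f10 s) tS.
rewrite /= => <-.
apply: ge0_subset_integral => //; first exact: bigcupT_measurable.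
exact: bigcup_sub.
Qed.

End Reparam.

(** * Sard's theorem and nearly affine pieces *)

Section Derivative.
Variables (R : realType) (n : nat).
Local Notation V := 'rV[R]_n.+1.
Implicit Types (f : V -> V) (x y h : V).

Lemma diff_jacmx f x h : differentiable f x -> 'd f x h = h *m jacmx f x.
Proof.
move=> df; rewrite {1}(row_sum_delta h) linear_sum; apply/rowP => j.
rewrite !mxE summxE; apply: eq_bigr => i _.
by rewrite linearZ !mxE.
Qed.

Lemma diff_approx f x (e : R) : differentiable f x -> 0 < e ->
  exists2 d, 0 < d & forall y, `|y - x| < d ->
    `|f y - f x - (y - x) *m jacmx f x| <= e * `|y - x|.
Proof.
move=> df e0.
have /eqaddoP /(_ e e0) /nbhs_ballP[d /= d0 hd] := diff_locally df.
exists d => // y yx; have := hd (y - x); rewrite -ball_normE /ball_/= sub0r normrN => /(_ yx).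
by rewrite !fctE/= subrK diff_jacmx// opprD addrA.
Qed.

End Derivative.

(** * Compact sets on which an infinitesimal condition holds uniformly *)

Section Decomposition.
Variables (R : realType) (n : nat).
Local Notation V := 'rV[R]_n.+1.
Implicit Types (x y u v : V).
Variables (D : set V) (f : V -> V) (K : countType) (k0 : K) (Q : K -> V -> V -> Prop).
Hypothesis oD : open D.
Hypothesis cf : {within D, continuous f}.
Hypothesis cQ : forall k, closed [set p : V * V | Q k p.1 p.2].

(* [k] ranges over countably many candidate behaviours of the increment [f y - f x] against [y - x]. *)
Definition near_cond k x := exists2 d, 0 < d &
  forall y, D y -> `|y - x| < d -> Q k (f y - f x) (y - x).

Lemma cont_at x : D x -> {for x, continuous f}.
Proof. by move: cf; rewrite continuous_open_subspace// => h Dx; apply: h; exact: mem_set. Qed.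

(** The points of a cube at which the condition holds already at the scale [d]. If 2 r < d, any two
    points of the cell satisfy it relative to each other. *)
Definition cell (k : K) (d r : R) (c : V) : set V :=
  [set x : V | [/\ forall i, c ord0 i - r <= x ord0 i <= c ord0 i + r &
    forall y, D y -> `|y - x| < d -> Q k (f y - f x) (y - x)]].

(** Failure of [Q] is an open condition and [f] is continuous: if it failed at a limit point [x]
    against some [y], it would fail against the same [y] at nearby points of the cell. *)
Lemma cell_compact k d r c : box (c - const_mx r) (c + const_mx r) `<=` D ->
  compact (cell k d r c).
Proof.
set B := box _ _ => BD.
have cB : cell k d r c `<=` B by move=> x [h _] i; rewrite !mxE.
apply: bounded_closed_compact.
  exists (`|c| + `|r|); split; first exact: num_real.
  move=> M hM x [h _]; apply/ltW/(le_lt_trans _ hM); apply: rV_norm_le => [|i].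
    by rewrite addr_ge0.
  have /andP[h1 h2] := h i; have := coord_le_norm c i; have := ler_norm r.
  by rewrite !ler_norml => h3 /andP[h4 h5]; apply/andP; split; lra.
move=> x clx; have Bx : B x by apply: (closed_box (closure_subset cB clx)).
split; first by move=> i; have := Bx i; rewrite !mxE.
move=> y Dy yx; apply: contrapT => nQ.
have cx := cont_at (BD _ Bx).
have /nbhs_ballP[e /= e0 he] : nbhs (f y - f x, y - x) (~` [set p : V * V | Q k p.1 p.2]).
  by apply: open_nbhs_nbhs; split => //; exact: closed_openC.
have : \forall z \near x, `|y - z| < d /\ ~ Q k (f y - f z) (y - z).
  have /nbhs_ballP[r1 /= r10 hr1] : \forall z \near x, ball (f x) e (f z).
    by apply: (cx (ball (f x) e)); exact: nbhsx_ballx.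
  have m0 : 0 < Num.min r1 (Num.min e (d - `|y - x|)) by rewrite !lt_min r10 e0 subr_gt0.
  apply/nbhs_ballP; exists (Num.min r1 (Num.min e (d - `|y - x|))) => // z.
  rewrite -ball_normE /ball_/= !lt_min => /and3P[zr1 ze zd]; split.
    by rewrite -(subrKA x); apply: le_lt_trans (ler_normD _ _) _; rewrite addrC -ltrBrDr.
  apply: (he (f y - f z, y - z)); split; rewrite -ball_normE /ball_/=; last first.
    by rewrite opprB addrC subrKA distrC.
  rewrite opprB addrC subrKA distrC.
  by have := hr1 z; rewrite -!ball_normE /ball_/=; apply.
by move=> /clx[z [[_ hz] [zd]]]; apply; exact: hz.
Qed.

(** The sets are the cells with scale 1/(j+1), rational centre and rational radius. *)
Lemma decomposition : exists (X : nat -> set V) (kap : nat -> K),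
  [/\ forall i, compact (X i),
      forall i x, X i x -> D x /\ near_cond (kap i) x,
      forall i x y, X i x -> X i y -> Q (kap i) (f y - f x) (y - x) &
      forall x k, D x -> near_cond k x -> exists2 i, X i x & kap i = k].
Proof.
pose T : Type := (K * nat * 'rV[rat]_n.+1 * rat)%type.
pose rc (t : T) : V := map_mx ratr t.1.2.
pose rr (t : T) : R := ratr t.2.
pose rd (t : T) : R := t.1.1.2.+1%:R^-1.
pose ok (t : T) := box (rc t - const_mx (rr t)) (rc t + const_mx (rr t)) `<=` D /\
  2 * rr t < rd t.
pose X i := if unpickle i is Some t then
   if `[< ok t >] then cell t.1.1.1 (rd t) (rr t) (rc t) else set0 else set0.
pose kap i := if unpickle i is Some t then (t : T).1.1.1 else k0.
have XP i x : X i x -> exists t : T, [/\ unpickle i = Some t, ok t & cell t.1.1.1 (rd t) (rr t) (rc t) x].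
  by rewrite /X; case: unpickle => // t; case: asboolP => // okt ct; exists t.
have rd0 t : 0 < rd t by rewrite invr_gt0.
exists X, kap; split.
- move=> i; rewrite /X; case: unpickle => [t|]; last exact: compact0.
  by case: asboolP => [[okt _]|_]; [exact: cell_compact|exact: compact0].
- move=> i x /XP[t [ti [okt _] [xB xQ]]]; split.
    by apply: okt => j; have := xB j; rewrite !mxE.
  by exists (rd t) => //; rewrite /kap ti.
- move=> i x y /XP[t [ti [okt rrd] [xB xQ]]] /XP[t']; rewrite ti => -[[<-] _ [yB yQ]].
  rewrite /kap ti; apply: xQ; first by apply: okt => j; have := yB j; rewrite !mxE.
  apply: le_lt_trans rrd; apply: rV_norm_le => [|j].
    by have := xB ord0 => /andP[h1 h2]; lra.
  have /andP[? ?] := xB j; have /andP[? ?] := yB j.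
  by rewrite !mxE ler_norml; apply/andP; split; lra.
move=> x k Dx [d d0 hd].
have /nbhs_ballP[r /= r0 xrD] : nbhs x D by exact: open_nbhs_nbhs.
have [j _ hj] := near_infty_natSinv_lt (PosNum d0).
have {}hj := hj j (leqnn j); rewrite /= in hj.
(* Below r / 2, so that a cube of half-side [q] containing [x] stays in [D]; below half the scale,
   so that the condition holds between any two of its points. *)
have [|q] := @rat_in_itvoo _ 0 (Num.min (r / 2) (j.+1%:R^-1 / 2) : R).
  by rewrite lt_min !divr_gt0.
rewrite in_itv/= lt_min => /andP[q0 /andP[qr qj]].
have /choice[c hc] : forall i : 'I_n.+1, exists c : rat,
    ratr c \in `](x ord0 i - ratr q), (x ord0 i + ratr q)[.
  by move=> i; apply: rat_in_itvoo; rewrite ltrBlDr -addrA ltrDl addr_gt0.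
pose t : T := (k, j, \row_i c i, q).
have ht : forall i, rc t ord0 i - rr t <= x ord0 i <= rc t ord0 i + rr t.
  move=> i; have := hc i; rewrite in_itv/= /rc /rr/= !mxE => /andP[? ?].
  by apply/andP; split; lra.
have okt : ok t.
  split; last by rewrite mulrC -ltr_pdivlMr.
  move=> y yB; apply: xrD; rewrite -ball_normE /ball_/=; apply: rV_norm_lt => // i.
  have := ht i; have := yB i; rewrite /rr/= !mxE => /andP[? ?] /andP[? ?].
  by rewrite ltr_norml; apply/andP; split; lra.
exists (pickle t); last by rewrite /kap pickleK.
rewrite /X pickleK asboolT//; split => // y Dy yx; apply: hd => //.
exact: lt_trans hj.
Qed.

End Decomposition.

Section Coverings.
Variables (R : realType) (n : nat).
Local Notation V := 'rV[R]_n.+1.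
Local Notation lebn := (@lebn R n.+1).
Implicit Types (x y u v : V) (A : set V).

Lemma closed_ge0_lipschitz (h : V -> V -> R) (C : R) :
  (forall u v u' v', h u v - h u' v' <= C * (`|u - u'| + `|v - v'|)) ->
  closed [set p : V * V | 0 <= h p.1 p.2].
Proof.
move=> hC [u v] cl /=; rewrite leNgt; apply/negP => h0.
pose e := - h u v / (2 * (`|C| + 1)).
have C1 : 0 < `|C| + 1 by rewrite ltr_wpDl.
have e0 : 0 < e by rewrite divr_gt0 ?oppr_gt0// mulr_gt0.
have [[u' v'] /= [h' [bu bv]]] := cl _ (nbhsx_ballx (u, v) e e0).
move: bu bv; rewrite -!ball_normE /ball_/= => bu bv.
have := hC u' v' u v; rewrite (distrC u') (distrC v') => h1.
have : h u' v' - h u v < - h u v.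
  apply: le_lt_trans h1 _.
  apply: (@le_lt_trans _ _ ((`|C| + 1) * (`|u - u'| + `|v - v'|))).
    by rewrite ler_wpM2r ?addr_ge0// ler_wpDr// ler_norm.
  have -> : - h u v = (`|C| + 1) * (e + e) by rewrite /e; field; rewrite gt_eqF.
  by rewrite ltr_pM2l// ltrD.
lra.
Qed.

(** A crude bound for the operator norm with respect to the sup norm. *)
Definition mxsum (M : 'M[R]_n.+1) : R := \sum_j \sum_i `|M i j|.

Lemma mxsum_ge0 M : 0 <= mxsum M.
Proof. by apply: sumr_ge0 => j _; exact: sumr_ge0. Qed.

Lemma norm_mulmx_le v (M : 'M[R]_n.+1) : `|v *m M| <= mxsum M * `|v|.
Proof.
apply: rV_norm_le => [|j]; first by rewrite mulr_ge0 ?mxsum_ge0.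
apply: le_trans (mulmx_coord_le _ _ _) _; rewrite ler_wpM2r//.
by rewrite /mxsum [leRHS](bigD1 j)//= lerDl sumr_ge0// => k _; exact: sumr_ge0.
Qed.

Lemma lebn_trivIset_le A (B : nat -> set V) :
  (forall i, lebn.-caratheodory (B i)) -> trivIset setT B ->
  (\sum_(0 <= i <oo) lebn (A `&` B i) <= lebn A)%E.
Proof.
move=> mB tB; have := caratheodory_lime_le mB tB A.
by apply: le_trans; rewrite leeDl// lebn_ge0.
Qed.

Lemma compact_borel A : compact A -> borel_set A.
Proof. by move=> cA; apply: borel_closed; exact: compact_closed. Qed.

Lemma seqDU_borel (X : nat -> set V) i : (forall i, borel_set (X i)) -> borel_set (seqDU X i).
Proof.
move=> bX; apply: borel_setD => //; elim/big_ind : _ => //; first exact: borel_set0.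
exact: borel_setU.
Qed.

Lemma lebn_image_pieces (f : V -> V) (X : nat -> set V) A (C : R) : 0 <= C ->
  (forall i, compact (X i)) -> A `<=` \bigcup_i X i ->
  (forall i B, B `<=` A `&` X i -> (lebn (f @` B) <= C%:E * lebn B)%E) ->
  (lebn (f @` A) <= C%:E * lebn A)%E.
Proof.
move=> C0 cX AX fX.
have mB i : lebn.-caratheodory (seqDU X i).
  by apply: borel_caratheodory; apply: seqDU_borel => j; exact: compact_borel.
apply: (@le_trans _ _ (lebn (\bigcup_i (f @` (A `&` seqDU X i))))).
  apply: le_lebn => _ [x Ax <-]; have := AX x Ax.
  by rewrite seqDU_bigcup_eq => -[i _ Xi]; exists i => //; exists x.
apply: le_trans (lebn_sigma_subadditive _) _.
apply: (@le_trans _ _ (\sum_(0 <= i <oo) C%:E * lebn (A `&` seqDU X i))%E).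
  apply: lee_nneseries => [i _ _|i _]; first exact: lebn_ge0.
  by apply: (fX i) => x [Ax [Xx _]].
rewrite nneseriesZl; last by move=> i _; exact: lebn_ge0.
rewrite lee_wpmul2l ?lee_fin//; exact: lebn_trivIset_le.
Qed.

End Coverings.

(** * Sard's theorem *)

Section Sard.
Variables (R : realType) (n : nat).
Local Notation V := 'rV[R]_n.+1.
Local Notation lebn := (@lebn R n.+1).
Implicit Types (x y u v : V) (A : set V).

(** Rational directions keep the index set of the decomposition countable. *)
Definition rdot u (w : 'rV[rat]_n.+1) : R := \sum_j u ord0 j * ratr (w ord0 j).

Lemma rdotB u u' w : rdot (u - u') w = rdot u w - rdot u' w.
Proof. by rewrite /rdot -sumrB; apply: eq_bigr => j _; rewrite !mxE mulrBl. Qed.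

Lemma rdot_le u w : `|rdot u w| <= (\sum_j `|ratr (w ord0 j) : R|) * `|u|.
Proof.
rewrite (le_trans (ler_norm_sum _ _ _))// mulr_suml; apply: ler_sum => j _.
by rewrite normrM mulrC ler_wpM2l// coord_le_norm.
Qed.

(* If [f] moves points of [A] little in the direction [w], the image is [e]-thin: change the [i]-th
   coordinate of the image to the product with [w], a shear of determinant 1. *)
Lemma lebn_flat_image (f : V -> V) A (i : 'I_n.+1) (w : 'rV[rat]_n.+1) (M e : R) :
  0 < M -> 0 < e -> w ord0 i = 1 ->
  (forall x y, A x -> A y -> `|f y - f x| <= M * `|y - x|) ->
  (forall x y, A x -> A y -> `|rdot (f y - f x) w| <= e * `|y - x|) ->
  (lebn (f @` A) <= (e * M ^+ n)%:E * lebn A)%E.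
Proof.
move=> M0 e0 wi fM fw.
pose U v : V := \row_k (if k == i then rdot v w else v ord0 k).
(* The inverse of the shear [U]: it recovers the i-th coordinate from the product with [w] and the
   other coordinates. *)
pose W : 'M[R]_n.+1 := \matrix_(j, k)
  (if k == i then (if j == i then 1 else - ratr (w ord0 j)) else (j == k)%:R).
have UW v : U v *m W = v.
  apply/rowP => k; rewrite mxE; have [->|ki] := eqVneq k i.
    rewrite (bigD1 i)//= !mxE !eqxx mulr1 {1}/rdot (bigD1 i)//= wi rmorph1 mulr1.
    rewrite -addrA -big_split/= big1 ?addr0// => j /negbTE ji.
    by rewrite !mxE ji eqxx mulrN subrr.
  rewrite (bigD1 k)//= !mxE (negbTE ki) eqxx mulr1 big1 ?addr0// => j /negbTE jk.
  by rewrite !mxE (negbTE ki) jk mulr0.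
have -> : f @` A = (fun x => x *m W) @` ((U \o f) @` A).
  by rewrite image_comp; apply: eq_imagel => x _ /=; rewrite UW.
apply: le_trans (lebn_mulmx_trig (w := fun k => (k == i) : nat) _ _ _) _.
- by move=> k; rewrite mxE; case: (eqVneq k i) => _; rewrite ?eqxx oner_neq0.
- move=> j k jk; rewrite mxE; case: (eqVneq k i) => [ki|_].
    by rewrite -ki (negbTE jk).
  by rewrite (negbTE jk) eqxx.
rewrite big1 ?mul1e; last first.
  by move=> k _; rewrite mxE; case: (eqVneq k i) => _; rewrite ?eqxx /= normr1.
pose K k := if k == i then e else M.
have -> : e * M ^+ n = \prod_k K k.
  rewrite (bigD1 i)//= {1}/K eqxx (eq_bigr (fun=> M)); last by move=> k /negbTE; rewrite /K => ->.
  by rewrite prodr_const cardC1 card_ord.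
apply: lebn_lip => [k|x y k Ax Ay]; first by rewrite /K; case: ifP.
rewrite /= !mxE /K; case: eqP => _; first by rewrite -rdotB; exact: fw.
have := coord_le_norm (f y - f x) k; rewrite !mxE => /le_trans; apply; exact: fM.
Qed.

Variables (D : set V) (f : V -> V).
Hypothesis oD : open D.
Hypothesis cf : {within D, continuous f}.

Let Z (M : nat) := [set x | [/\ D x, differentiable f x, jac f x = 0,
  mxsum (jacmx f x) + 1 <= M%:R & `|x| <= M%:R]].

(** A singular derivative takes its values in the orthogonal complement of some nonzero vector. In a
    rational direction close to that vector the increments of [f] are therefore at most [e] times
    those of the argument, and the image is thin. *)
Let lebn_image_Z (M : nat) (e : R) : (0 < M)%N -> 0 < e ->
  (lebn (f @` Z M) <= (e * M%:R ^+ n)%:E * lebn (Z M))%E.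
Proof.
move=> M0 e0; have M0' : 0 < M%:R :> R by rewrite ltr0n.
pose K : countType := ('I_n.+1 * 'rV[rat]_n.+1)%type.
pose Q (k : K) u v := [/\ k.2 ord0 k.1 = 1, 0 <= M%:R * `|v| - `|u| & 0 <= e * `|v| - `|rdot u k.2|].
have cQ k : closed [set p : V * V | Q k p.1 p.2].
  have [wk|wk] := eqVneq (k.2 ord0 k.1) 1; last first.
    rewrite (_ : [set _ | _] = set0); first exact: closed0.
    by rewrite -subset0 => p [h]; move: wk; rewrite h eqxx.
  rewrite (_ : [set _ | _] = [set p | 0 <= M%:R * `|p.2| - `|p.1|] `&`
      [set p | 0 <= e * `|p.2| - `|rdot p.1 k.2|]); last first.
    by apply/seteqP; split => p /= [].
  apply: closedI.
    apply: (@closed_ge0_lipschitz _ _ (fun u v => M%:R * `|v| - `|u|) (M%:R + 1)) => u v u' v'.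
    have h1 := lerB_dist v v'; have h2 := lerB_dist u' u; rewrite distrC in h2.
    have h3 : M%:R * (`|v| - `|v'|) <= M%:R * `|v - v'| by rewrite ler_wpM2l.
    have := normr_ge0 (u - u'); have := normr_ge0 (v - v') => h4 h5.
    have : 0 <= M%:R * `|u - u'| by rewrite mulr_ge0.
    by rewrite mulrBr in h3; rewrite mulrDl mulrDr mul1r; lra.
  pose s := \sum_j `|ratr (k.2 ord0 j) : R|.
  have s0 : 0 <= s by apply: sumr_ge0.
  apply: (@closed_ge0_lipschitz _ _ (fun u v => e * `|v| - `|rdot u k.2|) (e + s)) => u v u' v'.
  have h1 := lerB_dist v v'; have h2 := lerB_dist (rdot u' k.2) (rdot u k.2).
  rewrite -rdotB in h2; have := rdot_le (u' - u) k.2; rewrite -/s (distrC u') => h6.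
  have h3 : e * (`|v| - `|v'|) <= e * `|v - v'| by rewrite ler_wpM2l// ltW.
  have : 0 <= e * `|u - u'| by rewrite mulr_ge0// ltW.
  have : 0 <= s * `|v - v'| by rewrite mulr_ge0.
  by rewrite mulrBr in h3; rewrite mulrDl !mulrDr; lra.
have [X [kap [cX _ XQ Xcov]]] := decomposition ((ord0, 0) : K) oD cf cQ.
pose Xk k i := if kap i == k then X i else set0.
apply: (@lebn_image_pieces _ _ _ X); rewrite ?mulr_ge0 ?exprn_ge0// ?(ltW e0)//.
- move=> x [Dx dx jx xM _].
  pose J := jacmx f x.
  have /det0P[v v0 vJ] : \det J^T == 0 by rewrite det_tr; apply/eqP.
  have [i vi] : exists i, v ord0 i != 0.
    apply: contrapT => /forallNP h; move/eqP: v0; apply; apply/rowP => j; rewrite mxE.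
    by apply/eqP/negPn/negP; exact: h.
  (* Scaled so that the i-th coordinate is 1, as the shear in [lebn_flat_image] requires; the
     rational approximation keeps this coordinate exactly. *)
  pose w0 : V := (v ord0 i)^-1 *: v.
  have Jw0 (u : V) : \sum_j (u *m J) ord0 j * w0 ord0 j = 0.
    have : (u *m J *m w0^T) ord0 ord0 = 0.
      by rewrite -mulmxA -(trmxK J) -trmx_mul /w0 -scalemxAl vJ scaler0 trmx0 mulmx0 mxE.
    move=> uw; rewrite -[RHS]uw [RHS]mxE; apply: eq_bigr => j _.
    by rewrite [w0^T _ _]mxE.
  (* The linear part of the increment has norm at most M |h|; over n.+1 coordinates the rational
     approximation thus costs e / 2 times |h|. *)
  pose eta := e / (2 * (M%:R * n.+1%:R)).
  have eta0 : 0 < eta by rewrite divr_gt0// !mulr_gt0.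
  have /choice[c hc] : forall j : 'I_n.+1, exists c : rat,
      `|ratr c - w0 ord0 j| <= eta /\ (j = i -> c = 1).
    move=> j; have [->|ji] := eqVneq j i.
      by exists 1; split => //; rewrite rmorph1 mxE mulVf// subrr normr0 ltW.
    have [|q] := @rat_in_itvoo _ (w0 ord0 j - eta) (w0 ord0 j + eta); first by lra.
    rewrite in_itv/= => /andP[q1 q2]; exists q; split; last by move/eqP: ji.
    by rewrite ler_norml; apply/andP; split; lra.
  pose w : 'rV[rat]_n.+1 := \row_j c j.
  pose s := \sum_j `|ratr (w ord0 j) : R|.
  have s0 : 0 <= s by apply: sumr_ge0.
  (* The remainder of the derivative is multiplied by at most [s] when paired with [w]; this uses up
     the other half of [e]. *)
  have e20 : 0 < e / (2 * (s + 1)) by rewrite divr_gt0// mulr_gt0// ltr_wpDl.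
  have [d1 d10 hd1] := diff_approx dx ltr01.
  have [d2 d20 hd2] := diff_approx dx e20.
  have : near_cond D f Q (i, w) x.
    exists (Num.min d1 d2); first by rewrite lt_min d10.
    move=> y Dy; rewrite lt_min => /andP[/hd1 h1 /hd2 h2].
    rewrite mul1r in h1; rewrite -/J in h1 h2.
    set u := f y - f x; set h := y - x; rewrite -/u -/h in h1 h2.
    have h0 : 0 <= `|h| := normr_ge0 h.
    have hJ := norm_mulmx_le h J.
    have JM : mxsum J * `|h| <= (M%:R - 1) * `|h| by rewrite ler_wpM2r// lerBrDr.
    split.
    - by rewrite /= mxE (hc i).2.
    - have := ler_normD (u - h *m J) (h *m J); rewrite subrK; rewrite mulrBl mul1r in JM.
      lra.
    rewrite /= -/w subr_ge0.
    have -> : rdot u w = rdot (u - h *m J) w + rdot (h *m J) w by rewrite (rdotB u (h *m J)) subrK.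
    apply: le_trans (ler_normD _ _) _.
    have -> : e * `|h| = e / 2 * `|h| + e / 2 * `|h| by field.
    apply: lerD.
      apply: le_trans (rdot_le _ _) _; rewrite -/s.
      apply: (@le_trans _ _ (s * (e / (2 * (s + 1)) * `|h|))); first by rewrite ler_wpM2l.
      rewrite mulrA ler_wpM2r//.
      apply: (@le_trans _ _ ((s + 1) * (e / (2 * (s + 1))))).
        by rewrite ler_wpM2r ?(ltW e20)// lerDl.
      by rewrite le_eqVlt; apply/orP; left; apply/eqP; field; rewrite gt_eqF// ltr_wpDl.
    have -> : rdot (h *m J) w = \sum_j (h *m J) ord0 j * (ratr (w ord0 j) - w0 ord0 j).
      by under [RHS]eq_bigr do rewrite mulrBr; rewrite sumrB Jw0 subr0.
    apply: le_trans (ler_norm_sum _ _ _) _.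
    apply: (@le_trans _ _ (\sum_(j < n.+1) M%:R * `|h| * eta)).
      apply: ler_sum => j _; rewrite normrM; apply: ler_pM => //.
        apply: le_trans (coord_le_norm _ _) _; rewrite mulrBl mul1r in JM; lra.
      by rewrite mxE; exact: (hc j).1.
    rewrite sumr_const card_ord -mulr_natl; rewrite le_eqVlt; apply/orP; left; apply/eqP; rewrite /eta; field.
    by rewrite !gt_eqF.
  by move=> /(Xcov _ _ Dx)[j Xj _]; exists j.
move=> j A AX.
have [->|/set0P[x0 Ax0]] := eqVneq A set0.
  by rewrite image_set0 lebn0 mule0.
have [_ Xx0] := AX _ Ax0; have [wi _ _] := XQ j _ _ Xx0 Xx0.
apply: (lebn_flat_image M0' e0 wi) => x y Ax Ay.
  by have [_ + _] := XQ j x y (AX _ Ax).2 (AX _ Ay).2; rewrite subr_ge0.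
by have [_ _ +] := XQ j x y (AX _ Ax).2 (AX _ Ay).2; rewrite subr_ge0.
Qed.

(** The sets [Z M] exhaust the critical set. Each is bounded, hence of finite measure, and [e] in
    [lebn_image_Z] is arbitrary. *)
Lemma lebn_image_critical :
  lebn (f @` [set x | [/\ D x, differentiable f x & jac f x = 0]]) = 0%E.
Proof.
have Z0 M : (0 < M)%N -> lebn (f @` Z M) = 0%E.
  move=> M0; pose c := boxvol (const_mx (- M%:R) : V) (const_mx M%:R).
  have c0 : 0 <= c by exact: boxvol_ge0.
  have Zc : (lebn (Z M) <= c%:E)%E.
    apply: le_trans (lebn_box _ _); apply: le_lebn => x [_ _ _ _ xM] i.
    by rewrite !mxE -ler_norml (le_trans (coord_le_norm _ _)).
  apply/eqP; rewrite eq_le lebn_ge0 andbT; apply/lee_addgt0Pr => e e0; rewrite add0e.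
  pose k := M%:R ^+ n * c + 1; have k0 : 0 < k by rewrite ltr_wpDl// mulr_ge0// exprn_ge0.
  have ek : 0 < e / k by rewrite divr_gt0.
  apply: le_trans (lebn_image_Z M0 ek) _.
  apply: (@le_trans _ _ ((e / k * M%:R ^+ n)%:E * c%:E)%E).
    by rewrite lee_wpmul2l// lee_fin mulr_ge0 ?exprn_ge0// ltW.
  rewrite -EFinM lee_fin (_ : _ * c = e * ((M%:R ^+ n * c) / k)); last by ring.
  by rewrite ger_pMr// ler_pdivrMr// mul1r /k lerDl.
apply/eqP; rewrite eq_le lebn_ge0 andbT.
apply: (@le_trans _ _ (lebn (\bigcup_M (f @` Z M.+1)))).
  apply: le_lebn => _ [x [Dx dx jx] <-].
  pose M := Num.truncn (mxsum (jacmx f x) + 1 + `|x|).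
  have h : mxsum (jacmx f x) + 1 + `|x| < M.+1%:R.
    by rewrite -truncn_le_nat.
  have := normr_ge0 x; have := mxsum_ge0 (jacmx f x) => h1 h2.
  exists M => //; exists x => //; split => //; lra.
apply: le_trans (lebn_sigma_subadditive _) _.
by rewrite eseries0// => M _ _; rewrite Z0.
Qed.

End Sard.

Section MatrixBounds.
Variables (R : realType) (n : nat).
Local Notation V := 'rV[R]_n.+1.
Implicit Types (M : 'M[R]_n.+1) (h : V).

Definition mxmin M : R := inf [set enorm (h *m M) | h in [set h : V | enorm h = 1]].
Definition mxmax M : R := sup [set enorm (h *m M) | h in [set h : V | enorm h = 1]].

Lemma unit_vector : exists h : V, enorm h = 1.
Proof.
exists (delta_mx ord0 ord0); apply/eqP; rewrite -(@eqrXn2 _ 2)// ?enorm_ge0// enorm2 expr1n.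
rewrite (bigD1 ord0)//= big1 ?addr0; first by rewrite mxE !eqxx expr1n.
by move=> i /negbTE i0; rewrite mxE i0 andbF expr0n.
Qed.

Lemma enorm_mulmx_le h M : enorm (h *m M) <= n.+1%:R * mxsum M * enorm h.
Proof.
apply: le_trans (enorm_le_norm _) _; rewrite -mulrA ler_wpM2l//.
apply: le_trans (norm_mulmx_le _ _) _; rewrite ler_wpM2l ?mxsum_ge0//.
exact: norm_le_enorm.
Qed.

Lemma enorm_normalize h : h != 0 -> exists2 k : V, enorm k = 1 & h = enorm h *: k.
Proof.
move=> h0; have eh : 0 < enorm h.
  rewrite lt_neqAle enorm_ge0 andbT eq_sym; apply: contra h0 => /eqP /enorm_eq0 ->.
  exact: eqxx.
exists ((enorm h)^-1 *: h); last by rewrite scalerA divff ?scale1r// gt_eqF.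
by rewrite enormZ gtr0_norm ?invr_gt0// mulVf// gt_eqF.
Qed.

Lemma mxmin_mul_le h M : mxmin M * enorm h <= enorm (h *m M).
Proof.
have [->|/enorm_normalize[k k1 {2}->]] := eqVneq h 0; first by rewrite enorm0 mulr0 enorm_ge0.
rewrite -scalemxAl enormZ ger0_norm ?enorm_ge0// mulrC ler_wpM2l ?enorm_ge0//.
by apply: ge_inf; [exists 0 => _ [j _ <-]; exact: enorm_ge0|exists k].
Qed.

Lemma enorm_mulmx_max h M : enorm (h *m M) <= mxmax M * enorm h.
Proof.
have [->|/enorm_normalize[k k1 {1}->]] := eqVneq h 0; first by rewrite mul0mx enorm0 mulr0.
rewrite -scalemxAl enormZ ger0_norm ?enorm_ge0// mulrC ler_wpM2r ?enorm_ge0//.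
apply: ub_le_sup; last by exists k.
by exists (n.+1%:R * mxsum M) => _ [j j1 <-]; have := enorm_mulmx_le j M; rewrite j1 mulr1.
Qed.

Lemma mxmin_ge M (c : R) : (forall h, c * enorm h <= enorm (h *m M)) -> c <= mxmin M.
Proof.
move=> hc; have [k k1] := unit_vector; apply: lb_le_inf; first by exists (enorm (k *m M)), k.
by move=> _ [h h1 <-]; have := hc h; rewrite h1 mulr1.
Qed.

Lemma mxmax_le M (c : R) : (forall h, enorm (h *m M) <= c * enorm h) -> mxmax M <= c.
Proof.
move=> hc; have [k k1] := unit_vector; apply: sup_le_ub; first by exists (enorm (k *m M)), k.
by move=> _ [h h1 <-]; have := hc h; rewrite h1 mulr1.
Qed.

Lemma mxmin_gt0 M : M \in unitmx -> 0 < mxmin M.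
Proof.
move=> uM; pose c := n.+1%:R * mxsum (invmx M) + 1.
have c0 : 0 < c by rewrite ltr_wpDl// mulr_ge0// mxsum_ge0.
apply: (@lt_le_trans _ _ c^-1); first by rewrite invr_gt0.
apply: mxmin_ge => h; rewrite mulrC ler_pdivrMr//.
have := enorm_mulmx_le (h *m M) (invmx M); rewrite mulmxK//.
move=> /le_trans; apply; rewrite mulrC ler_wpM2l ?enorm_ge0//.
by rewrite /c lerDl.
Qed.

Lemma mxmax_gt0 M : M \in unitmx -> 0 < mxmax M.
Proof.
move=> uM; apply: lt_le_trans (mxmin_gt0 uM) _; have [k k1] := unit_vector.
have := mxmin_mul_le k M; have := enorm_mulmx_max k M; rewrite k1 !mulr1 => h1 h2.
exact: le_trans h2 h1.
Qed.

Lemma prod_near (I : Type) (r : seq I) (a b : I -> R) (d : R) : 0 <= d ->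
  (forall i, `|a i| <= 1) -> (forall i, `|b i - a i| <= d) ->
  `|\prod_(i <- r) b i - \prod_(i <- r) a i| <= \prod_(i <- r) (1 + d) - 1.
Proof.
move=> d0 a1 ba; elim: r => [|i r IH]; first by rewrite !big_nil !subrr normr0.
rewrite !big_cons; set B := \prod_(j <- r) b j in IH *.
set A := \prod_(j <- r) a j in IH *; set P := \prod_(j <- r) (1 + d) in IH *.
have BP : `|B| <= P.
  rewrite normr_prod; apply: ler_prod => j _; rewrite normr_ge0/=.
  have := ler_normD (b j - a j) (a j); rewrite subrK; have := a1 j; have := ba j; lra.
have -> : b i * B - a i * A = (b i - a i) * B + a i * (B - A) by ring.
apply: le_trans (ler_normD _ _) _; rewrite !normrM.
have h1 : `|b i - a i| * `|B| <= d * P by apply: ler_pM.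
have h2 : `|a i| * `|B - A| <= 1 * (P - 1) by apply: ler_pM.
lra.
Qed.

(** Termwise in the Leibniz formula; each of the [c] permutations receives the error e / c. *)
Lemma det_near1 (e : R) : 0 < e -> exists2 d, 0 < d &
  forall M, (forall i j, `|(M - 1%:M) i j| <= d) -> `|\det M - 1| <= e.
Proof.
move=> e0; pose c := #|{perm 'I_n.+1}|%:R : R.
have c0 : 0 < c by rewrite ltr0n; apply/card_gt0P; exists 1%g.
have ec0 : 0 < e / c by rewrite divr_gt0.
have [d d0 hd] := prod_perturb (fun _ : 'I_n.+1 => 1) ec0.
rewrite (_ : \prod_(i < n.+1) 1 = 1) in hd; last by rewrite big1.
exists d => // M hM; rewrite -(det1 R n.+1) /determinant -sumrB.
apply: le_trans (ler_norm_sum _ _ _) _.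
apply: (@le_trans _ _ (\sum_(s : {perm 'I_n.+1}) e / c)); last first.
  by rewrite sumr_const -mulr_natr -/c divfK// gt_eqF.
apply: ler_sum => s _; rewrite -mulrBr normrM normr_sign mul1r.
apply: le_trans (prod_near _ (ltW d0) _ _) _ => [i|i|].
- by rewrite mxE; case: (_ == _); rewrite ?normr1 ?normr0.
- by have := hM i (s i); rewrite [X in `|X| <= _ -> _]mxE [X in `|_ + X| <= _ -> _]mxE.
by rewrite lerBlDl.
Qed.

Lemma lmin_mxmin (f : V -> V) x : differentiable f x -> lmin f x = mxmin (jacmx f x).
Proof.
move=> df; rewrite /lmin /mxmin; congr inf; apply: eq_imagel => h _.
by rewrite diff_jacmx.
Qed.

Lemma opnorm_mxmax (f : V -> V) x : differentiable f x -> opnorm f x = mxmax (jacmx f x).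
Proof.
move=> df; rewrite /opnorm /mxmax; congr sup; apply: eq_imagel => h _.
by rewrite diff_jacmx.
Qed.

End MatrixBounds.

(** * Distortion on a single nearly affine piece *)

Section RegularPiece.
Variables (R : realType) (n : nat).
Local Notation V := 'rV[R]_n.+1.
Local Notation lebn := (@lebn R n.+1).
Implicit Types (x y u v h : V) (A : set V) (B : 'M[R]_n.+1).
Variables (D : set V) (f : V -> V) (X : set V) (B : 'M[R]_n.+1) (e s tau : R).
Hypothesis uB : B \in unitmx.
Hypothesis XB : forall x y, X x -> X y ->
  `|(f y - f x) *m B - (y - x)| <= e * `|y - x|.
Hypothesis e0 : 0 <= e.
Hypothesis es : n.+1%:R * e <= s.
Hypothesis s1 : s < 1.
Hypothesis stau : (1 + s) / (1 - s) <= tau.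

Let s0 : 0 <= s. Proof. by apply: le_trans es; rewrite mulr_ge0. Qed.
Let s1' : 0 < 1 - s. Proof. by rewrite subr_gt0. Qed.
Let e_le_s : e <= s.
Proof. by apply: le_trans es; rewrite ler_peMl// ler1n. Qed.
Let e1 : 0 < 1 - e.
Proof. by rewrite subr_gt0; exact: le_lt_trans e_le_s s1. Qed.

Lemma bernoulli_sub m (d : R) : 0 <= d -> d <= 1 -> 1 - m%:R * d <= (1 - d) ^+ m.
Proof.
move=> d0 d1; elim: m => [|m IH]; first by rewrite mul0r subr0.
rewrite exprS -natr1; have := ler_wpM2l (_ : 0 <= 1 - d) IH.
move=> /(_ ltac:(by rewrite subr_ge0)); apply: le_trans.
have : 0 <= m%:R * d * d by rewrite !mulr_ge0.
lra.
Qed.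

(** Bernoulli's inequality: [s] is at least n.+1 times [e], so 1 - s absorbs all n.+1 factors 1 -
    e. *)
Let pow_tau : (1 - e) ^- n.+1 <= tau.
Proof.
apply: le_trans stau; apply: (@le_trans _ _ (1 - s)^-1).
  rewrite lef_pV2 ?posrE ?exprn_gt0//; apply: le_trans (bernoulli_sub _ _ _) => //.
    by rewrite lerB.
  by rewrite -subr_ge0 ltW.
by rewrite ler_peMl ?invr_ge0 ?(ltW s1')// lerDl.
Qed.

(** [f] followed by [B] is (1 + e)-Lipschitz on [X], and undoing [B] multiplies volumes by at most
    |det B|^-1. *)
Lemma lebn_image_le A : A `<=` X -> (lebn (f @` A) <= (tau * `|\det B|^-1)%:E * lebn A)%E.
Proof.
move=> AX; pose g x := f x *m B.
have -> : f @` A = (fun x => x *m invmx B) @` (g @` A).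
  by rewrite image_comp; apply: eq_imagel => x _ /=; rewrite /g mulmxK.
have uT : invmx B \in unitmx by rewrite unitmx_inv.
apply: le_trans (lebn_mulmx _ uT) _.
rewrite det_inv normfV mulrC EFinM -muleA lee_wpmul2l ?lee_fin ?invr_ge0//.
have ge1 : 0 < 1 + e by rewrite ltr_pwDl.
apply: (@le_trans _ _ ((\prod_(i < n.+1) (1 + e))%:E * lebn A)%E).
  apply: lebn_lip => // x y i Ax Ay.
  have := coord_le_norm (g y - g x) i; rewrite [X in `|X| <= _]mxE [X in `|_ + X|]mxE.
  move=> /le_trans; apply; rewrite /g -mulmxBl.
  have := XB (AX _ Ax) (AX _ Ay); set a := _ *m B; set b := y - x => h.
  by have := ler_normD (a - b) b; rewrite subrK mulrDl mul1r; lra.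
rewrite lee_wpmul2r ?lebn_ge0// lee_fin prodr_const card_ord; apply: le_trans pow_tau.
(* The power of 1 + e is bounded by that of (1 - e)^-1, because (1 + e)(1 - e) <= 1. *)
rewrite -[leLHS]mul1r -[leRHS]mul1r ler_pdivlMr ?exprn_gt0// mul1r -exprMn.
rewrite exprn_ile1//; first by rewrite mulr_ge0 ?(ltW ge1)// ltW.
by have : 0 <= e * e; [rewrite mulr_ge0|lra].
Qed.

(** [f] followed by [B] is injective on [A], and its inverse [k] is Lipschitz with constant (1 -
    e)^-1. *)
Lemma lebn_le_image A : A `<=` X -> (lebn A <= (tau * `|\det B|)%:E * lebn (f @` A))%E.
Proof.
move=> AX; pose g x := f x *m B.
have gA x y : A x -> A y -> (1 - e) * `|y - x| <= `|g y - g x|.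
  move=> Ax Ay; rewrite /g -mulmxBl.
  have := XB (AX _ Ax) (AX _ Ay); set a := _ *m B; set b := y - x => h.
  by have := ler_normB a (a - b); rewrite subKr mulrBl mul1r; lra.
pose k z := get [set x | A x /\ g x = z].
have kP z : (g @` A) z -> A (k z) /\ g (k z) = z.
  move=> [x Ax xz]; have : exists x, [set x | A x /\ g x = z] x by exists x.
  by move=> /getPex.
have kg x : A x -> k (g x) = x.
  move=> Ax; have [Ak gk] := kP (g x) ltac:(by exists x).
  have := gA _ _ Ax Ak; rewrite gk subrr normr0 pmulr_rle0// normr_le0 subr_eq0.
  by move/eqP.
have {1}-> : A = k @` (g @` A).
  rewrite image_comp; apply/seteqP; split => [x Ax|_ [x Ax <-]] /=; last by rewrite kg.
  by exists x => //=; rewrite kg.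
apply: (@le_trans _ _ ((\prod_(i < n.+1) (1 - e)^-1)%:E * lebn (g @` A))%E).
  apply: lebn_lip => [i|x y i /kP[Ax kx] /kP[Ay ky]]; first by rewrite invr_gt0.
  have := coord_le_norm (k y - k x) i; rewrite [X in `|X| <= _]mxE [X in `|_ + X|]mxE.
  by move=> /le_trans; apply; rewrite mulrC ler_pdivlMr// mulrC -{2}ky -{2}kx; exact: gA.
rewrite prodr_const card_ord exprVn.
have -> : g @` A = (fun x => x *m B) @` (f @` A) by rewrite image_comp.
apply: (@le_trans _ _ (((1 - e) ^- n.+1)%:E * (`|\det B|%:E * lebn (f @` A)))%E).
  by rewrite lee_wpmul2l ?lee_fin ?invr_ge0 ?exprn_ge0 ?(ltW e1)//; exact: lebn_mulmx.
rewrite muleA -EFinM lee_wpmul2r ?lebn_ge0// lee_fin ler_wpM2r//.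
Qed.

Let T := invmx B.

(** The passage from the sup norm to the Euclidean norm costs a factor n.+1, turning [e] into
    [s]. *)
Let enorm_gB u v : `|u *m B - v| <= e * `|v| -> enorm (u *m B - v) <= s * enorm v.
Proof.
move=> h; apply: le_trans (enorm_le_norm _) _.
apply: (@le_trans _ _ (n.+1%:R * (e * enorm v))).
  rewrite ler_wpM2l//; apply: le_trans h _; rewrite ler_wpM2l//; exact: norm_le_enorm.
by rewrite mulrA ler_wpM2r ?enorm_ge0.
Qed.

Lemma piece_chord_ge x y : X x -> X y ->
  mxmin T * (1 - s) * enorm (y - x) <= enorm (f y - f x).
Proof.
move=> Xx Xy; have := enorm_gB (XB Xx Xy); set u := f y - f x; set v := y - x => h.
have h1 := mxmin_mul_le (u *m B) T; rewrite mulmxK// in h1.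
apply: le_trans h1; rewrite -mulrA ler_wpM2l//.
  by rewrite ltW// mxmin_gt0// unitmx_inv.
have := enormD (v - u *m B) (u *m B); rewrite subrK (enormB v); lra.
Qed.

Lemma piece_chord_le x y : X x -> X y ->
  enorm (f y - f x) <= mxmax T * (1 + s) * enorm (y - x).
Proof.
move=> Xx Xy; have := enorm_gB (XB Xx Xy); set u := f y - f x; set v := y - x => h.
have h1 := enorm_mulmx_max (u *m B) T; rewrite mulmxK// in h1.
apply: le_trans h1 _; rewrite -mulrA ler_wpM2l//.
  by rewrite ltW// mxmax_gt0// unitmx_inv.
have := enormD (u *m B - v) v; rewrite subrK; lra.
Qed.

Variables (x : V) (d : R).
Hypothesis d0 : 0 < d.
Hypothesis oD : open D.
Hypothesis Dx : D x.
Hypothesis near_x : forall y, D y -> `|y - x| < d ->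
  `|(f y - f x) *m B - (y - x)| <= e * `|y - x|.
Hypothesis df : differentiable f x.
Let J := jacmx f x.

(** The derivative inherits the condition on increments: apply it at x + t h, divide by [t], and let
    the error [r] tend to 0. *)
Lemma jac_near_inverse h : `|h *m J *m B - h| <= e * `|h|.
Proof.
apply/ler_addgt0Pr => r r0.
have [->|h0] := eqVneq h 0; first by rewrite !mul0mx subr0 normr0 mulr0 add0r ltW.
have nh : 0 < `|h| by rewrite normr_gt0.
pose m := mxsum B + 1; have m0 : 0 < m by rewrite ltr_wpDl// mxsum_ge0.
(* Chosen so that the remainder of the derivative, after multiplication by [B], is at most t r. *)
pose r' := r / (m * `|h|); have r'0 : 0 < r' by rewrite divr_gt0// mulr_gt0.
have [d1 d10 hd1] := diff_approx df r'0.
have /nbhs_ballP[d2 /= d20 hd2] : nbhs x D by exact: open_nbhs_nbhs.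
pose t := Num.min d (Num.min d1 d2) / (2 * `|h|).
have min0 : 0 < Num.min d (Num.min d1 d2) by rewrite !lt_min d0 d10.
have t0 : 0 < t by rewrite divr_gt0// mulr_gt0.
pose y := x + t *: h.
have yx : y - x = t *: h by rewrite /y addrC addKr.
have nyx : `|y - x| < Num.min d (Num.min d1 d2).
  rewrite yx normrZ gtr0_norm// /t -mulrA invfM -mulrA mulVf ?gt_eqF// mulr1.
  by rewrite ltr_pdivrMr// ltr_pMr// ltr1n.
move: (nyx); rewrite !lt_min => /and3P[yd yd1 yd2].
have Dy : D y by apply: hd2; rewrite -ball_normE /ball_/= distrC.
have h1 := near_x Dy yd; have h2 := hd1 _ yd1.
rewrite -/J yx in h1 h2; set u := f y - f x in h1 h2.
have h3 := norm_mulmx_le (u - (t *: h) *m J) B.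
have h4 := ler_normB (u *m B - t *: h) ((u - (t *: h) *m J) *m B).
have E : u *m B - t *: h - (u - (t *: h) *m J) *m B = t *: (h *m J *m B - h).
  by rewrite (mulmxBl u) opprB addrC subrKA scalerBr !scalemxAl.
rewrite E in h4; rewrite normrZ (gtr0_norm t0) in h1. rewrite normrZ (gtr0_norm t0) in h2. rewrite normrZ (gtr0_norm t0) in h4.
have h5 : mxsum B * `|u - t *: h *m J| <= m * (r' * (t * `|h|)).
  by apply: ler_pM => //; rewrite ?mxsum_ge0// /m lerDl.
have h6 : m * (r' * (t * `|h|)) = t * r by rewrite /r'; field; rewrite !gt_eqF.
rewrite -(ler_pM2l t0) mulrDr.
have h7 : e * (t * `|h|) = t * (e * `|h|) by ring.
lra.
Qed.

Hypothesis detB : forall M : 'M[R]_n.+1,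
  (forall i j, `|(M - 1%:M) i j| <= e) -> `|\det M - 1| <= 1 - tau^-1.

Let tau1 : 1 <= tau.
Proof.
apply: le_trans stau; rewrite ler_pdivlMr// mul1r.
by have := s0; lra.
Qed.

Lemma piece_jac : tau^-1 <= `|jac f x| * `|\det B| <= tau.
Proof.
have tau0 : 0 < tau by exact: lt_le_trans ltr01 tau1.
have := detB (M := J *m B) _; rewrite det_mulmx -/(jac f x) -normrM => h.
have {}h : `|jac f x * \det B - 1| <= 1 - tau^-1.
  apply: h => i j.
  have := coord_le_norm (delta_mx ord0 i *m J *m B - delta_mx ord0 i) j.
  have := jac_near_inverse (delta_mx ord0 i); rewrite -mulmxA -rowE => h2 h1.
  have h3 : `|delta_mx ord0 i : V| <= 1.
    by apply: rV_norm_le => // k; rewrite mxE; case: (_ && _); rewrite ?normr1 ?normr0.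
  rewrite -[leRHS]mulr1; apply: le_trans (ler_wpM2l e0 h3); apply: le_trans h2.
  by apply: le_trans h1; rewrite !mxE eqxx/= (eq_sym j).
have h1 := lerB_dist (jac f x * \det B) 1; have h2 := lerB_dist 1 (jac f x * \det B).
rewrite normr1 in h1 h2; rewrite distrC in h2.
apply/andP; split; first by lra.
(* The determinant bound 1 - tau^-1 also gives the upper estimate, since tau + tau^-1 >= 2. *)
suff : 2 - tau^-1 <= tau by lra.
rewrite -(ler_pM2r tau0) mulrBl mulVf ?gt_eqF//.
by have := sqr_ge0 (tau - 1); rewrite expr2; lra.
Qed.

Let uJ : J \in unitmx.
Proof.
rewrite unitmxE unitfE; have /andP[h _] := piece_jac; apply/negP => /eqP jx.
move: h; rewrite /jac jx normr0 mul0r leNgt invr_gt0 => /negP; apply.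
exact: lt_le_trans ltr01 tau1.
Qed.

Lemma piece_jac_neq0 : jac f x != 0.
Proof. by move: uJ; rewrite unitmxE unitfE. Qed.

Lemma piece_lmin_gt0 : 0 < lmin f x.
Proof. by rewrite lmin_mxmin// mxmin_gt0. Qed.

(* [h] is the vector with [h *m J = k *m T]; it is close to [k]. *)
Let preimage (k : V) : exists2 h, h *m J = k *m T & enorm (k - h) <= s * enorm h.
Proof.
exists (k *m T *m invmx J); first by rewrite mulmxKV.
have := enorm_gB (jac_near_inverse (k *m T *m invmx J)).
by rewrite mulmxKV// mulmxKV.
Qed.

(** With h J = k T, the vectors [h] and [k] differ by the factor 1 + s at most; the quotient (1 + s)
    / (1 - s) is then absorbed in [tau]. [piece_opnorm_ge] is analogous, with 1 - s. *)
Lemma piece_lmin_le : lmin f x <= tau * (mxmin T * (1 - s)).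
Proof.
rewrite lmin_mxmin//.
suff : mxmin J / (1 + s) <= mxmin T.
  have sp : 0 < 1 + s by rewrite ltr_pwDl.
  rewrite ler_pdivrMr// => /le_trans; apply.
  rewrite mulrCA ler_wpM2l//; first by rewrite ltW// mxmin_gt0// unitmx_inv.
  by rewrite -ler_pdivrMr.
have sp : 0 < 1 + s by rewrite ltr_pwDl.
apply: mxmin_ge => k; have [h hk kh] := preimage k.
rewrite -hk; apply: le_trans (mxmin_mul_le _ _).
rewrite mulrAC -mulrA ler_wpM2l//; first by rewrite ltW// mxmin_gt0.
by rewrite ler_pdivrMr//; have := enormD (k - h) h; rewrite subrK; lra.
Qed.

Lemma piece_opnorm_ge : mxmax T * (1 + s) <= tau * opnorm f x.
Proof.
rewrite opnorm_mxmax//.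
have mJ : 0 <= mxmax J by rewrite ltW// mxmax_gt0.
suff : mxmax T <= mxmax J / (1 - s).
  move=> h; apply: (@le_trans _ _ (mxmax J / (1 - s) * (1 + s))).
    by rewrite ler_wpM2r// addr_ge0.
  by rewrite mulrAC -mulrA mulrC ler_wpM2r.
apply: mxmax_le => k; have [h hk kh] := preimage k.
rewrite -hk; apply: le_trans (enorm_mulmx_max _ _) _.
rewrite -mulrA ler_wpM2l// mulrC ler_pdivlMr//.
by have := enormD (h - k) k; rewrite subrK (enormB h); lra.
Qed.

End RegularPiece.

Section RegularPieces.
Variables (R : realType) (n : nat).
Local Notation V := 'rV[R]_n.+1.
Local Notation lebn := (@lebn R n.+1).
Implicit Types (x y u v h : V) (A : set V).
Variables (D : set V) (f : V -> V).
Hypothesis oD : open D.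
Hypothesis cf : {within D, continuous f}.

(* On [X] the map [f] is, up to the factor [tau], affine with |det| = [beta]^-1, smallest
   stretching [l] and largest stretching [L]. *)
Definition regular_piece (tau : R) (X : set V) (beta l L : R) : Prop :=
  [/\ [/\ 0 < beta, 0 < l & 0 < L],
      forall A, A `<=` X -> (lebn (f @` A) <= (tau * beta^-1)%:E * lebn A)%E,
      forall A, A `<=` X -> (lebn A <= (tau * beta)%:E * lebn (f @` A))%E,
      forall x y, X x -> X y ->
        l * enorm (y - x) <= enorm (f y - f x) <= L * enorm (y - x) &
      forall x, X x -> differentiable f x ->
        [/\ jac f x != 0, 0 < lmin f x, tau^-1 <= `|jac f x| * beta <= tau,
            lmin f x <= tau * l & L <= tau * opnorm f x]].

Lemma regular_piece0 (tau : R) : regular_piece tau set0 1 1 1.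
Proof.
split => [|A|A|x y|x] //.
- move=> A0; have -> : A = set0 by apply/seteqP; split.
  by rewrite image_set0 lebn0 mule0.
- move=> A0; have -> : A = set0 by apply/seteqP; split.
  by rewrite image_set0 lebn0 mule0.
Qed.

Lemma regular_pieces (tau : R) : 1 < tau ->
  exists (X : nat -> set V) (beta l L : nat -> R),
  [/\ forall i, compact (X i) /\ X i `<=` D,
      forall i, regular_piece tau (X i) (beta i) (l i) (L i) &
      forall x, D x -> differentiable f x -> jac f x != 0 -> exists i, X i x].
Proof.
move=> tau1; have tau0 : 0 < tau by exact: lt_trans tau1.
have [d d0 hd] := @det_near1 R n (1 - tau^-1) ltac:(by rewrite subr_gt0 invf_lt1).
(* The solution of (1 + s) / (1 - s) = tau. *)
pose s := (tau - 1) / (tau + 1).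
have tp : 0 < tau + 1 by rewrite addr_gt0.
have s0 : 0 < s by rewrite divr_gt0// subr_gt0.
have s1 : s < 1 by rewrite ltr_pdivrMr// mul1r; lra.
have stau : (1 + s) / (1 - s) <= tau.
  by rewrite ler_pdivrMr ?subr_gt0// le_eqVlt; apply/orP; left; apply/eqP; rewrite /s; field; rewrite gt_eqF.
pose e := Num.min d (s / n.+1%:R).
have e0 : 0 < e by rewrite lt_min d0 divr_gt0.
have es : n.+1%:R * e <= s.
  by rewrite mulrC -ler_pdivlMr// ge_min lexx orbT.
have detB (M : 'M[R]_n.+1) : (forall i j, `|(M - 1%:M) i j| <= e) -> `|\det M - 1| <= 1 - tau^-1.
  by move=> h; apply: hd => i j; apply: le_trans (h i j) _; rewrite ge_min lexx.
(* Rational matrices, as candidates for approximate inverses of the derivative. *)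
pose K : countType := 'M[rat]_n.+1.
pose mat (k : K) : 'M[R]_n.+1 := map_mx ratr k.
pose Q (k : K) u v := mat k \in unitmx /\ 0 <= e * `|v| - `|u *m mat k - v|.
have cQ k : closed [set p : V * V | Q k p.1 p.2].
  have [uk|uk] := boolP (mat k \in unitmx); last first.
    rewrite (_ : [set _ | _] = set0); first exact: closed0.
    by rewrite -subset0 => p [h]; rewrite h in uk.
  rewrite (_ : [set _ | _] = [set p | 0 <= e * `|p.2| - `|p.1 *m mat k - p.2|]); last first.
    by apply/seteqP; split => p /= [].
  pose m := mxsum (mat k); have m0 : 0 <= m by exact: mxsum_ge0.
  apply: (@closed_ge0_lipschitz _ _ (fun u v => e * `|v| - `|u *m mat k - v|) (e + m + 1)) => u v u' v'.
  have h1 := lerB_dist v v'; have h2 := lerB_dist (u' *m mat k - v') (u *m mat k - v).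
  have h3 := norm_mulmx_le (u' - u) (mat k); rewrite -/m (distrC u') in h3.
  have h4 := ler_normB ((u' - u) *m mat k) (v' - v); rewrite (distrC v') in h4.
  have E : (u' - u) *m mat k - (v' - v) = u' *m mat k - v' - (u *m mat k - v).
    by rewrite mulmxBl !opprB addrACA [RHS]addrACA addrC [RHS]addrC; congr (_ + _); rewrite addrC.
  rewrite E in h4.
  have h5 : e * (`|v| - `|v'|) <= e * `|v - v'| by rewrite ler_wpM2l// ltW.
  have h6 : 0 <= e * `|u - u'| by rewrite mulr_ge0// ltW.
  have h7 : 0 <= m * `|v - v'| by rewrite mulr_ge0.
  have h8 := normr_ge0 (u - u').
  rewrite mulrBr in h5; rewrite !mulrDl !mulrDr !mul1r; lra.
have [X [kap [cX XD XQ Xcov]]] := decomposition (0 : K) oD cf cQ.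
have /choice[c hc] : forall i, exists c : R * R * R, regular_piece tau (X i) c.1.1 c.1.2 c.2.
  move=> i; have [->|/set0P[x0 Xx0]] := eqVneq (X i) set0.
    by exists (1, 1, 1); exact: regular_piece0.
  pose B := mat (kap i).
  have uB : B \in unitmx by have [] := XQ i _ _ Xx0 Xx0.
  have uT : invmx B \in unitmx by rewrite unitmx_inv.
  have XB x y : X i x -> X i y -> `|(f y - f x) *m B - (y - x)| <= e * `|y - x|.
    by move=> Xx Xy; have [_] := XQ i _ _ Xx Xy; rewrite subr_ge0.
  exists (`|\det B|, mxmin (invmx B) * (1 - s), mxmax (invmx B) * (1 + s)); split => /=.
  - split; first by rewrite normr_gt0 -unitfE -unitmxE.
      by rewrite mulr_gt0 ?mxmin_gt0// subr_gt0.
    by rewrite mulr_gt0 ?mxmax_gt0// addr_gt0.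
  - move=> A AX; exact: (lebn_image_le uB XB (ltW e0) es s1 stau AX).
  - move=> A AX; exact: (lebn_le_image uB XB (ltW e0) es s1 stau AX).
  - by move=> x y Xx Xy; rewrite (piece_chord_ge uB XB) ?(piece_chord_le uB XB)// ltW.
  - move=> x Xx dx; have [Dx [r r0 hr]] := XD _ _ Xx.
    have near_x y : D y -> `|y - x| < r -> `|(f y - f x) *m B - (y - x)| <= e * `|y - x|.
      by move=> Dy yx; have [_] := hr y Dy yx; rewrite subr_ge0.
    split.
    + exact: (piece_jac_neq0 (ltW e0) es s1 stau r0 oD Dx near_x dx detB).
    + exact: (piece_lmin_gt0 (ltW e0) es s1 stau r0 oD Dx near_x dx detB).
    + exact: (piece_jac (ltW e0) es s1 stau r0 oD Dx near_x dx detB).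
    + exact: (piece_lmin_le uB (ltW e0) es s1 stau r0 oD Dx near_x dx detB).
    + exact: (piece_opnorm_ge uB (ltW e0) es s1 stau r0 oD Dx near_x dx detB).
exists X, (fun i => (c i).1.1), (fun i => (c i).1.2), (fun i => (c i).2); split => //.
  by move=> i; split => // x /XD[].
move=> x Dx dx jx; pose J := jacmx f x.
have uJ : J \in unitmx by rewrite unitmxE unitfE.
pose N : R := n.+1%:R.
have N0 : 0 < N by rewrite ltr0n.
pose m := mxsum J; have m0 : 0 <= m by exact: mxsum_ge0.
have mp : 0 < m + 1 by rewrite ltr_wpDl.
(* Entrywise closeness [eta] of [B] to the inverse of [J] makes J B differ from the identity by at
   most e / 2; the other half of [e] is left for the remainder of the derivative. *)
pose eta := e / (2 * (N * N * (m + 1))).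
have eta0 : 0 < eta by rewrite divr_gt0// !mulr_gt0.
have /choice[k hk] : forall ij : 'I_n.+1 * 'I_n.+1, exists q : rat,
    `|ratr q - invmx J ij.1 ij.2| <= eta.
  move=> ij; have [|q] := @rat_in_itvoo _ (invmx J ij.1 ij.2 - eta) (invmx J ij.1 ij.2 + eta); first by lra.
  rewrite in_itv/= => /andP[q1 q2]; exists q.
  by rewrite ler_norml; apply/andP; split; lra.
pose k0 : K := \matrix_(i, j) k (i, j); pose B := mat k0.
have BJ : mxsum (B - invmx J) <= N * N * eta.
  apply: (@le_trans _ _ (\sum_(j < n.+1) \sum_(i < n.+1) eta)).
    apply: ler_sum => j _; apply: ler_sum => i _.
    by have := hk (i, j); rewrite !mxE.
  by rewrite !sumr_const !card_ord -mulrnA -mulr_natl natrM.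
have hJB h : `|h *m J *m B - h| <= e / 2 * `|h|.
  have -> : h *m J *m B - h = h *m J *m (B - invmx J) by rewrite mulmxBr mulmxK.
  apply: le_trans (norm_mulmx_le _ _) _.
  apply: (@le_trans _ _ (N * N * eta * ((m + 1) * `|h|))).
    apply: ler_pM; rewrite ?mxsum_ge0//.
    by apply: le_trans (norm_mulmx_le _ _) _; rewrite ler_wpM2r// lerDl.
  by rewrite le_eqVlt; apply/orP; left; apply/eqP; rewrite /eta; field; rewrite !gt_eqF.
(* The determinant of J B is within 1 - tau^-1 < 1 of 1, hence nonzero. *)
have uB : B \in unitmx.
  have : `|\det (J *m B) - 1| <= 1 - tau^-1.
    apply: detB => i j.
    have := coord_le_norm (delta_mx ord0 i *m J *m B - delta_mx ord0 i) j.
    have := hJB (delta_mx ord0 i); rewrite -mulmxA -rowE => h2 h1.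
    have h3 : `|delta_mx ord0 i : V| <= 1.
      by apply: rV_norm_le => // a; rewrite mxE; case: (_ && _); rewrite ?normr1 ?normr0.
    have h4 : e / 2 * `|delta_mx ord0 i : V| <= e / 2 * 1 by rewrite ler_wpM2l// divr_ge0// ltW.
    apply: (@le_trans _ _ (e / 2 * 1)); last by lra.
    apply: le_trans h4; apply: le_trans h2; apply: le_trans h1.
    by rewrite !mxE eqxx/= (eq_sym j).
  rewrite det_mulmx unitmxE unitfE => h; apply/negP => /eqP B0; move: h.
  rewrite B0 mulr0 sub0r normrN normr1; have : 0 < tau^-1 by rewrite invr_gt0.
  lra.
pose b := mxsum B; have b0 : 0 <= b by exact: mxsum_ge0.
have bp : 0 < b + 1 by rewrite ltr_wpDl.
have r0 : 0 < e / (2 * (b + 1)) by rewrite divr_gt0// mulr_gt0.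
have [r rp hr] := diff_approx dx r0.
have : near_cond D f Q k0 x.
  exists r => // y Dy /hr h1; split => //; rewrite subr_ge0 -/B -/J in h1 *.
  set u := f y - f x in h1 *; set h := y - x in h1 *.
  have -> : u *m B - h = (u - h *m J) *m B + (h *m J *m B - h) by rewrite (mulmxBl u) addrA subrK.
  apply: le_trans (ler_normD _ _) _.
  have -> : e * `|h| = e / 2 * `|h| + e / 2 * `|h| by field.
  apply: lerD => //; apply: le_trans (norm_mulmx_le _ _) _.
  apply: (@le_trans _ _ ((b + 1) * (e / (2 * (b + 1)) * `|h|))).
    by apply: ler_pM => //; rewrite lerDl.
  by rewrite le_eqVlt; apply/orP; left; apply/eqP; field; rewrite gt_eqF.
by move=> /(Xcov _ _ Dx)[i Xi _]; exists i.
Qed.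

End RegularPieces.

(** * Line integrals along a curve and its image *)

Section Arcs.
Variables (R : realType) (n : nat).
Local Notation V := 'rV[R]_n.+1.
Local Notation lam := (@lebesgue_measure R).
Implicit Types (g : curve R n.+1) (rho : V -> \bar R) (a b s t u : R).

Definition rect_arc g a b : Prop :=
  [/\ a <= b,
      forall u v, a <= u -> u <= v -> v <= b -> (clength g u v < +oo)%E &
      forall t e, a <= t -> t <= b -> 0 < e -> exists2 d, 0 < d &
        forall u, a <= u -> u <= b -> `|u - t| < d -> enorm (cpath g u - cpath g t) < e].

Definition len g u v : R := fine (clength g u v).

Lemma rect_arc_unit_speed g a b : rect_arc g a b ->
  unit_speed (arcparam g a b) (len g a b).
Proof.
move=> [ab fin cont]; split.
- exact: ell_ge0.
- exact: (arcparam_lip ab fin cont).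
- exact: (arc_length_le ab fin).
Qed.

Lemma borel_preimage (c : R -> V) (L : R) (B : set V) : 0 <= L ->
  (forall s s' : R, 0 <= s -> s <= L -> 0 <= s' -> s' <= L -> enorm (c s - c s') <= `|s - s'|) ->
  borel_set B -> measurable (`[0, L]%classic `&` c @^-1` B : set R).
Proof.
move=> L0 clip; suff H : @borel_set R n.+1 `<=` [set A : set V | measurable (`[0, L]%classic `&` c @^-1` A : set R)].
  exact: H.
apply: smallest_sub.
  split.
  - by rewrite /= preimage_set0 setI0.
  - move=> A /= mA; rewrite setTD preimage_setC.
    rewrite (_ : _ `&` _ = `[0, L]%classic `\` (`[0, L]%classic `&` c @^-1` A)).
      exact: measurableD.
    by apply/seteqP; split => s /=; [move=> [sL nA]; split => // -[]|move=> [sL nA]; split => // cA; apply: nA].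
  - move=> F mF; rewrite /= preimage_bigcup setI_bigcupr; exact: bigcupT_measurable.
(* [c] is controlled on [0, L] only; composed with the retraction [cl] onto this interval it is
   continuous on the whole line. *)
move=> U oU /=; pose cl s := Num.max 0 (Num.min s L).
have cl0 s : 0 <= cl s by rewrite le_max lexx.
have clL s : cl s <= L by rewrite ge_max L0 ge_min lexx orbT.
have cl_lip s s' : `|cl s - cl s'| <= `|s - s'|.
  rewrite /cl; case: (leP s L) => sL; case: (leP s' L) => s'L.
  - case: (leP 0 s) => s0; case: (leP 0 s') => s'0; rewrite ?subrr ?normr0//; rewrite ler_norml; have := ler_norm (s - s'); have := ler_norm (- (s - s')); rewrite normrN => ? ?; apply/andP; split; lra.
  - case: (leP 0 s) => s0; case: (leP 0 L) => s'0; rewrite ?subrr ?normr0//; rewrite ler_norml; have := ler_norm (s - s'); have := ler_norm (- (s - s')); rewrite normrN => ? ?; apply/andP; split; lra.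
  - case: (leP 0 L) => s0; case: (leP 0 s') => s'0; rewrite ?subrr ?normr0//; rewrite ler_norml; have := ler_norm (s - s'); have := ler_norm (- (s - s')); rewrite normrN => ? ?; apply/andP; split; lra.
  - by rewrite subrr normr0.
rewrite (_ : _ `&` _ = `[0, L]%classic `&` (c \o cl) @^-1` U); last first.
  have clE s : 0 <= s <= L -> cl s = s.
    by move=> /andP[s0 sL]; rewrite /cl (min_idPl sL) (max_idPr s0).
  by apply/seteqP; split => s /= []; rewrite in_itv/= => sL; rewrite clE.
apply: measurableI => //; apply: open_measurable; rewrite openE => s /= Us.
have /nbhs_ballP[r /= r0 hr] : nbhs (c (cl s)) U by exact: open_nbhs_nbhs.
apply/nbhs_ballP; exists r => // s'; rewrite -ball_normE /ball_/= => ss'.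
apply: hr; rewrite -ball_normE /ball_/=; apply: le_lt_trans ss'.
apply: le_trans (norm_le_enorm _) _; apply: le_trans (clip _ _ _ _ _ _) _ => //.
Qed.

Lemma borel_fun_comp rho (c : R -> V) (L : R) : borel_fun rho -> 0 <= L ->
  (forall s s' : R, 0 <= s -> s <= L -> 0 <= s' -> s' <= L -> enorm (c s - c s') <= `|s - s'|) ->
  measurable_fun (`[0, L]%classic : set R) (rho \o c).
Proof.
move=> brho L0 clip mD; apply: (measurability _ (ErealGenOInfty.measurableE R)) => //.
move=> /= _ [_ [r ->]] <-; rewrite comp_preimage.
apply: (borel_preimage L0 clip).
rewrite (_ : _ @^-1` _ = [set x | (r%:E < rho x)%E]); first exact: brho.
by apply/seteqP; split => x /=; rewrite in_itv/= andbT.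
Qed.

Lemma monotone_preimage (P : R -> R) (L : R) (A : set R) : 0 <= L ->
  (forall s s' : R, 0 <= s -> s <= s' -> s' <= L -> P s <= P s') ->
  measurable A -> measurable (`[0, L]%classic `&` P @^-1` A).
Proof.
move=> L0 Pm mA; pose cl s := Num.max 0 (Num.min s L).
have cl0 s : 0 <= cl s by rewrite le_max lexx.
have clL s : cl s <= L by rewrite ge_max L0 ge_min lexx orbT.
have clm s s' : s <= s' -> cl s <= cl s'.
  move=> ss'; rewrite /cl; apply: le_max2 => //; exact: le_min2.
rewrite (_ : _ `&` _ = `[0, L]%classic `&` (P \o cl) @^-1` A); last first.
  have clE s : 0 <= s <= L -> cl s = s.
    by move=> /andP[s0 sL]; rewrite /cl (min_idPl sL) (max_idPr s0).
  by apply/seteqP; split => s /= []; rewrite in_itv/= => sL; rewrite clE.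
apply: nondecreasing_measurable => //.
by move=> s s' ss' /=; apply: Pm => //; exact: clm.
Qed.

Section compare.
Variables (g1 g2 : curve R n.+1) (a b : R).
Hypothesis arc1 : rect_arc g1 a b.
Hypothesis arc2 : rect_arc g2 a b.
Local Notation l1 := (len g1 a).
Local Notation l2 := (len g2 a).
Hypothesis l12 : forall u v, a <= u -> u <= v -> v <= b -> l1 u = l1 v -> l2 u = l2 v.

Let ab : a <= b. Proof. by case: arc1. Qed.

Let L10 : 0 <= l1 b. Proof. exact: ell_ge0. Qed.
Let L20 : 0 <= l2 b. Proof. exact: ell_ge0. Qed.

(* the length function of [g2] expressed through the arc length of [g1] *)
Definition reparam (s : R) : R := l2 (get [set t | a <= t <= b /\ l1 t = s]).

Lemma reparam_len t : a <= t <= b -> reparam (l1 t) = l2 t.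
Proof.
move=> /andP[at_ tb]; rewrite /reparam.
have /getPex : exists u, [set u | a <= u <= b /\ l1 u = l1 t] u by exists t; rewrite /= at_ tb.
set u := get _ => -[/andP[au ub] e].
have [ut|/ltW tu] := leP u t; first by apply: l12.
by apply/esym/l12.
Qed.

Lemma len_surj1 s : 0 <= s <= l1 b -> exists2 t, a <= t <= b & l1 t = s.
Proof. by move=> /andP[s0 sL]; case: arc1 => ab' fin cont; exact: (ell_surj ab fin cont). Qed.

Lemma len_mono1 u v : a <= u -> u <= v -> v <= b -> l1 u <= l1 v.
Proof. by case: arc1 => _ fin _ au uv vb; exact: (ell_mono fin). Qed.

Lemma len_mono2 u v : a <= u -> u <= v -> v <= b -> l2 u <= l2 v.
Proof. by case: arc2 => _ fin _ au uv vb; exact: (ell_mono fin). Qed.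

Lemma arcparam1 t : a <= t <= b -> arcparam g1 a b (l1 t) = cpath g1 t.
Proof. by case: arc1 => _ fin _ /andP[au ub]; exact: (arcparam_ell fin). Qed.

Lemma arcparam2 t : a <= t <= b -> arcparam g2 a b (l2 t) = cpath g2 t.
Proof. by case: arc2 => _ fin _ /andP[au ub]; exact: (arcparam_ell fin). Qed.

Lemma reparam_mono s s' : 0 <= s -> s <= s' -> s' <= l1 b -> reparam s <= reparam s'.
Proof.
move=> s0 ss' s'L; have [|t tab ts] := @len_surj1 s; first by rewrite s0 (le_trans ss').
have [|t' tab' ts'] := @len_surj1 s'; first by rewrite (le_trans s0).
rewrite -ts -ts' !reparam_len//.
have [/andP[at_ tb] /andP[at' tb']] := (tab, tab').
have [tt'|/ltW t't] := leP t t'; first exact: len_mono2.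
have e : l1 t' = l1 t by apply/eqP; rewrite eq_le len_mono1//= ts ts'.
by rewrite (l12 at' t't tb e).
Qed.

Lemma reparam_range s : 0 <= s <= l1 b -> 0 <= reparam s <= l2 b.
Proof.
move=> /len_surj1[t tab <-]; rewrite reparam_len//; move/andP: tab => [at_ tb].
by rewrite ell_ge0// len_mono2.
Qed.

Lemma reparam_preimage (B : set V) : borel_set B ->
  measurable (`[0, l1 b]%classic `&` (fun s => arcparam g2 a b (reparam s)) @^-1` B).
Proof.
move=> bB; have [_ clip _] := rect_arc_unit_speed arc2.
have := monotone_preimage L10 reparam_mono (borel_preimage L20 clip bB).
rewrite (_ : _ `&` _ = `[0, l1 b]%classic `&` (fun s => arcparam g2 a b (reparam s)) @^-1` B)//.
apply/seteqP; split => s /= [sL]; first by case.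
by move=> Bs; split => //; split => //; move: sL; rewrite !in_itv/=; exact: reparam_range.
Qed.

(** [integral_reparam] in terms of the common parameter [t] of two curves. A curve and its image
    under [f] will take either role. *)
Lemma arc_compare (S : nat -> set R) (kap : nat -> R) (rho1 rho2 : V -> \bar R) :
  (forall k, 0 < kap k) -> (forall k, measurable (S k)) -> trivIset setT S ->
  (forall k s, S k s -> 0 <= s <= l1 b) ->
  (forall k t t', a <= t <= b -> a <= t' <= b -> S k (l1 t) -> S k (l1 t') ->
    enorm (cpath g2 t' - cpath g2 t) <= kap k * enorm (cpath g1 t' - cpath g1 t)) ->
  lam (l2 @` [set t | a <= t <= b /\ forall k, ~ S k (l1 t)]) = 0%E ->
  borel_fun rho1 -> borel_fun rho2 ->
  (forall x, 0 <= rho1 x)%E -> (forall x, 0 <= rho2 x)%E ->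
  (forall k t, a <= t <= b -> S k (l1 t) ->
    ((kap k)%:E * rho2 (cpath g2 t) <= rho1 (cpath g1 t))%E) ->
  (\int[lam]_(u in `[0%R, l2 b]) rho2 (arcparam g2 a b u) <=
   \int[lam]_(u in `[0%R, l1 b]) rho1 (arcparam g1 a b u))%E.
Proof.
move=> kap0 mS tS SL Skap Snull b1 b2 r10 r20 r12.
have us1 := rect_arc_unit_speed arc1; have us2 := rect_arc_unit_speed arc2.
have [_ clip1 _] := us1; have [_ clip2 _] := us2.
apply: (@integral_reparam _ _ (arcparam g2 a b) (l1 b) (l2 b) reparam S kap
  (rho1 \o arcparam g1 a b) (rho2 \o arcparam g2 a b)) => //.
- exact: reparam_range.
- move=> u /andP[u0 uL]; case: arc2 => _ fin2 cont2.
  have [t tab tu] := ell_surj ab fin2 cont2 u0 uL.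
  exists (l1 t); last by rewrite reparam_len.
  by move/andP: tab => [at_ tb]; rewrite ell_ge0// len_mono1.
- exact: reparam_mono.
- apply/eqP; rewrite eq_le measure_ge0 andbT -Snull; apply: le_lam => _ [s [/= sL nS] <-].
  move: sL; rewrite in_itv/= => /len_surj1[t tab ts].
  exists t; last by rewrite -ts reparam_len.
  by split => // k; rewrite ts => Sk; apply: nS; exists k.
- move=> k s s' Ss Ss' ss'.
  have [t tab ts] := len_surj1 (SL _ _ Ss); have [t' tab' ts'] := len_surj1 (SL _ _ Ss').
  rewrite -ts -ts' !reparam_len// !arcparam2//.
  apply: le_trans (Skap k t t' tab tab' _ _) _; rewrite ?ts ?ts'//.
  rewrite ler_pM2l// -!arcparam1//.
  have /andP[? ?] := SL _ _ Ss; have /andP[? ?] := SL _ _ Ss'.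
  apply: le_trans (clip1 _ _ _ _ _ _) _; rewrite ?ts ?ts'//.
  by rewrite ger0_norm// subr_ge0.
- exact: borel_fun_comp.
- exact: borel_fun_comp.
- move=> mD; apply: (measurability _ (ErealGenOInfty.measurableE R)) => //.
  move=> /= _ [_ [r ->]] <-.
  have := reparam_preimage (b2 r).
  rewrite (_ : _ `&` _ = `[0, l1 b]%classic `&` ((rho2 \o arcparam g2 a b) \o reparam) @^-1` `]r%:E, +oo[%classic)//.
  by apply/seteqP; split => s /= [sL h]; split => //; move: h; rewrite /= ?in_itv/= ?andbT.
- by move=> s; exact: r10.
- by move=> s; exact: r20.
- move=> k s Ss; have [t tab ts] := len_surj1 (SL _ _ Ss).
  rewrite -ts /= reparam_len// arcparam1// arcparam2//; apply: r12 => //.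
  by rewrite ts.
Qed.

End compare.
End Arcs.

Section Curves.
Variables (R : realType) (n : nat).
Local Notation V := 'rV[R]_n.+1.
Local Notation lam := (@lebesgue_measure R).
Implicit Types (g : curve R n.+1) (rho : V -> \bar R) (a b s t u v : R).

Lemma itv_mem_between (i : interval R) a b u : a \in i -> b \in i -> a <= u -> u <= b -> u \in i.
Proof. by move=> ai bi au ub; apply: (@interval_is_interval _ i a b) => //; rewrite au ub. Qed.

Lemma loc_rect_arc g a b : is_curve g -> loc_rectifiable g ->
  a \in cdom g -> b \in cdom g -> a <= b -> rect_arc g a b.
Proof.
move=> [_ cg] rg ag bg ab.
have mem u : a <= u -> u <= b -> u \in cdom g by exact: itv_mem_between.
split=> // [u v au uv vb|t e at_ tb e0].
  by apply: rg => //; apply: mem => //; [exact: le_trans uv vb|exact: le_trans au uv].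
have e'0 : 0 < e / n.+1%:R by rewrite divr_gt0.
have tg := mem t at_ tb.
have : within [set` cdom g] (nbhs t) (cpath g @^-1` ball (cpath g t) (e / n.+1%:R)).
  rewrite nbhs_subspace_in//.
  exact: (cg t (ball (cpath g t) (e / n.+1%:R)) (nbhsx_ballx _ _ e'0)).
move=> /nbhs_ballP[d /= d0 hd]; exists d => // u au ub ut.
have ug := mem u au ub; have := hd u; rewrite -!ball_normE /ball_/= distrC => /(_ ut ug) h.
apply: le_lt_trans (enorm_le_norm _) _.
by rewrite distrC mulrC -ltr_pdivlMr.
Qed.

Lemma fcurve_is_curve (D : set V) (f : V -> V) g : open D -> {within D, continuous f} ->
  curve_in D g -> is_curve (fcurve f g).
Proof.
move=> oD cf [[g0 cg] gD]; split => //= t.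
have [tg|tg] := pselect ([set` cdom g] t).
  apply: (@continuous_comp _ _ _ (cpath g : subspace [set` cdom g] -> V) f).
    exact: cg.
  by apply: (cont_at oD cf); apply: gD; exists t.
(* Points outside the interval are isolated in the subspace topology. *)
move=> A /nbhs_singleton At.
have H : nbhs_subspace (A := [set` cdom g]) t ((f \o cpath g) @^-1` A).
  by rewrite -(@nbhs_subspace_out R [set` cdom g] t tg) => _ ->.
exact: H.
Qed.

Lemma integral_pinfty_set rho (c : R -> V) (L : R) (G : set V) : borel_fun rho ->
  borel_set G -> unit_speed c L -> (forall x, 0 <= rho x)%E ->
  (forall x, G x -> rho x = +oo%E) -> lam (`[0, L]%classic `&` c @^-1` G) <> 0%E ->
  (\int[lam]_(u in `[0%R, L]) rho (c u) = +oo)%E.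
Proof.
move=> brho bG [L0 clip _] r0 rG lamG.
have mG := borel_preimage L0 clip bG.
have mr := borel_fun_comp brho L0 clip.
apply/eqP; rewrite -leye_eq.
have := @ge0_subset_integral _ _ _ lam _ _ mG (measurable_itv _) _ mr (fun x _ => r0 (c x)) (@subIsetl _ _ _).
apply: le_trans; rewrite (eq_integral (fun=> +oo%E)); last first.
  by move=> x /set_mem [_ /rG] /=.
rewrite integral_cst// gt0_mulye// lt_neqAle measure_ge0 andbT eq_sym.
exact/eqP.
Qed.

Lemma len_slength g a t : a <= t -> slength g a t = len g a t.
Proof. by rewrite /slength /len => ->. Qed.

Lemma null1_lam (A : set R) : null1 A <-> lam A = 0%E.
Proof. exact: negligible_outer_measure. Qed.

Section pair.
Variables (f : V -> V) (g : curve R n.+1).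
Hypothesis cg : is_curve g.
Hypothesis cfg : is_curve (fcurve f g).
Hypothesis rg : loc_rectifiable g.
Hypothesis rfg : loc_rectifiable (fcurve f g).

(** A curve of length 0 is constant, and so is its image. *)
Lemma len_fcurve_eq0 u v : u \in cdom g -> v \in cdom g -> u <= v ->
  len g u v = 0 -> len (fcurve f g) u v = 0.
Proof.
move=> ug vg uv l0.
have [_ fin1 cont1] := loc_rect_arc cg rg ug vg uv.
have [_ fin2 cont2] := loc_rect_arc cfg rfg ug vg uv.
have cst t : u <= t -> t <= v -> cpath g t = cpath g u.
  move=> ut tv; apply/eqP; rewrite -subr_eq0; apply/eqP/enorm_eq0/eqP.
  rewrite eq_le enorm_ge0 andbT.
  have := ell_append fin1 (lexx u) (lexx u) ut tv.
  have := ell_mono fin1 (lexx u) ut tv (lexx v).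
  rewrite (ellxx fin1 (lexx u) uv) -!/(len _ _ _) l0; lra.
apply/eqP; rewrite eq_le (ell_ge0 _ uv) andbT.
have := @ell_le _ _ _ _ _ fin2 (fun=> 0) u v (lexx u) uv (lexx v).
rewrite subrr; apply => s t us st tv /=.
by rewrite !cst ?subrr ?enorm0//; [exact: le_trans st tv|exact: le_trans us st].
Qed.

Lemma slength_eq_len0 (h : curve R n.+1) t0 t u : is_curve h -> loc_rectifiable h ->
  t0 \in cdom h -> t \in cdom h -> u \in cdom h -> t <= u ->
  slength h t0 t = slength h t0 u <-> len h t u = 0.
Proof.
move=> ch rh t0h th uh tu; rewrite /slength.
have pos x y : x <= y -> 0 <= len h x y by exact: ell_ge0.
have add x y z : x \in cdom h -> z \in cdom h -> x <= y -> y <= z ->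
    len h x z = len h x y + len h y z.
  move=> xh zh xy yz; have [_ fin _] := loc_rect_arc ch rh xh zh (le_trans xy yz).
  by apply: (ell_add fin) => //; exact: le_trans xy yz.
rewrite -!/(len _ _ _).
have [t0t|tt0] := leP t0 t.
  have := add t0 t u t0h uh t0t tu; rewrite (le_trans t0t tu) => ->.
  by split => h1; lra.
have [t0u|ut0] := leP t0 u.
  have := add t t0 u th uh (ltW tt0) t0u => ->.
  have := pos _ _ (ltW tt0); have := pos _ _ t0u; split => h1; lra.
have := add t u t0 th t0h tu (ltW ut0) => ->.
by split => h1; lra.
Qed.

(** The point picked by [get] may differ from [t], but the curve has length 0 between the two, so
    its image does as well. *)
Lemma Lfun_slength t0 t : t0 \in cdom g -> t \in cdom g ->
  Defs.Lfun f g t0 (slength g t0 t) = slength (fcurve f g) t0 t.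
Proof.
move=> t0g tg; rewrite /Defs.Lfun.
have /getPex : exists u, [set u | u \in cdom g /\ slength g t0 u = slength g t0 t] u by exists t.
set u := get _ => -[ug e].
have [ut|/ltW tu] := leP u t.
  apply/(slength_eq_len0 cfg rfg t0g ug tg ut)/len_fcurve_eq0 => //.
  exact/(slength_eq_len0 cg rg t0g ug tg ut).
apply/esym/(slength_eq_len0 cfg rfg t0g tg ug tu)/len_fcurve_eq0 => //.
exact/(slength_eq_len0 cg rg t0g tg ug tu).
Qed.

End pair.

Variables (D : set V) (f : V -> V).
Hypothesis oD : open D.
Hypothesis cf : {within D, continuous f}.
Variables (B : nat -> set V) (kap : nat -> R) (rho1 rho2 : V -> \bar R) (G : set V).
Hypothesis bB : forall k, borel_set (B k).
Hypothesis tB : trivIset setT B.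
Hypothesis kap0 : forall k, 0 < kap k.
Hypothesis b1 : borel_fun rho1.
Hypothesis b2 : borel_fun rho2.
Hypothesis r10 : forall x, (0 <= rho1 x)%E.
Hypothesis r20 : forall x, (0 <= rho2 x)%E.
Hypothesis bG : borel_set G.
Hypothesis rG : forall x, G x -> rho1 x = +oo%E.

Lemma line_int_image_le g : curve_in D g -> L1_prop f g ->
  (forall t, t \in cdom g -> ~ G (cpath g t) -> exists k, B k (cpath g t)) ->
  (forall k x y, B k x -> B k y -> enorm (f y - f x) <= kap k * enorm (y - x)) ->
  (forall k t, t \in cdom g -> B k (cpath g t) ->
    ((kap k)%:E * rho2 (f (cpath g t)) <= rho1 (cpath g t))%E) ->
  (line_int rho2 (fcurve f g) <= line_int rho1 g)%E.
Proof.
move=> gD [rg [rfg NL]] GB Bkap r12.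
have cg : is_curve g by case: gD.
have cfg := fcurve_is_curve oD cf gD.
apply: ge_ereal_sup => _ [a [b [ag [bg [ab ->]]]]].
have arc1 := loc_rect_arc cg rg ag bg ab; have arc2 := loc_rect_arc cfg rfg ag bg ab.
have us1 := rect_arc_unit_speed arc1; have [L0 clip1 _] := us1.
have mem u : a <= u <= b -> u \in cdom g.
  by move=> /andP[au ub]; exact: (itv_mem_between ag bg).
apply: (@le_trans _ _ (\int[lam]_(u in `[0%R, len g a b]) rho1 (arcparam g a b u))%E); last first.
  by apply: ereal_sup_ubound; exists a, b.
pose N := `[0, len g a b]%classic `&` arcparam g a b @^-1` G.
have [N0|N0] := pselect (lam N = 0%E); last first.
  by rewrite (integral_pinfty_set b1 bG us1 r10 rG N0) leey.
have l12 u v : a <= u -> u <= v -> v <= b -> len g a u = len g a v ->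
    len (fcurve f g) a u = len (fcurve f g) a v.
  move=> au uv vb; have av := le_trans au uv; have ub := le_trans uv vb.
  have ug : u \in cdom g by apply: mem; rewrite au ub.
  have vg : v \in cdom g by apply: mem; rewrite av vb.
  rewrite -!len_slength// => /(slength_eq_len0 cg rg ag ug vg uv) h.
  exact/(slength_eq_len0 cfg rfg ag ug vg uv)/len_fcurve_eq0.
apply: (arc_compare arc1 arc2 l12 (S := fun k => `[0, len g a b]%classic `&` arcparam g a b @^-1` B k)
   (kap := kap)) => //.
- by move=> k; exact: borel_preimage.
- move=> i j _ _ [s [[_ Bi] [_ Bj]]]; apply: (tB (i := i) (j := j)) => //.
  by exists (arcparam g a b s).
- by move=> k s [/=]; rewrite in_itv.
- move=> k t t' tab tab' [_ /=]; rewrite (arcparam1 arc1)// => Bt [_ /=].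
  by rewrite (arcparam1 arc1)// => Bt'; exact: Bkap Bt Bt'.
- apply/eqP; rewrite eq_le measure_ge0 andbT.
  have Nsub : N `<=` ldom g a.
    move=> s [/=]; rewrite in_itv/= => sL _; have [t tab ts] := len_surj1 arc1 sL.
    by exists t; [exact: mem|rewrite len_slength//; case/andP: tab].
  have /null1_lam <- := NL a ag N Nsub (proj2 (null1_lam N) N0).
  apply: le_lam => _ [t [tab nB] <-].
  have tg := mem t tab; have /andP[at_ tb] := tab.
  exists (len g a t); last by rewrite -len_slength// Lfun_slength// len_slength.
  have lL : 0 <= len g a t <= len g a b.
    by rewrite ell_ge0// (len_mono1 arc1)//.
  split; first by rewrite /= in_itv.
  rewrite /= (arcparam1 arc1)//; apply: contrapT => /(GB t tg)[k Bk].
  by apply: (nB k); split; [rewrite /= in_itv|rewrite /= (arcparam1 arc1)].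
- by move=> k t tab [_ /=]; rewrite (arcparam1 arc1)//; apply: r12; exact: mem.
Qed.

(** As for [line_int_image_le], with the curve and its image exchanged: the null set now lies on the
    side of the image, and the N^-1-property pulls it back. *)
Lemma line_int_lift_le g : curve_in D g -> L2_prop D f (fcurve f g) ->
  (forall t, t \in cdom g -> ~ G (f (cpath g t)) -> exists k, B k (cpath g t)) ->
  (forall k x y, B k x -> B k y -> enorm (y - x) <= kap k * enorm (f y - f x)) ->
  (forall k t, t \in cdom g -> B k (cpath g t) ->
    ((kap k)%:E * rho2 (cpath g t) <= rho1 (f (cpath g t)))%E) ->
  loc_rectifiable g /\ (line_int rho2 g <= line_int rho1 (fcurve f g))%E.
Proof.
move=> gD L2 GB Bkap r12.
have [rg [rfg NL]] := L2 g gD erefl (fun _ _ => erefl).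
split=> //; have cg : is_curve g by case: gD.
have cfg := fcurve_is_curve oD cf gD.
apply: ge_ereal_sup => _ [a [b [ag [bg [ab ->]]]]].
have arc2 := loc_rect_arc cg rg ag bg ab; have arc1 := loc_rect_arc cfg rfg ag bg ab.
have us1 := rect_arc_unit_speed arc1; have [L0 clip1 _] := us1.
have mem u : a <= u <= b -> u \in cdom g.
  by move=> /andP[au ub]; exact: (itv_mem_between ag bg).
pose h := fcurve f g.
apply: (@le_trans _ _ (\int[lam]_(u in `[0%R, len h a b]) rho1 (arcparam h a b u))%E); last first.
  by apply: ereal_sup_ubound; exists a, b.
pose N := `[0, len h a b]%classic `&` arcparam h a b @^-1` G.
have [N0|N0] := pselect (lam N = 0%E); last first.
  by rewrite (integral_pinfty_set b1 bG us1 r10 rG N0) leey.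
have Lab t : a <= t <= b -> Defs.Lfun f g a (len g a t) = len h a t.
  move=> tab; have /andP[at_ tb] := tab.
  by rewrite -len_slength// Lfun_slength// ?len_slength//; exact: mem.
have ldom_h s : 0 <= s <= len h a b -> ldom h a s.
  move=> sL; have [t tab ts] := len_surj1 arc1 sL.
  by exists t; [exact: mem|rewrite len_slength//; case/andP: tab].
have lrange t : a <= t <= b -> 0 <= len h a t <= len h a b.
  by move=> /andP[at_ tb]; rewrite ell_ge0// (len_mono1 arc1).
(* Where the image has length 0, the length function takes a single value. A point is a null set, so
   by the N^-1-property the lifting cannot have positive length there. *)
have l12 u v : a <= u -> u <= v -> v <= b -> len h a u = len h a v ->
    len g a u = len g a v.
  move=> au uv vb e; have av := le_trans au uv; have ub := le_trans uv vb.
  apply/eqP; rewrite eq_le (len_mono2 arc2)//= leNgt; apply/negP => luv.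
  have Q : [set len h a u] `<=` ldom h a by move=> _ ->; apply: ldom_h; apply: lrange; rewrite au ub.
  have Q0 : null1 [set len h a u] by apply/null1_lam; exact: lebesgue_measure_set1.
  have /null1_lam Z := NL a ag _ Q Q0.
  suff : (lam `]len g a u, len g a v[%classic <= 0)%E.
    by rewrite lebesgue_measure_itv/= lte_fin luv -EFinB lee_fin leNgt subr_gt0 luv.
  rewrite -Z; apply: le_lam => s /=; rewrite in_itv/= => /andP[us sv].
  have [|t tab ts] := @len_surj1 _ _ _ _ _ arc2 s.
    by rewrite (le_trans _ (ltW us)) ?ell_ge0// (le_trans (ltW sv))// (len_mono2 arc2).
  have /andP[at_ tb] := tab.
  split; first by exists t; [exact: mem|rewrite len_slength].
  rewrite /= -ts Lab//.
  have ut : u <= t.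
    rewrite leNgt; apply/negP => /ltW tu; move: us; rewrite -ts ltNge => /negP; apply.
    exact: (len_mono2 arc2).
  have tv : t <= v.
    rewrite leNgt; apply/negP => /ltW vt; move: sv; rewrite -ts ltNge => /negP; apply.
    exact: (len_mono2 arc2).
  apply/eqP; rewrite eq_le {1}e !(len_mono1 arc1)//.
(* The pieces lie in the source while the parameter is the arc length of the image; hence the detour
   through [reparam]. *)
pose S k := `[0, len h a b]%classic `&`
  (fun s => arcparam g a b (reparam h g a b s)) @^-1` B k.
have SE k t : a <= t <= b -> S k (len h a t) -> B k (cpath g t).
  by move=> tab [_ /=]; rewrite (reparam_len l12)// (arcparam2 arc2).
apply: (arc_compare arc1 arc2 l12 (S := S) (kap := kap)) => //.
- by move=> k; exact: (reparam_preimage arc1 arc2 l12).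
- move=> i j _ _ [s [[_ Bi] [_ Bj]]]; apply: (tB (i := i) (j := j)) => //.
  by exists (arcparam g a b (reparam h g a b s)).
- by move=> k s [/=]; rewrite in_itv.
- by move=> k t t' tab tab' /SE-/(_ tab) Bt /SE-/(_ tab') Bt'; exact: Bkap Bt Bt'.
- apply/eqP; rewrite eq_le measure_ge0 andbT.
  have Nsub : N `<=` ldom h a by move=> s [/=]; rewrite in_itv/= => sL _; exact: ldom_h.
  have /null1_lam <- := NL a ag N Nsub (proj2 (null1_lam N) N0).
  apply: le_lam => _ [t [tab nB] <-].
  have tg := mem t tab; have /andP[at_ tb] := tab; have lL := lrange t tab.
  split; first by exists t => //; rewrite len_slength.
  rewrite /= Lab//; split; first by rewrite /= in_itv.
  change (G (arcparam (fcurve f g) a b (len (fcurve f g) a t))).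
  rewrite (arcparam1 arc1)//; apply: contrapT => /(GB t tg)[k Bk].
  apply: (nB k); split; first by rewrite /= in_itv.
  by rewrite /= (reparam_len l12)// (arcparam2 arc2).
- by move=> k t tab /SE-/(_ tab); apply: r12; exact: mem.
Qed.

End Curves.

(** * Modulus inequalities *)

Section Power.
Variable R : realType.
Local Open Scope ereal_scope.

Lemma lt_poweR (x : \bar R) (t p : R) : 0 <= x -> (0 < t)%R -> (0 < p)%R ->
  (t%:E < x `^ p) = ((t `^ p^-1)%:E < x).
Proof.
move=> x0 t0 p0.
have tE : t%:E = (t `^ p^-1)%:E `^ p.
  by rewrite poweR_EFin -powRrM mulVf ?gt_eqF// powRr1// ltW.
have xE : x = (x `^ p) `^ p^-1 by rewrite -poweRrM divff ?gt_eqF// poweRe1.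
have mono (r : R) (u v : \bar R) : (0 < r)%R -> 0 <= u -> 0 <= v -> u <= v -> u `^ r <= v `^ r.
  move=> r0 u0 v0; apply: gt0_ler_poweR => //; first exact: ltW.
    by rewrite in_itv/= u0 leey.
  by rewrite in_itv/= v0 leey.
have q0 : (0 < p^-1)%R by rewrite invr_gt0.
have tt0 : 0 <= (t `^ p^-1)%:E by rewrite lee_fin powR_ge0.
apply/idP/idP; rewrite !ltNge; apply: contra => h.
  by rewrite tE; exact: mono.
rewrite xE -[leRHS]poweR_EFin; apply: mono => //; first exact: poweR_ge0.
by rewrite lee_fin ltW.
Qed.

End Power.

Section Modulus.
Variables (R : realType) (n : nat).
Local Notation V := 'rV[R]_n.+1.
Local Notation lebn := (@lebn R n.+1).
Local Notation lam := (@lebesgue_measure R).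
Implicit Types (g h rho : V -> \bar R) (gam : curve R n.+1).
Local Open Scope ereal_scope.

Lemma lvl_poweR g (t p : R) : (forall x, 0 <= g x) -> (0 < t)%R -> (0 < p)%R ->
  lvl (fun x => g x `^ p) t = lvl g (t `^ p^-1)%R.
Proof. by move=> g0 t0 p0; apply/seteqP; split => x; rewrite /lvl/= lt_poweR. Qed.

Lemma le_line_int rho h gam : is_curve gam -> loc_rectifiable gam ->
  borel_fun rho -> borel_fun h -> (forall x, 0 <= rho x) -> (forall x, rho x <= h x) ->
  line_int rho gam <= line_int h gam.
Proof.
move=> cg rg br bh r0 rh.
apply: ge_ereal_sup => _ [a [b [ag [bg [ab ->]]]]].
have [L0 clip _] := rect_arc_unit_speed (loc_rect_arc cg rg ag bg ab).
apply: (@le_trans _ _ (\int[lam]_(u in `[0%R, fine (clength gam a b)]) h (arcparam gam a b u))).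
  apply: ge0_le_integral => //.
  - exact: (borel_fun_comp br L0 clip).
  - exact: (borel_fun_comp bh L0 clip).
by apply: ereal_sup_ubound; exists a, b.
Qed.

Lemma intn_null g (A : set V) : lebn A = 0 -> (forall x, ~ A x -> g x <= 0) -> intn g = 0.
Proof.
move=> A0 gA; apply: integral0_eq => t /=; rewrite in_itv/= andbT => t0.
apply/eqP; rewrite eq_le lebn_ge0 andbT -A0; apply: le_lebn => x /= tg.
by apply: contrapT => /gA; rewrite leNgt (lt_trans _ tg)// lte_fin.
Qed.

(* The test function need not be Borel: the maximum of [g], of an admissible function of small
   energy for [Bad] and of [+oo] on [G] is replaced by a Borel majorant with level sets of the
   same measure. *)
Lemma modulus_le_test (p : R) (Gam Bad : set (curve R n.+1)) g (G : set V) : (1 <= p)%R ->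
  modulus p Bad = 0 -> lebn G = 0 -> (forall x, 0 <= g x) ->
  (forall gam, Gam gam -> is_curve gam) ->
  (forall h, borel_fun h -> (forall x, 0 <= h x) -> (forall x, g x <= h x) ->
     (forall x, G x -> h x = +oo) ->
     forall gam, Gam gam -> loc_rectifiable gam -> Bad gam \/ 1 <= line_int h gam) ->
  modulus p Gam <= intn (fun x => g x `^ p).
Proof.
move=> p1 Bad0 G0 g0 cG test; have p0 : (0 < p)%R by exact: lt_le_trans p1.
apply/lee_addgt0Pr => e e0.
have : modulus p Bad < e%:E by rewrite Bad0 lte_fin.
move=> /ereal_inf_lt[_ [sig [bsig [sig0 sigBad]] <-] sige].
pose u x := if `[< G x >] then +oo else maxe (g x) (sig x).
have u0 x : 0 <= u x by rewrite /u; case: asboolP => // _; rewrite le_max g0.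
have [h [bh uh hu]] := borel_hull u0.
have h0 x : 0 <= h x by exact: le_trans (uh x).
have gh x : g x <= h x.
  apply: le_trans (uh x); rewrite /u; case: asboolP => _; first exact: leey.
  by rewrite le_max lexx.
have sh x : sig x <= h x.
  apply: le_trans (uh x); rewrite /u; case: asboolP => _; first exact: leey.
  by rewrite le_max lexx orbT.
have Gh x : G x -> h x = +oo.
  by move=> Gx; apply/eqP; rewrite -leye_eq; apply: le_trans (uh x); rewrite /u asboolT.
apply: (@le_trans _ _ (intn (fun x => h x `^ p))).
  apply: ereal_inf_lbound; exists h => //; split => //; split => // gam Ggam rgam.
  have [Bgam|//] := test h bh h0 gh Gh gam Ggam rgam.
  apply: le_trans (sigBad _ Bgam rgam) _.
  exact: le_line_int (cG _ Ggam) rgam bsig bh sig0 sh.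
apply: (@le_trans _ _ (intn (fun x => u x `^ p))).
  apply: intn_le; first exact: measurable_lvl.
  by move=> t t0; rewrite -/(lvl _ t) !lvl_poweR//; apply: hu; rewrite powR_gt0.
pose v x := if `[< G x >] then +oo else 0 : \bar R.
pose w x := maxe (g x `^ p) (sig x `^ p).
apply: (@le_trans _ _ (intn v + intn w)).
  apply: intnU => t x t0; rewrite lvl_poweR// /lvl/= /u /v /w.
  case: asboolP => _; first by left; rewrite ltry.
  by rewrite lt_max -!lt_poweR// -lt_max; right.
rewrite (@intn_null v G)// ?add0e; last by move=> x; rewrite /v; case: asboolP.
apply: (@le_trans _ _ (intn (fun x => g x `^ p) + intn (fun x => sig x `^ p))).
  by apply: intnU => t x t0; rewrite /lvl/= /w lt_max => /orP.
by rewrite leeD2l// ltW.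
Qed.

Lemma le_scale_limit (x y : \bar R) (r : R) : 0 <= y -> (0 < r)%R ->
  (forall tau : R, (1 < tau)%R -> x <= (tau `^ r)%:E * y) -> x <= y.
Proof.
move=> y0 r0 h; case: y y0 h => [y| |//] y0 h; last exact: leey.
rewrite lee_fin in y0; apply/lee_addgt0Pr => e e0.
(* Then (th - 1) y <= e, and [tau] is taken to be the power of [th] with exponent 1 / r. *)
pose th := (1 + e / (y + 1))%R.
have yp : (0 < y + 1)%R by rewrite ltr_wpDl.
have th1 : (1 < th)%R by rewrite ltrDl divr_gt0.
have th0 : (0 < th)%R by exact: lt_trans th1.
have : (1 < th `^ r^-1)%R.
  have E : (1 `^ r^-1 = 1 :> R)%R by rewrite powR1.
  by rewrite -[ltLHS]E gt0_ltr_powR ?invr_gt0 ?nnegrE ?ltW.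
move=> /h; rewrite -powRrM mulVf ?gt_eqF// (powRr1 (ltW th0)) => hx.
apply: le_trans hx _.
rewrite -EFinM -EFinD lee_fin /th mulrDl mul1r lerD2l.
by rewrite mulrAC ler_pdivrMr// ler_pM2l// lerDl.
Qed.

End Modulus.

(** * Measurable images and the partition of the domain *)

Section RegularPartition.
Variables (R : realType) (n : nat).
Local Notation V := 'rV[R]_n.+1.
Local Notation lebn := (@lebn R n.+1).
Implicit Types (x y : V) (A B E X : set V) (tau beta l L : R).
Variables (D : set V) (f : V -> V).
Hypothesis oD : open D.
Hypothesis cf : {within D, continuous f}.
Hypothesis fN : N_prop D f.

Lemma caratheodory_null A : lebn A = 0%E -> lebn.-caratheodory A.
Proof.
move=> A0; apply: (@le_caratheodory_measurable _ _ (lebn_outer R n)) => X.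
rewrite [X in (X + _ <= _)%E](_ : _ = 0%E) ?add0e; first by apply: le_lebn => x [].
by apply/eqP; rewrite eq_le lebn_ge0 andbT -A0; apply: le_lebn => x [].
Qed.

(** Images of closed subsets of [X] are compact, and injectivity turns relative complements into
    relative complements, so the sets with Borel image form a sigma-algebra. *)
Lemma borel_image_compact X A : compact X -> X `<=` D -> set_inj X f ->
  borel_set A -> borel_set (f @` (X `&` A)).
Proof.
move=> cX XD iX.
have cfX B : closed B -> borel_set (f @` (X `&` B)).
  move=> cB; apply: compact_borel; apply: continuous_compact.
    by apply: continuous_subspaceW cf => x [/XD].
  exact: compact_closedI.
have diff B : f @` (X `\` B) = f @` (X `&` setT) `\` f @` (X `&` B).
  apply/seteqP; split => [_ [x [Xx Bx] <-]|_ [[x [Xx _] <-] h]].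
    split; first by exists x.
    move=> [x' [Xx' Bx'] e]; apply: Bx.
    by have <- : x' = x by apply: (iX x' x) => //; exact: mem_set.
  by exists x => //; split=> // Bx; apply: h; exists x.
move: A; apply: smallest_sub; last first.
  move=> A oA; rewrite /= -(setCK A) -setDE diff; apply: borel_setD; first exact: (cfX setT (@closedT _)).
  exact: (cfX (~` A) (open_closedC oA)).
split; first by rewrite /= setI0 image_set0; exact: borel_set0.
- move=> B bB; rewrite /= setTD -setDE diff; apply: borel_setD => //.
  exact: (cfX setT (@closedT _)).
- move=> F bF; rewrite /= setI_bigcupr image_bigcup; exact: borel_bigcup.
Qed.

(** Let [H] be a Borel hull of the complement of [E] in [X]. Then [E] consists of the Borel set X \
    H and the part of [E] in [H], which is null because [X] has finite measure; the N-property keeps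
    its image null. *)
Lemma caratheodory_image X E : compact X -> X `<=` D -> set_inj X f ->
  lebn.-caratheodory E -> E `<=` X -> lebn.-caratheodory (f @` E).
Proof.
move=> cX XD iX mE EX.
have fin : (lebn X < +oo)%E.
  have [M [_ hM]] := compact_bounded cX.
  apply: le_lt_trans (ltry (boxvol (const_mx (- (M + 1)) : V) (const_mx (M + 1)))).
  apply: le_trans (lebn_box _ _); apply: le_lebn => x Xx i.
  rewrite !mxE -ler_norml (le_trans (coord_le_norm _ _))//.
  by apply: hM => //; rewrite ltrDl.
have [H [bH XEH lH]] := lebn_hull (X `\` E).
have HE0 : lebn (E `&` H) = 0%E.
  have h := mE (H `&` X); rewrite (_ : H `&` X `&` ~` E = X `\` E) in h; last first.
    by apply/seteqP; split => [x [[]]//|x [Xx Ex]]; do !split => //; exact: XEH.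
  have hle : (lebn (H `&` X) <= lebn (X `\` E))%E by rewrite -lH; apply: le_lebn => x [].
  have fXE : lebn (X `\` E) \is a fin_num.
    rewrite ge0_fin_numE ?lebn_ge0//; apply: le_lt_trans fin; apply: le_lebn => x [].
    done.
  apply/eqP; rewrite eq_le lebn_ge0 andbT -(leeD2rE _ _ fXE) add0e.
  apply: le_trans hle; rewrite h leeD2r//; apply: le_lebn => x [Ex Hx].
  by split => //; split => //; exact: EX.
have -> : f @` E = f @` (X `&` ~` H) `|` f @` (E `&` H).
  rewrite -image_setU; congr image; apply/seteqP; split => [x Ex|x [[Xx Hx]|[]//]].
    by have [Hx|Hx] := pselect (H x); [right|left; split => //; exact: EX].
  by apply: contrapT => Ex; apply/Hx/XEH.
apply: (caratheodory_measurable_setU (mu := lebn_outer R n)).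
  by apply: borel_caratheodory; apply: borel_image_compact => //; exact: (borel_setC bH).
by apply/caratheodory_null/fN => // x [/EX/XD].
Qed.

Hypothesis fN' : Ninv_prop D f.
Hypothesis fD : lebn [set x | D x /\ ~ differentiable f x] = 0%E.

Lemma regular_partition tau : 1 < tau ->
  exists (G : set V) (B : nat -> set V) (beta l L : nat -> R),
  [/\ [/\ borel_set G, lebn G = 0%E & trivIset setT B],
      forall k, borel_set (B k) /\ B k `<=` D,
      forall k, regular_piece f tau (B k) (beta k) (l k) (L k),
      forall k x, B k x -> differentiable f x /\
        forall E, lebn.-caratheodory E -> lebn.-caratheodory (f @` (E `&` B k)) &
      forall x, D x -> ~ G x -> exists k, B k x].
Proof.
move=> tau1; have [X [beta [l [L [cX rX coverX]]]]] := regular_pieces oD cf tau1.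
pose Z1 := [set x | D x /\ ~ differentiable f x].
(* Sard's theorem makes the set of critical values null, and the N^-1-property then makes its whole
   preimage null. *)
pose Z2 := D `&` f @^-1` (f @` [set x | [/\ D x, differentiable f x & jac f x = 0]]).
pose Z := Z1 `|` Z2.
have Z0 : lebn Z = 0%E.
  apply/eqP; rewrite eq_le lebn_ge0 andbT.
  apply: (@le_trans _ _ (lebn Z1 + lebn Z2)%E).
    exact: (outer_measureU2 (lebn_outer R n)).
  by rewrite [lebn Z1]fD add0e [lebn Z2]fN'//; exact: lebn_image_critical oD cf.
have [G [bG ZG G0]] := lebn_hull Z; rewrite Z0 in G0.
have bX i : borel_set (X i) by apply: compact_borel; exact: (cX i).1.
have BX k : seqDU X k `\` G `<=` X k by move=> x [[]].
exists G, (fun k => seqDU X k `\` G), beta, l, L; split.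
- split => // i j _ _ [x [[xi _] [xj _]]].
  by apply: (@trivIset_seqDU _ X i j I I); exists x.
- by move=> k; split; [apply: borel_setD => //; exact: seqDU_borel|move=> x /BX/(cX k).2].
- move=> k; have [pos h1 h2 h3 h4] := rX k; split => //.
  + by move=> A AB; apply: h1; exact: subset_trans (BX k).
  + by move=> A AB; apply: h2; exact: subset_trans (BX k).
  + by move=> x y /BX Xx /BX Xy; exact: h3.
  + by move=> x /BX; exact: h4.
- move=> k x Bx; split.
    apply: contrapT => nd; case: Bx => Xx; apply; apply: ZG; left; split => //.
    by apply: (cX k).2; case: Xx.
  move=> E mE; have [[_ l0 _] _ _ hl _] := rX k.
  apply: (@caratheodory_image (X k)); [exact: (cX k).1|exact: (cX k).2| | |].
  + move=> y z /set_mem Xy /set_mem Xz fyz; apply/esym/eqP; rewrite -subr_eq0.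
    apply/eqP/enorm_eq0/eqP; rewrite eq_le enorm_ge0 andbT.
    have /andP[+ _] := hl y z Xy Xz; rewrite fyz subrr enorm0.
    by rewrite pmulr_rle0.
  + apply: (caratheodory_measurable_setI (mu := lebn_outer R n)) => //.
    by apply: borel_caratheodory; apply: borel_setD => //; exact: seqDU_borel.
  + by move=> y [_ /BX].
- move=> x Dx nGx.
  have dx : differentiable f x by apply: contrapT => nd; apply/nGx/ZG; left.
  have jx : jac f x != 0.
    by apply/eqP => j0; apply/nGx/ZG; right; split => //; exists x.
  have : (\bigcup_k X k) x by have [i Xi] := coverX x Dx dx jx; exists i.
  by rewrite seqDU_bigcup_eq => -[k _ Bk]; exists k.
Qed.

End RegularPartition.

Section Moduli.
Variables (R : realType) (n : nat).
Local Notation V := 'rV[R]_n.+1.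
Local Notation lebn := (@lebn R n.+1).
Implicit Types (x y : V) (A E : set V) (Gam : set (curve R n.+1)) (rho : V -> \bar R).
Variables (D : set V) (f : V -> V).
Hypothesis oD : open D.
Hypothesis cf : {within D, continuous f}.
Hypothesis fN : N_prop D f.
Hypothesis fN' : Ninv_prop D f.
Hypothesis fD : lebn [set x | D x /\ ~ differentiable f x] = 0%E.

Lemma KI_ge0 (q : R) x : (0 <= KI q f x)%E.
Proof.
rewrite /KI; case: asboolP => // _; case: ifP => _.
  by rewrite lee_fin divr_ge0// powR_ge0.
by case: ifP.
Qed.

(** The divisor tau^(p+2) pays for the explicit factor [tau] of the volume bound, one [tau] from the
    Jacobian, and tau^p from L <= tau |f'(x)|. [KI_ge] is the analogue for the smallest
    stretching. *)
Lemma KO_ge (tau p : R) A beta l L x : 1 < tau -> 1 <= p ->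
  regular_piece f tau A beta l L -> A x -> differentiable f x ->
  ((tau * beta * L `^ p / tau `^ (p + 2))%:E <= KO p f x)%E.
Proof.
move=> tau1 p1 [[b0 l0 L0] _ _ _ h] Ax dx; have [j0 _ /andP[_ jb] _ Lo] := h x Ax dx.
have tau0 : 0 < tau by exact: lt_trans tau1.
have p0 : 0 <= p by exact: le_trans p1.
rewrite /KO asboolT// j0 lee_fin.
have J0 : 0 < `|jac f x| by rewrite normr_gt0.
have o0 : 0 <= opnorm f x by rewrite -(pmulr_rge0 _ tau0) (le_trans _ Lo)// ltW.
have Lp : L `^ p <= tau `^ p * opnorm f x `^ p.
  by rewrite -powRM ?(ltW tau0)// ge0_ler_powR ?nnegrE ?mulr_ge0 ?(ltW L0) ?(ltW tau0).
have -> : tau `^ (p + 2) = tau `^ p * tau ^+ 2.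
  rewrite powRD; last by apply/implyP => _; rewrite gt_eqF.
  by rewrite powR_mulrn// ltW.
rewrite ler_pdivrMr ?mulr_gt0 ?powR_gt0 ?exprn_gt0//.
rewrite [leRHS]mulrAC ler_pdivlMr//.
have -> : tau * beta * L `^ p * `|jac f x| = tau * (`|jac f x| * beta) * L `^ p by ring.
have -> : opnorm f x `^ p * (tau `^ p * tau ^+ 2) = tau * tau * (tau `^ p * opnorm f x `^ p) by ring.
by rewrite ler_pM ?mulr_ge0 ?powR_ge0 ?ler_wpM2l ?(ltW tau0) ?(ltW b0).
Qed.

Lemma KI_ge (tau q : R) A beta l L x : 1 < tau -> 1 <= q ->
  regular_piece f tau A beta l L -> A x -> differentiable f x ->
  ((tau * beta^-1 * (l `^ q)^-1)%:E <= (tau `^ (q + 2))%:E * KI q f x)%E.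
Proof.
move=> tau1 q1 [[b0 l0 L0] _ _ _ h] Ax dx; have [j0 lm0 /andP[jb _] lo _] := h x Ax dx.
have tau0 : 0 < tau by exact: lt_trans tau1.
have q0 : 0 <= q by exact: le_trans q1.
rewrite /KI asboolT// j0 -EFinM lee_fin.
have lq : lmin f x `^ q <= tau `^ q * l `^ q.
  by rewrite -powRM ?(ltW tau0) ?(ltW l0)// ge0_ler_powR ?nnegrE ?mulr_ge0 ?(ltW lm0) ?(ltW tau0) ?(ltW l0).
have -> : tau `^ (q + 2) = tau `^ q * tau ^+ 2.
  rewrite powRD; last by apply/implyP => _; rewrite gt_eqF.
  by rewrite powR_mulrn// ltW.
rewrite -ler_pdivrMl; last by rewrite mulr_gt0 ?powR_gt0 ?exprn_gt0.
rewrite ler_pdivlMr ?powR_gt0//.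
have jb' : tau^-1 * beta^-1 <= `|jac f x| by rewrite ler_pdivrMr.
apply: le_trans jb'.
have lq0 : 0 < l `^ q by rewrite powR_gt0.
have tq0 : 0 < tau `^ q by rewrite powR_gt0.
apply: (@le_trans _ _ ((tau `^ q * tau ^+ 2)^-1 * (tau * beta^-1 * (l `^ q)^-1) * (tau `^ q * l `^ q))).
  rewrite ler_wpM2l// !mulr_ge0 ?invr_ge0 ?mulr_ge0 ?(ltW tau0) ?(ltW b0) ?exprn_ge0 ?(ltW tau0) ?powR_ge0//.
rewrite le_eqVlt; apply/orP; left; apply/eqP; field.
by rewrite !gt_eqF.
Qed.

(** One preimage of [y] is chosen in every piece whose image contains [y]. They are distinct because
    the pieces are disjoint, so their contributions form a finite part of the sum over all
    preimages. *)
Lemma KIinv_ge (p : R) E (B : nat -> set V) (c : nat -> R) N y : trivIset setT B ->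
  (forall k x, (E `&` B k) x -> ((c k)%:E <= KO p f x)%E) ->
  ((\sum_(k < N | `[< (f @` (E `&` B k)) y >]) c k)%:E <= KIinv p f E y)%E.
Proof.
move=> tB hc.
have /choice[x hx] : forall k, exists x, (f @` (E `&` B k)) y -> (E `&` B k) x /\ f x = y.
  move=> k; have [[x Bx fx]|nB] := pselect ((f @` (E `&` B k)) y).
    by exists x.
  by exists point.
pose s := [seq x k | k <- index_iota 0 N & `[< (f @` (E `&` B k)) y >]].
have us : uniq s.
  rewrite map_inj_in_uniq; first by rewrite filter_uniq ?iota_uniq.
  move=> i j; rewrite !mem_filter => /andP[/asboolP /hx[[_ Bi] _] _] /andP[/asboolP /hx[[_ Bj] _] _] e.
  apply: (tB i j I I); exists (x i); split => //.
  by rewrite e.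
apply: esum_ge; exists [set` s].
  split; first exact: finite_seq.
  move=> _ /= /mapP[k + ->]; rewrite mem_filter => /andP[/asboolP /hx[[Ex _] fx] _].
  by split.
rewrite -fsbig_seq// big_map big_filter big_mkord -sumEFin.
by apply: lee_sum => k /asboolP /hx[Bx _]; exact: hc Bx.
Qed.

Lemma modulus_source_le (p tau : R) E Gam rho : 1 <= p -> 1 < tau ->
  ae_curve p D (L1_prop f) -> leb_measurable E -> E `<=` D ->
  (forall g, Gam g -> curve_in E g) -> admissible (fimage f Gam) rho ->
  (modulus p Gam <=
     (tau `^ (p + 2))%:E * intn_on (f @` E) (fun y => KIinv p f E y * rho y `^ p))%E.
Proof.
move=> p1 tau1 aeL mE ED GE [brho [rho0 adm]].
have p0 : 0 < p by exact: lt_le_trans p1.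
have tau0 : 0 < tau by exact: lt_trans tau1.
have [G [B [beta [l [L [[bG G0 tB] bB rB dB coverB]]]]]] := regular_partition oD cf fN fN' fD tau1.
pose r k x := if `[< (E `&` B k) x >] then ((L k)%:E * rho (f x))%E else 0%E.
have L0 k : 0 < L k by have [[_ _ ?]] := rB k.
have b0 k : 0 < beta k by have [[]] := rB k.
have r0 k x : (0 <= r k x)%E.
  by rewrite /r; case: asboolP => // _; rewrite mule_ge0// lee_fin ltW.
pose rs x := ereal_sup [set r k x | k in setT].
have r_le k x : (r k x <= rs x)%E by apply: ereal_sup_ubound; exists k.
have rs0 x : (0 <= rs x)%E by exact: le_trans (r_le 0%N x).
apply: (@le_trans _ _ (intn (fun x => rs x `^ p)%E)).
  apply: (modulus_le_test p1 aeL G0 rs0) => [gam /GE[]//|h bh h0 rsh Gh gam Ggam rgam].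
  have [L1|nL1] := pselect (L1_prop f gam); last first.
    left; split => //; have [cgam gE] := GE _ Ggam.
    by split => //; exact: subset_trans ED.
  right; have gamE := GE _ Ggam.
  have inE t : t \in cdom gam -> E (cpath gam t) by move=> tg; apply: gamE.2; exists t.
  have gamD : curve_in D gam by split; [exact: gamE.1|exact: subset_trans gamE.2 ED].
  have [_ [rfg _]] := L1.
  apply: le_trans (adm _ _ rfg) _; first by exists gam.
  apply: (line_int_image_le oD cf (fun k => (bB k).1) tB L0 bh brho h0 rho0 bG Gh gamD L1).
  - by move=> t tg; apply: coverB; exact/ED/inE.
  - by move=> k x y Bx By; have [_ _ _ /(_ x y Bx By)/andP[]] := rB k.
  - move=> k t tg Bt; apply: le_trans (rsh _); apply: le_trans (r_le k _).
    by rewrite /r asboolT//; split => //; exact: inE.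
pose F k := f @` (E `&` B k).
apply: (@le_trans _ _ (\sum_(0 <= k <oo) intn (fun x => r k x `^ p)%E)%E).
  apply: intn_sigma_subadditive => t x t0.
  rewrite lvl_poweR// => /ereal_sup_gt[_ [k _ <-]] h.
  by exists k; rewrite lvl_poweR.
(* The lower bound of [KO] on the piece [B k] furnished by [KO_ge]. *)
pose c k := tau * beta k * L k `^ p / tau `^ (p + 2).
have tp0 : 0 < tau `^ (p + 2) by rewrite powR_gt0.
have c0 k : 0 <= c k by rewrite divr_ge0 ?mulr_ge0 ?powR_ge0 ?ltW.
have rint k : (intn (fun x => r k x `^ p) <=
    (tau `^ (p + 2))%:E * ((c k)%:E * intn_on (F k) (fun y => rho y `^ p)))%E.
  rewrite muleA -EFinM [X in (X%:E * _)%E](_ : _ = tau * beta k * L k `^ p); last first.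
    by rewrite mulrC divfK// gt_eqF.
  (* Volumes on the piece change by at most tau beta, and the values of the test function to the
     power [p] by L^p. *)
  apply: intn_compare; rewrite ?powR_gt0 ?mulr_ge0 ?ltW// => t t0.
  have [_ _ hle _ _] := rB k.
  have sub : lvl (fun x => r k x `^ p)%E t `<=` B k.
    move=> x; rewrite lvl_poweR// /lvl/= /r; case: asboolP => [[]//|_].
    by rewrite lte_fin ltNge powR_ge0.
  apply: le_trans (hle _ sub) _; apply: lee_wpmul2l.
    by rewrite lee_fin mulr_ge0// ltW.
  apply: le_lebn => _ [x + <-]; rewrite lvl_poweR// /lvl/= /r.
  case: asboolP => [EBx|_]; last by rewrite lte_fin ltNge powR_ge0.
  rewrite asboolT; last by exists x.
  rewrite -lt_poweR ?mule_ge0// ?lee_fin ?ltW// poweRM// ?lee_fin ?ltW// poweR_EFin.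
  by rewrite mulrC EFinM lte_pdivrMl ?powR_gt0// .
apply: (@le_trans _ _ (\sum_(0 <= k <oo) (tau `^ (p + 2))%:E *
    ((c k)%:E * intn_on (F k) (fun y => rho y `^ p)))%E).
  by apply: lee_nneseries => [k _ _|k _]; [exact: intn_ge0|exact: rint].
rewrite nneseriesZl; last by move=> k _; rewrite mule_ge0 ?lee_fin ?intn_on_ge0.
apply: lee_wpmul2l; first by rewrite lee_fin ltW.
apply: intn_on_mult => //.
- move=> k; have [[x Bx]|nB] := pselect (B k !=set0).
    by apply: (dB k x Bx).2; exact/leb_measurableE.
  rewrite (_ : F k = set0); first exact: caratheodory_measurable_set0.
  by rewrite -subset0 => z [x [_ Bx] _]; apply: nB; exists x.
- by move=> y; exact: poweR_ge0.
- move=> N y; case: asboolP => [fEy|nfEy].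
    rewrite lee_wpmul2r ?poweR_ge0//; apply: KIinv_ge => // k x [Ex Bx].
    exact: (KO_ge tau1 p1 (rB k) Bx (dB k x Bx).1).
  rewrite big_pred0 ?mul0e// => k; apply/asboolP => -[x [Ex _] xy].
  by apply: nfEy; exists x.
Qed.

Lemma modulus_image_le (q tau : R) Gam rho : 1 <= q -> 1 < tau ->
  ae_curve q (f @` D) (L2_prop D f) ->
  (forall g, Gam g -> curve_in D g) -> admissible Gam rho ->
  (modulus q (fimage f Gam) <=
     (tau `^ (q + 2))%:E * intn_on D (fun x => KI q f x * rho x `^ q))%E.
Proof.
move=> q1 tau1 aeL GD [brho [rho0 adm]].
have q0 : 0 < q by exact: lt_le_trans q1.
have tau0 : 0 < tau by exact: lt_trans tau1.
have [G0 [B [beta [l [L [[bG0 G00 tB] bB rB dB coverB]]]]]] := regular_partition oD cf fN fN' fD tau1.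
(* The curves to be tested lie in the image, so the exceptional set is moved there; the N-property
   keeps it null. *)
have [G [bG fG G_0]] := lebn_hull (f @` (D `&` G0)).
have {}G_0 : lebn G = 0%E.
  rewrite G_0; apply: fN => [x []//|].
  by apply/eqP; rewrite eq_le lebn_ge0 andbT -G00; apply: le_lebn => x [].
have l0 k : 0 < l k by have [[]] := rB k.
have b0 k : 0 < beta k by have [[]] := rB k.
(* The value 0 is included for points [y] without a preimage in [B k], where the supremum would
   otherwise be -oo. *)
pose r k y := ereal_sup [set s | s = 0%E \/
  exists2 x, B k x /\ f x = y & s = ((l k)^-1%:E * rho x)%E].
have r0 k y : (0 <= r k y)%E by apply: ereal_sup_ubound; left.
pose rs y := ereal_sup [set r k y | k in setT].
have r_le k y : (r k y <= rs y)%E by apply: ereal_sup_ubound; exists k.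
have rs0 y : (0 <= rs y)%E by exact: le_trans (r_le 0%N y).
apply: (@le_trans _ _ (intn (fun x => rs x `^ q)%E)).
  apply: (modulus_le_test q1 aeL G_0 rs0) => [_ [gam /GD gamD <-]|h bh h0 rsh Gh _ [gam Ggam <-] rgam].
    exact: fcurve_is_curve oD cf gamD.
  have gamD := GD _ Ggam; have cfg := fcurve_is_curve oD cf gamD.
  have inD t : t \in cdom gam -> D (cpath gam t) by move=> tg; apply: gamD.2; exists t.
  have [L2|nL2] := pselect (L2_prop D f (fcurve f gam)); last first.
    left; split => //; split => // _ [t tg <-].
    by exists (cpath gam t) => //; exact: inD.
  right.
  have kap0 k : 0 < (l k)^-1 by rewrite invr_gt0.
  have [rg le_int] : loc_rectifiable gam /\ (line_int rho gam <= line_int h (fcurve f gam))%E.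
    apply: (line_int_lift_le oD cf (fun k => (bB k).1) tB kap0 bh brho h0 rho0 bG Gh gamD L2).
    - move=> t tg nG; apply: coverB; first exact: inD.
      by move=> G0t; apply/nG/fG; exists (cpath gam t) => //; split => //; exact: inD.
    - move=> k x y Bx By; have [_ _ _ /(_ x y Bx By)/andP[h1 _] _] := rB k.
      by rewrite ler_pdivlMl.
    - move=> k t tg Bt; apply: le_trans (rsh _); apply: le_trans (r_le k _).
      by apply: ereal_sup_ubound; right; exists (cpath gam t).
  exact: le_trans (adm _ Ggam rg) le_int.
apply: (@le_trans _ _ (\sum_(0 <= k <oo) intn (fun x => r k x `^ q)%E)%E).
  apply: intn_sigma_subadditive => t x t0.
  rewrite lvl_poweR// => /ereal_sup_gt[_ [k _ <-]] h.
  by exists k; rewrite lvl_poweR.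
pose K x := (KI q f x * rho x `^ q)%E.
have K0 x : (0 <= K x)%E by rewrite mule_ge0 ?KI_ge0 ?poweR_ge0.
have tq0 : 0 < tau `^ (q + 2) by rewrite powR_gt0.
pose c k := tau * (beta k)^-1 * (l k `^ q)^-1.
have c0 k : 0 <= c k by rewrite !mulr_ge0 ?invr_ge0 ?powR_ge0 ?ltW.
have rint k : (intn (fun x => r k x `^ q) <= (tau `^ (q + 2))%:E * intn_on (B k) K)%E.
  apply: (@le_trans _ _ ((c k)%:E * intn_on (B k) (fun x => rho x `^ q))%E).
    apply: intn_compare; rewrite ?invr_gt0 ?powR_gt0 ?mulr_ge0 ?invr_ge0 ?ltW// => t t0.
    have [_ hle _ _ _] := rB k.
    set A := lvl _ (t / _).
    have AB : A `<=` B k.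
      move=> x; rewrite /A /lvl/=; case: asboolP => // _.
      by rewrite lte_fin ltNge divr_ge0 ?invr_ge0 ?powR_ge0 ?ltW.
    apply: le_trans (hle _ AB); apply: le_lebn => y.
    rewrite lvl_poweR// => /ereal_sup_gt[_ [->|[x [Bx <-] ->]]].
      by rewrite lte_fin ltNge powR_ge0.
    rewrite -lt_poweR ?mule_ge0// ?lee_fin ?invr_ge0 ?ltW// poweRM// ?lee_fin ?invr_ge0 ?ltW// poweR_EFin.
    move=> h; exists x => //; rewrite /A /lvl/= asboolT//.
    move: h; rewrite -[(l k)^-1]powR_inv1 ?ltW// -powRrM mulN1r powRN.
    by rewrite [(t / _)%R]mulrC EFinM lte_pdivrMl ?invr_gt0 ?powR_gt0.
  rewrite -(intn_onZ _ _ (c0 k)) -(intn_onZ _ _ (ltW tq0)); apply: le_intn_on => // x; last first.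
    by rewrite mule_ge0// lee_fin ltW.
  move=> Bx; rewrite /K muleA lee_wpmul2r ?poweR_ge0//.
  exact: (KI_ge tau1 q1 (rB k) Bx (dB k x Bx).1).
apply: (@le_trans _ _ (\sum_(0 <= k <oo) (tau `^ (q + 2))%:E * intn_on (B k) K)%E).
  by apply: lee_nneseries => [k _ _|k _]; [exact: intn_ge0|exact: rint].
rewrite nneseriesZl; last by move=> k _; exact: intn_on_ge0.
apply: lee_wpmul2l; first by rewrite lee_fin ltW.
(* The integrals are now over disjoint sets in the source, so no multiplicity arises. *)
apply: le_trans (intn_on_disjoint _ (fun k => borel_caratheodory (bB k).1) tB).
apply: lee_nneseries => [k _ _|k _]; first exact: intn_on_ge0.
apply: le_intn_on => // [x Bx|x]; last by case: asboolP => _ //; exact: (K0 x).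
by rewrite asboolT//; exact: (bB k).2.
Qed.

End Moduli.

Theorem theorem1p1 (R : realType) (n : nat) (D : set 'rV[R]_n) (p q : R)
    (f : 'rV[R]_n -> 'rV[R]_n) :
  (2 <= n)%N -> domain D -> 1 <= p -> 1 <= q ->
  {within D, continuous f} -> orientation_preserving D f ->
  finite_length_distortion p q D f ->
  (forall (Gam : set (curve R n)) (rho : 'rV[R]_n -> \bar R),
      (forall g, Gam g -> curve_in D g) -> admissible Gam rho ->
      (modulus q (fimage f Gam) <=
         intn_on D (fun x => KI q f x * rho x `^ q))%E) /\
  (forall (E : set 'rV[R]_n) (Gam : set (curve R n)) (rhos : 'rV[R]_n -> \bar R),
      leb_measurable E -> E `<=` D ->
      (forall g, Gam g -> curve_in E g) -> admissible (fimage f Gam) rhos ->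
      (modulus p Gam <=
         intn_on (f @` E) (fun y => KIinv p f E y * rhos y `^ p))%E).
Proof.
case: n => [//|n] in D f *; move=> _ [oD _] p1 q1 cf _ [fD [fN [fN' [aeL1 aeL2]]]].
split => [Gam rho GD adm|E Gam rho mE ED GE adm].
  apply: (@le_scale_limit R _ _ (q + 2)) => [||tau tau1]; first exact: intn_on_ge0.
    by rewrite addr_gt0 ?(lt_le_trans _ q1).
  exact: (modulus_image_le oD cf fN fN' fD q1 tau1 aeL2 GD adm).
apply: (@le_scale_limit R _ _ (p + 2)) => [||tau tau1]; first exact: intn_on_ge0.
    by rewrite addr_gt0 ?(lt_le_trans _ p1).
exact: (modulus_source_le oD cf fN fN' fD p1 tau1 aeL1 mE ED GE adm).
Qed.
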